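(* Let $n$ be a positive integer and let $X$ be a Banach space of genus $n$. Then every normalized unconditional basis of an (infinite-dimensional) complemented subspace of $X$ has a subsequence which is permutatively equivalent to the unit vector basis of $c_0$, $\ell_1$, or $\ell_2$.
   Context: Two sequences $(x_n)$, $(y_n)$ in Banach spaces are equivalent, $(x_n)\sim(y_n)$, if $Tx_n=y_n$ defines an isomorphism between their closed linear spans; they are permutatively equivalent if $(x_n)\sim(y_{\pi(n)})$ for some permutation $\pi$ of the index set. A Banach space has a unique normalized unconditional basis if it has a normalized unconditional basis and any two such bases are permutatively equivalent. A Banach space $X$ is of genus $n$ if $X$ and all its complemented subspaces with unconditional bases have a unique normalized unconditional basis, and there are, up to isomorphism, exactly $n$ different (infinite-dimensional) complemented subspaces of $X$ with unconditional bases ($X$ itself included in the count). For example, $\ell_1\oplus\ell_2$ is of genus 3. *)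

(* Defs.v *)
From HB Require Import structures.
From mathcomp Require Import all_boot all_order all_algebra.
From mathcomp Require Import all_classical all_reals all_analysis.
From mathcomp Require Import ring.
From mathcomp.real_closed Require Import complex.

Set Implicit Arguments.
Unset Strict Implicit.
Unset Printing Implicit Defensive.
Import Order.TTheory GRing.Theory Num.Theory.
Import numFieldNormedType.Exports.
Local Open Scope classical_set_scope.
Local Open Scope ring_scope.

(* Banach spaces are real or complex: they are completeNormedModTypes over
   [scalars R k], which is R or R[i]. *)
Variant scalar_kind := RealScalars | ComplexScalars.

Definition scalars (R : realType) (k : scalar_kind) : numFieldType :=
  match k with
  | RealScalars => (R : numFieldType)
  | ComplexScalars => (R[i] : numFieldType)
  end.

(* MathComp norms take their values in the scalar field.  [absv] is the modulus
   as an element of R, and [ofreal] embeds R into the scalars. *)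
Definition absv (R : realType) (k : scalar_kind) : scalars R k -> R :=
  match k with
  | RealScalars => fun x : R => `|x|
  | ComplexScalars => fun z : R[i] => complex.Re `|z|
  end.

Definition ofreal (R : realType) (k : scalar_kind) : R -> scalars R k :=
  match k with
  | RealScalars => id
  | ComplexScalars => real_complex R
  end.

Section ScalarTheory.
Variables (R : realType) (k : scalar_kind).
Local Notation K := (scalars R k).
Local Notation absv := (@absv R k).
Local Notation ofreal := (@ofreal R k).

Lemma ofreal_absv (x : K) : ofreal (absv x) = `|x|.
Proof. by case: k x => [x|[a b]]. Qed.

Lemma ofreal0 : ofreal 0 = 0.
Proof. by case: k. Qed.

Lemma ofrealD (x y : R) : ofreal (x + y) = ofreal x + ofreal y.
Proof. by case: k => //=; rewrite rmorphD. Qed.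

Lemma ofrealM (x y : R) : ofreal (x * y) = ofreal x * ofreal y.
Proof. by case: k => //=; rewrite rmorphM. Qed.

Lemma ofreal_le (x y : R) : (ofreal x <= ofreal y) = (x <= y).
Proof. by case: k => //=; rewrite lecR. Qed.

Lemma ofreal_inj : injective ofreal.
Proof. by move=> x y xy; apply/eqP; rewrite eq_le -!ofreal_le xy lexx. Qed.

Lemma absv_ge0 (x : K) : 0 <= absv x.
Proof. by rewrite -ofreal_le ofreal0 ofreal_absv. Qed.

Lemma absv0 : absv 0 = 0.
Proof. by apply: ofreal_inj; rewrite ofreal_absv ofreal0 normr0. Qed.

Lemma absv1 : absv 1 = 1.
Proof. by apply: ofreal_inj; rewrite ofreal_absv normr1; case: k. Qed.

Lemma absv0_eq0 (x : K) : absv x = 0 -> x = 0.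
Proof. by move=> x0; apply: normr0_eq0; rewrite -ofreal_absv x0 ofreal0. Qed.

Lemma absvD (x y : K) : absv (x + y) <= absv x + absv y.
Proof. by rewrite -ofreal_le ofrealD !ofreal_absv ler_normD. Qed.

Lemma absvM (x y : K) : absv (x * y) = absv x * absv y.
Proof. by apply: ofreal_inj; rewrite ofrealM !ofreal_absv normrM. Qed.

End ScalarTheory.

Section BasesAndGenus.
Variable K : numFieldType.

Definition closed_span (V : normedModType K) (x : nat -> V) : set V :=
  closure [set v | exists n (a : nat -> K), v = \sum_(i < n) a i *: x i].

(* T is a linear homeomorphism of the subspace A of V onto the subspace B of W;
   the values of T outside A are irrelevant. *)
Definition isomorphism (V W : normedModType K) (A : set V) (B : set W)
    (T : V -> W) : Prop :=
  [/\ forall (a : K) (u v : V), A u -> A v -> T (a *: u + v) = a *: T u + T v,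
      {within A, continuous T},
      forall u, A u -> B (T u)
    & exists S : W -> V,
        [/\ {within B, continuous S}, forall w, B w -> A (S w),
            forall u, A u -> S (T u) = u & forall w, B w -> T (S w) = w]].

Definition isomorphic (V W : normedModType K) (A : set V) (B : set W) : Prop :=
  exists T : V -> W, isomorphism A B T.

Definition equivalent (V W : normedModType K) (x : nat -> V) (y : nat -> W) :
    Prop :=
  exists T : V -> W,
    isomorphism (closed_span x) (closed_span y) T /\ forall n, T (x n) = y n.

Definition perm_equivalent (V W : normedModType K) (x : nat -> V)
    (y : nat -> W) : Prop :=
  exists2 pi : nat -> nat, bijective pi & equivalent x (y \o pi).

(* Bases are indexed by nat, so that only infinite-dimensional subspaces have
   one: the elements of a basis are linearly independent by uniqueness of the
   expansion of 0. *)
Definition schauder_basis (V : normedModType K) (Y : set V) (x : nat -> V) :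
    Prop :=
  (forall n, Y (x n)) /\
  forall y, Y y ->
    exists! a : nat -> K, series (fun i => a i *: x i) @ \oo --> y.

Definition unconditional_basis (V : normedModType K) (Y : set V)
    (x : nat -> V) : Prop :=
  schauder_basis Y x /\
  forall (a : nat -> K) (y : V), series (fun i => a i *: x i) @ \oo --> y ->
    forall pi : nat -> nat, bijective pi ->
      series (fun i => a (pi i) *: x (pi i)) @ \oo --> y.

Definition normalized (V : normedModType K) (x : nat -> V) : Prop :=
  forall n, `|x n| = 1.

Definition normalized_unconditional_basis (V : normedModType K) (Y : set V)
    (x : nat -> V) : Prop :=
  normalized x /\ unconditional_basis Y x.

Definition unique_normalized_unconditional_basis (V : normedModType K)
    (Y : set V) : Prop :=
  (exists x, normalized_unconditional_basis Y x) /\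
  forall x y, normalized_unconditional_basis Y x ->
    normalized_unconditional_basis Y y -> perm_equivalent x y.

Definition complemented (V : normedModType K) (Y : set V) : Prop :=
  exists P : {linear V -> V},
    [/\ continuous P, forall v, P (P v) = P v & range P = Y].

Definition complemented_with_ub (V : normedModType K) (Y : set V) : Prop :=
  complemented Y /\ exists x, unconditional_basis Y x.

(* The last clause lists representatives of the isomorphism classes of
   complemented subspaces with an unconditional basis: there are exactly n. *)
Definition genus (n : nat) (X : completeNormedModType K) : Prop :=
  [/\ unique_normalized_unconditional_basis [set: X],
      forall Y : set X, complemented_with_ub Y ->
        unique_normalized_unconditional_basis Y
    & exists Z : 'I_n -> set X,
        [/\ forall i, complemented_with_ub (Z i),
            forall i j, isomorphic (Z i) (Z j) -> i = j
          & forall Y : set X, complemented_with_ub Y ->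
              exists i, isomorphic Y (Z i)]].

End BasesAndGenus.

Section SequenceSpaces.
Variables (R : realType) (k : scalar_kind).
Local Notation K := (scalars R k).
Local Notation absv := (@absv R k).
Local Notation ofreal := (@ofreal R k).
Implicit Types u v : nat -> K^o.

Definition c0_pred : {pred nat -> K^o} :=
  mem [set u : nat -> K^o | absv (u i) @[i --> \oo] --> 0].
Definition l1_pred : {pred nat -> K^o} :=
  mem [set u : nat -> K^o | cvgn (series (fun i => absv (u i)))].
Definition l2_pred : {pred nat -> K^o} :=
  mem [set u : nat -> K^o | cvgn (series (fun i => absv (u i) ^+ 2))].

Record c0 := C0 { c0_val :> nat -> K^o ; c0_valP : c0_val \in c0_pred }.
Record l1 := L1 { l1_val :> nat -> K^o ; l1_valP : l1_val \in l1_pred }.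
Record l2 := L2 { l2_val :> nat -> K^o ; l2_valP : l2_val \in l2_pred }.

Definition c0_norm (u : c0) : K := ofreal (sup (range (fun i => absv (u i)))).
Definition l1_norm (u : l1) : K :=
  ofreal (limn (series (fun i => absv (u i)))).
Definition l2_norm (u : l2) : K :=
  ofreal (Num.sqrt (limn (series (fun i => absv (u i) ^+ 2)))).

HB.instance Definition _ := [isSub for c0_val].
HB.instance Definition _ := [Choice of c0 by <:].
HB.instance Definition _ := [isSub for l1_val].
HB.instance Definition _ := [Choice of l1 by <:].
HB.instance Definition _ := [isSub for l2_val].
HB.instance Definition _ := [Choice of l2 by <:].

Lemma c0_submod_closed : submod_closed c0_pred.
Proof.
split.
  by rewrite inE /=; under eq_fun do rewrite absv0; exact: cvg_cst.
move=> a u v; rewrite !inE /= => u0 v0.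
have h : absv a * absv (u i) + absv (v i) @[i --> \oo] --> 0.
  rewrite -[X in _ --> X](addr0 0); apply: cvgD => //.
  by rewrite -[X in _ --> X](mulr0 (absv a)); apply: cvgMl_tmp.
apply: (squeeze_cvgr _ (cvg_cst 0) h); apply: nearW => i.
by rewrite absv_ge0 /= (le_trans (absvD _ _))// lerD2r absvM.
Qed.

Lemma l1_submod_closed : submod_closed l1_pred.
Proof.
split.
  rewrite inE /=; under eq_fun do rewrite absv0.
  apply/cvg_ex; exists 0; rewrite (_ : series _ = cst 0); first exact: cvg_cst.
  by apply/funext => n; rewrite /series /= big1.
move=> a u v; rewrite !inE /= => u1 v1.
apply: (@series_le_cvg _ _ (absv a *: (fun i => absv (u i)) +
  (fun i => absv (v i)))).
- by move=> n; exact: absv_ge0.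
- by move=> n; rewrite addr_ge0 ?mulr_ge0 ?absv_ge0.
- by move=> n; rewrite (le_trans (absvD _ _))// lerD2r absvM.
- by apply: is_cvg_seriesD => //; exact: is_cvg_seriesZ.
Qed.

Lemma l2_submod_closed : submod_closed l2_pred.
Proof.
split.
  rewrite inE /=; under eq_fun do rewrite absv0 expr0n.
  apply/cvg_ex; exists 0; rewrite (_ : series _ = cst 0); first exact: cvg_cst.
  by apply/funext => n; rewrite /series /= big1.
move=> a u v; rewrite !inE /= => u2 v2.
apply: (@series_le_cvg _ _ ((2 * absv a ^+ 2) *: (fun i => absv (u i) ^+ 2) +
  2 *: (fun i => absv (v i) ^+ 2))).
- by move=> n; exact: sqr_ge0.
- move=> n; apply: addr_ge0; apply: mulr_ge0 => //; rewrite ?sqr_ge0//.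
  by rewrite mulr_ge0 ?sqr_ge0.
- move=> n; apply: (@le_trans _ _ ((absv a * absv (u n) + absv (v n)) ^+ 2)).
    rewrite lerXn2r ?nnegrE ?addr_ge0 ?mulr_ge0 ?absv_ge0//.
    by rewrite (le_trans (absvD _ _))// lerD2r absvM.
  change ((absv a * absv (u n) + absv (v n)) ^+ 2 <=
    2 * absv a ^+ 2 * absv (u n) ^+ 2 + 2 * absv (v n) ^+ 2).
  rewrite -subr_ge0 (_ : _ - _ = (absv a * absv (u n) - absv (v n)) ^+ 2).
    exact: sqr_ge0.
  ring.
- by apply: is_cvg_seriesD; exact: is_cvg_seriesZ.
Qed.

HB.instance Definition _ :=
  GRing.isSubmodClosed.Build _ _ c0_pred c0_submod_closed.
HB.instance Definition _ := [SubChoice_isSubLmodule of c0 by <:].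
HB.instance Definition _ :=
  GRing.isSubmodClosed.Build _ _ l1_pred l1_submod_closed.
HB.instance Definition _ := [SubChoice_isSubLmodule of l1 by <:].
HB.instance Definition _ :=
  GRing.isSubmodClosed.Build _ _ l2_pred l2_submod_closed.
HB.instance Definition _ := [SubChoice_isSubLmodule of l2 by <:].

Lemma c0_has_sup (u : c0) : has_sup (range (fun i => absv (u i))).
Proof.
split; first by exists (absv (u 0)), 0%N.
have /set_mem /= u0 := c0_valP u.
have /cvg_seq_bounded : cvgn (fun i => absv (u i)) by apply/cvg_ex; exists 0.
by move/bounded_fun_has_ubound.
Qed.

Lemma absv_le_c0 (u : c0) i : absv (u i) <= sup (range (fun i => absv (u i))).
Proof. by apply: ub_le_sup; [exact: (c0_has_sup u).2|exists i]. Qed.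

Lemma c0_normD (u v : c0) : c0_norm (u + v) <= c0_norm u + c0_norm v.
Proof.
rewrite -ofrealD ofreal_le; apply: ge_sup; first exact: (c0_has_sup (u + v)).1.
move=> _ [i _ <-].
exact: le_trans (absvD _ _) (lerD (absv_le_c0 u i) (absv_le_c0 v i)).
Qed.

Lemma c0_normZ (a : K) (u : c0) : c0_norm (a *: u) = `|a| * c0_norm u.
Proof.
have le_normZ b w : c0_norm (b *: w) <= `|b| * c0_norm w.
  rewrite -ofreal_absv -ofrealM ofreal_le.
  apply: ge_sup; first exact: (c0_has_sup (b *: w)).1.
  by move=> _ [i _ <-]; rewrite absvM ler_wpM2l ?absv_ge0 ?absv_le_c0.
have [->|a0] := eqVneq a 0.
  apply/eqP; rewrite eq_le le_normZ normr0 mul0r -(ofreal0 R k) ofreal_le.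
  exact: le_trans (absv_ge0 _) (absv_le_c0 _ 0).
apply/eqP; rewrite eq_le le_normZ /=.
rewrite -ler_pdivlMl ?normr_gt0// -normfV (le_trans _ (le_normZ _ _))//.
by rewrite scalerA mulVf// scale1r.
Qed.

Lemma c0_norm0_eq0 (u : c0) : c0_norm u = 0 -> u = 0.
Proof.
rewrite -(ofreal0 R k) => /ofreal_inj u0; apply/val_inj/funext => i.
by apply/absv0_eq0/eqP; rewrite eq_le absv_ge0 -u0 absv_le_c0.
Qed.

HB.instance Definition _ :=
  Lmodule_isNormed.Build K c0 c0_normD c0_normZ c0_norm0_eq0.

Let term_le_series (f : nat -> R) i :
  (forall n, 0 <= f n) -> cvgn (series f) -> f i <= limn (series f).
Proof.
move=> f0 cf; have nd : nondecreasing_seq (series f).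
  exact: nondecreasing_series.
apply: le_trans (nondecreasing_cvgn_le nd cf i.+1).
by rewrite /series /= big_nat_recr //= lerDr sumr_ge0.
Qed.

Lemma l1_cvg (u : l1) : cvgn (series (fun i => absv (u i))).
Proof. exact: set_mem (l1_valP u). Qed.

Lemma l1_normD (u v : l1) : l1_norm (u + v) <= l1_norm u + l1_norm v.
Proof.
rewrite -ofrealD ofreal_le -(lim_seriesD (@l1_cvg u) (@l1_cvg v)).
apply: lim_series_le; first exact: (@l1_cvg (u + v)).
  exact: is_cvg_seriesD (@l1_cvg u) (@l1_cvg v).
by move=> n; exact: absvD.
Qed.

Lemma l1_normZ (a : K) (u : l1) : l1_norm (a *: u) = `|a| * l1_norm u.
Proof.
rewrite -ofreal_absv -ofrealM; congr ofreal.
rewrite -[RHS](lim_seriesZ _ (@l1_cvg u)); congr (limn (series _)).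
by apply/funext => i; rewrite absvM.
Qed.

Lemma l1_norm0_eq0 (u : l1) : l1_norm u = 0 -> u = 0.
Proof.
rewrite -(ofreal0 R k) => /ofreal_inj u0; apply/val_inj/funext => i.
apply/absv0_eq0/eqP; rewrite eq_le absv_ge0 -u0.
by rewrite (@term_le_series (fun i => absv (u i)))//;
  [move=> n; exact: absv_ge0|exact: l1_cvg].
Qed.

HB.instance Definition _ :=
  Lmodule_isNormed.Build K l1 l1_normD l1_normZ l1_norm0_eq0.

Lemma l2_cvg (u : l2) : cvgn (series (fun i => absv (u i) ^+ 2)).
Proof. exact: set_mem (l2_valP u). Qed.

Let l2_sum (u : l2) : R := limn (series (fun i => absv (u i) ^+ 2)).

Let term_le_l2_sum (u : l2) i : absv (u i) ^+ 2 <= l2_sum u.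
Proof.
by apply: (term_le_series (f := fun i => absv (u i) ^+ 2)) => [n|];
  [exact: sqr_ge0|exact: l2_cvg].
Qed.

Let l2_sum_ge0 (u : l2) : 0 <= l2_sum u.
Proof. exact: le_trans (sqr_ge0 _) (term_le_l2_sum u 0). Qed.

Lemma l2_norm0_eq0 (u : l2) : l2_norm u = 0 -> u = 0.
Proof.
rewrite -(ofreal0 R k) => /ofreal_inj/eqP; rewrite sqrtr_eq0 => u0.
apply/val_inj/funext => i; apply/absv0_eq0/eqP.
by rewrite -sqrf_eq0 eq_le sqr_ge0 (le_trans (term_le_l2_sum u i)).
Qed.

Lemma l2_normZ (a : K) (u : l2) : l2_norm (a *: u) = `|a| * l2_norm u.
Proof.
rewrite -ofreal_absv -ofrealM; congr ofreal.
rewrite -[absv a]ger0_norm ?absv_ge0// -sqrtr_sqr -sqrtrM ?sqr_ge0//.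
congr Num.sqrt.
rewrite -[RHS](lim_seriesZ _ (@l2_cvg u)); congr (limn (series _)).
by apply/funext => i; rewrite absvM exprMn.
Qed.

(* (p + q)^2 <= (s + t) (p^2 / s + q^2 / t) is summed with s and t the norms
   of the two sequences. *)
Lemma l2_normD (u v : l2) : l2_norm (u + v) <= l2_norm u + l2_norm v.
Proof.
have n0 : l2_norm 0 = 0.
  by rewrite -(scale0r (0 : l2)) l2_normZ normr0 mul0r.
have nE (w : l2) : l2_norm w = ofreal (Num.sqrt (l2_sum w)) by [].
have [s0|s0] := eqVneq (Num.sqrt (l2_sum u)) 0.
  have -> : u = 0 by apply: l2_norm0_eq0; rewrite nE s0 ofreal0.
  by rewrite n0 !add0r.
have [t0|t0] := eqVneq (Num.sqrt (l2_sum v)) 0.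
  have -> : v = 0 by apply: l2_norm0_eq0; rewrite nE t0 ofreal0.
  by rewrite n0 !addr0.
rewrite !nE -ofrealD ofreal_le.
set s := Num.sqrt (l2_sum u) in s0 *; set t := Num.sqrt (l2_sum v) in t0 *.
have {}s0 : 0 < s by rewrite lt_neqAle eq_sym s0 sqrtr_ge0.
have {}t0 : 0 < t by rewrite lt_neqAle eq_sym t0 sqrtr_ge0.
have su : s ^+ 2 = l2_sum u by rewrite sqr_sqrtr.
have tv : t ^+ 2 = l2_sum v by rewrite sqr_sqrtr.
rewrite -(ger0_norm (addr_ge0 (ltW s0) (ltW t0))) -sqrtr_sqr; apply: ler_wsqrtr.
have -> : (s + t) ^+ 2 = (s + t) / s * l2_sum u + (s + t) / t * l2_sum v.
  by rewrite -su -tv; field; rewrite !gt_eqF.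
set f := fun i => absv (u i) ^+ 2; set g := fun i => absv (v i) ^+ 2.
have cf : cvgn (series f) by exact: l2_cvg.
have cg : cvgn (series g) by exact: l2_cvg.
set c := (s + t) / s; set d := (s + t) / t.
have lf : limn (series (c *: f)) = c * l2_sum u by rewrite lim_seriesZ.
have lg : limn (series (d *: g)) = d * l2_sum v by rewrite lim_seriesZ.
have cu : cvgn (series (c *: f)) by exact: is_cvg_seriesZ.
have cv : cvgn (series (d *: g)) by exact: is_cvg_seriesZ.
rewrite -lf -lg -lim_seriesD//.
apply: lim_series_le; first exact: (@l2_cvg (u + v)).
  exact: is_cvg_seriesD.
move=> n; set p := absv (u n); set q := absv (v n).
apply: (@le_trans _ _ ((p + q) ^+ 2)).
  by rewrite lerXn2r ?nnegrE ?addr_ge0 ?absv_ge0//; exact: absvD.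
change ((p + q) ^+ 2 <= c * p ^+ 2 + d * q ^+ 2).
rewrite {lf lg cu cv}/c /d.
rewrite -subr_ge0 [leRHS](_ : _ = (t * p - s * q) ^+ 2 / (s * t)).
  by rewrite divr_ge0 ?sqr_ge0 ?mulr_ge0 ?ltW.
by field; rewrite !gt_eqF.
Qed.

HB.instance Definition _ :=
  Lmodule_isNormed.Build K l2 l2_normD l2_normZ l2_norm0_eq0.

Definition unit_seq (n : nat) : nat -> K^o := fun i => (i == n)%:R.

Let absv_unit_seq n i : absv (unit_seq n i) = (i == n)%:R.
Proof. by rewrite /unit_seq; case: (i == n); rewrite ?absv1 ?absv0. Qed.

Let cvg_unit_series n : cvgn (series (fun i => (i == n)%:R : R)).
Proof.
apply/cvg_ex; exists 1; apply: cvg_near_cst; exists n.+1 => // m /= nm.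
change (\sum_(0 <= i < m) (i == n)%:R = 1 :> R).
rewrite (bigD1_seq n) ?mem_index_iota ?iota_uniq//=.
by rewrite eqxx big1 ?addr0// => i /negbTE ->.
Qed.

Lemma unit_seq_c0 n : unit_seq n \in c0_pred.
Proof.
rewrite inE /=; apply: cvg_near_cst; exists n.+1 => // i /= ni.
by rewrite absv_unit_seq gtn_eqF.
Qed.

Lemma unit_seq_l1 n : unit_seq n \in l1_pred.
Proof.
rewrite inE /=; under eq_fun do rewrite absv_unit_seq.
exact: cvg_unit_series.
Qed.

Lemma unit_seq_l2 n : unit_seq n \in l2_pred.
Proof.
rewrite inE /=.
under eq_fun do rewrite absv_unit_seq expr2 -natrM mulnb andbb.
exact: cvg_unit_series.
Qed.

Definition c0_unit_basis (n : nat) : c0 := C0 (unit_seq_c0 n).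
Definition l1_unit_basis (n : nat) : l1 := L1 (unit_seq_l1 n).
Definition l2_unit_basis (n : nat) : l2 := L2 (unit_seq_l2 n).

End SequenceSpaces.

(* Main.v *)
Require Import Defs.
From HB Require Import structures.
From mathcomp Require Import all_boot all_order all_algebra.
From mathcomp Require Import all_classical all_reals all_analysis.
From mathcomp Require Import ring lra zify.
From mathcomp.real_closed Require Import complex.

Set Implicit Arguments.
Unset Strict Implicit.
Unset Printing Implicit Defensive.
Import Order.TTheory GRing.Theory Num.Theory.
Import numFieldNormedType.Exports.
Local Open Scope classical_set_scope.
Local Open Scope ring_scope.

(* Finite genus yields a subsequence y of the basis such that every subsequence
   of y contains a permuted copy of y.  Ramsey's theorem then gives a spreading
   subsequence z: any two finite subsets of z with the same number of elements,
   taken in order, are uniformly equivalent.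

   Uniqueness of the unconditional basis of the closed span of z enters through
   a perturbation of z: if the vectors u_(j, c), for j in J and c in nat, form an
   unconditional basis of a complemented subspace, and shifting the copies
   c -> c + 1 is bounded on it, then the normalized u_(j, 0) are equivalent to a
   family of distinct terms of z.

   For u the sums of z over disjoint blocks, with complement given by averaging,
   this shows that lam (l_1) z_1 + ... + lam (l_n) z_n has norm comparable to
   lam (l_1 + ... + l_n), where lam n is the norm of a sum of n terms of z.  Hence
   lam n is comparable to n^al, and z is equivalent to the basis of c_0 if al = 0
   and to that of l_p with p = 1/al otherwise.  If 1 < p, the same device is
   applied to the Rademacher vectors on blocks of 2^m terms, which span
   uniformly complemented copies of l_2^m by Khintchine's inequality; comparing
   the norms of the sum of m of them gives m^(1/2) ~ m^(1/p), so p = 2. *)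

(** Uniqueness speaks of bases of whole subspaces, whereas the u_(j, 0) span only a part of the span
    of z. The copies bridge this gap, as in Pelczynski's decomposition method: shifting them shows
    that the span of z is isomorphic to its direct sum with the span of the u_(j, 0), so these
    vectors and an image of z form a second unconditional basis of one and the same space.

    The permutation that uniqueness provides is arbitrary, so nothing is known of the positions of
    the terms of z that it selects. Spreading reduces the role of positions to that of their order.
    The order in turn is restored by offering infinitely many blocks of every length to choose from;
    once z behaves like the basis of l_p, even the order is immaterial.

    The condition 1 < p comes from duality: the Rademacher projection is bounded through
    Khintchine's inequality for the conjugate exponent.

    The definition of an unconditional basis is qualitative, as it only asks rearranged series to
    converge. The constant D behind all estimates has to be extracted by a category argument. *)

(** * Real and imaginary parts, uniformly over the two scalar fields *)

Section Scalars.
Variables (R : realType) (k : scalar_kind).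
Local Notation K := (scalars R k).
Local Notation absv := (@absv R k).
Local Notation ofreal := (@ofreal R k).

Definition rpart : K -> R :=
  match k with
  | RealScalars => fun x : R => x
  | ComplexScalars => fun z : R[i] => complex.Re z
  end.

Definition ipart : K -> R :=
  match k with
  | RealScalars => fun=> 0
  | ComplexScalars => fun z : R[i] => complex.Im z
  end.

(** The value 0 in the real case is harmless because [ipart] vanishes there; it lets [scalarE] hold
    over both fields. *)
Definition iunit : K :=
  match k with
  | RealScalars => 0 : R
  | ComplexScalars => 'i%C : R[i]
  end.

Lemma rpartD x y : rpart (x + y) = rpart x + rpart y.
Proof. by rewrite /rpart; case: k x y => //= [[a b] [c d]]. Qed.

Lemma ipartD x y : ipart (x + y) = ipart x + ipart y.
Proof. by rewrite /ipart; case: k x y => /= [x y|[a b] [c d]] //; rewrite addr0. Qed.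

Lemma rpartN x : rpart (- x) = - rpart x.
Proof. by rewrite /rpart; case: k x => //= [[a b]]. Qed.

Lemma ipartN x : ipart (- x) = - ipart x.
Proof. by rewrite /ipart; case: k x => /= [x|[a b]] //; rewrite oppr0. Qed.

Lemma scalarE x : x = ofreal (rpart x) + iunit * ofreal (ipart x).
Proof.
rewrite /rpart /ipart /iunit; case: k x => /= [x|[a b]]; first by rewrite mul0r addr0.
by apply/eqP; rewrite eq_complex /=; apply/andP; split; apply/eqP; ring.
Qed.

Lemma absv_ofreal (x : R) : absv (ofreal x) = `|x|.
Proof.
case: k => //=; rewrite expr0n /= addr0; exact: sqrtr_sqr.
Qed.

Lemma absv_iunit : absv iunit <= 1.
Proof.
rewrite /iunit; case: k => /=; first by rewrite normr0.
by rewrite expr0n expr1n add0r sqrtr1.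
Qed.

Lemma rpart_le x : `|rpart x| <= absv x.
Proof.
rewrite /rpart; case: k x => /= [x|[a b]] //=.
by rewrite -[leLHS]sqrtr_sqr ler_wsqrtr// lerDl sqr_ge0.
Qed.

Lemma ipart_le x : `|ipart x| <= absv x.
Proof.
rewrite /ipart; case: k x => /= [x|[a b]] //=; first by rewrite normr0.
by rewrite -[leLHS]sqrtr_sqr ler_wsqrtr// lerDr sqr_ge0.
Qed.

Lemma absv_le_parts x : absv x <= `|rpart x| + `|ipart x|.
Proof.
rewrite {1}(scalarE x) (le_trans (absvD _ _))// absvM !absv_ofreal lerD2l.
by rewrite ler_piMl// absv_iunit.
Qed.

Lemma ofrealN (x : R) : ofreal (- x) = - ofreal x.
Proof. by case: k => //=; rewrite rmorphN. Qed.

Lemma ofrealB (x y : R) : ofreal (x - y) = ofreal x - ofreal y.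
Proof. by rewrite ofrealD ofrealN. Qed.

Lemma ofreal1 : ofreal 1 = 1.
Proof. by case: k. Qed.

Lemma ofreal_lt (x y : R) : (ofreal x < ofreal y) = (x < y).
Proof. by case: k => //=; rewrite ltcR. Qed.

Lemma absvN x : absv (- x) = absv x.
Proof. by apply: (@ofreal_inj R k); rewrite !ofreal_absv normrN. Qed.

Lemma absvB x y : absv (x - y) = absv (y - x).
Proof. by rewrite -absvN opprB. Qed.

Lemma absvV x : absv x^-1 = (absv x)^-1.
Proof.
have [->|x0] := eqVneq x 0; first by rewrite invr0 absv0 invr0.
have ax0 : absv x != 0 by apply: contra x0 => /eqP/absv0_eq0 ->.
by apply: (mulfI ax0); rewrite -absvM !mulfV// absv1.
Qed.

Lemma absv_gt0 x : x != 0 -> 0 < absv x.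
Proof.
move=> x0; rewrite lt_neqAle absv_ge0 andbT eq_sym.
by apply: contra x0 => /eqP/absv0_eq0 ->.
Qed.

(** The distance is a parameter so that scalars, measured by [absv], and vectors, measured by [rn],
    share one notion. *)
Definition scauchy (T : Type) (nm : T -> T -> R) (u : nat -> T) :=
  forall e : R, 0 < e -> exists N, forall m n, (N <= m)%N -> (N <= n)%N ->
    nm (u m) (u n) < e.

Let real_complete (u : nat -> R) : scauchy (fun x y => `|x - y|) u ->
  exists l, forall e : R, 0 < e -> exists N, forall n, (N <= n)%N -> `|u n - l| < e.
Proof.
move=> cu.
have : cvgn u.
  apply: R_complete; apply: cauchy_exP => e e0 //=.
  have [N uN] := cu _ e0; exists (u N); exists N => // n /= Nn.
  by rewrite /ball /=; exact: uN.
move=> /cvgrPdist_lt cv; exists (limn u) => e e0.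
by have [N _ uN] := cv _ e0; exists N => n Nn; rewrite distrC; exact: uN.
Qed.

Lemma scalar_complete (u : nat -> K) : scauchy (fun x y => absv (x - y)) u ->
  exists l, forall e : R, 0 < e ->
    exists N, forall n, (N <= n)%N -> absv (u n - l) < e.
Proof.
move=> cu.
have [l lP] : exists l, forall e : R, 0 < e ->
    exists N, forall n, (N <= n)%N -> `|rpart (u n) - l| < e.
  apply: (@real_complete (rpart \o u)) => e e0; have [N uN] := cu _ e0.
  exists N => m n Nm Nn /=; rewrite -rpartN -rpartD.
  exact: le_lt_trans (rpart_le _) (uN _ _ Nm Nn).
have [l' lP'] : exists l, forall e : R, 0 < e ->
    exists N, forall n, (N <= n)%N -> `|ipart (u n) - l| < e.
  apply: (@real_complete (ipart \o u)) => e e0; have [N uN] := cu _ e0.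
  exists N => m n Nm Nn /=; rewrite -ipartN -ipartD.
  exact: le_lt_trans (ipart_le _) (uN _ _ Nm Nn).
exists (ofreal l + iunit * ofreal l') => e e0.
have e20 : 0 < e / 2 by rewrite divr_gt0.
have [N uN] := lP _ e20; have [N' uN'] := lP' _ e20.
exists (maxn N N') => n; rewrite geq_max => /andP[Nn N'n].
rewrite {1}(scalarE (u n)).
rewrite (_ : _ - _ = ofreal (rpart (u n) - l) + iunit * ofreal (ipart (u n) - l')); last first.
  by rewrite !ofrealB; ring.
apply: (le_lt_trans (absvD _ _)); rewrite absvM !absv_ofreal (splitr e).
apply: ltrD; first exact: uN.
by apply: le_lt_trans (uN' _ N'n); rewrite ler_piMl// absv_iunit.
Qed.

End Scalars.

(** * Real-valued norms and limits in terms of epsilon *)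

Section RealNorm.
Variables (R : realType) (k : scalar_kind).
Local Notation K := (scalars R k).
Local Notation absv := (@absv R k).
Local Notation ofreal := (@ofreal R k).

(** Norms lie in the scalar field, which is only partially ordered in the complex case; every
    estimate below is carried out in [R] instead. *)
Definition rn (V : normedModType K) (v : V) : R := absv `|v|.

Section Normed.
Variable V : normedModType K.
Implicit Types u v w : V.

Lemma ofreal_rn v : ofreal (rn v) = `|v|.
Proof. by rewrite ofreal_absv normr_id. Qed.

Lemma rn_ge0 v : 0 <= rn v. Proof. exact: absv_ge0. Qed.

Lemma rnD v w : rn (v + w) <= rn v + rn w.
Proof. by rewrite -(@ofreal_le R k) ofrealD !ofreal_rn ler_normD. Qed.

Lemma rnZ a v : rn (a *: v) = absv a * rn v.
Proof. by apply: (@ofreal_inj R k); rewrite ofrealM !ofreal_rn ofreal_absv normrZ. Qed.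

Lemma rn0 : rn (0 : V) = 0.
Proof. by rewrite /rn normr0 absv0. Qed.

Lemma rn0_eq0 v : rn v = 0 -> v = 0.
Proof. by move=> v0; apply/normr0_eq0; rewrite -ofreal_rn v0 ofreal0. Qed.

Lemma rnN v : rn (- v) = rn v. Proof. by rewrite /rn normrN. Qed.

Lemma rnB v w : rn (v - w) = rn (w - v).
Proof. by rewrite -rnN opprB. Qed.

Lemma rn_gt0 v : v != 0 -> 0 < rn v.
Proof.
move=> v0; rewrite lt_neqAle rn_ge0 andbT eq_sym.
by apply: contra v0 => /eqP/rn0_eq0 ->.
Qed.

Lemma rn_tri u v w : rn (u - w) <= rn (u - v) + rn (v - w).
Proof. by rewrite -(subrKA v); exact: rnD. Qed.

Lemma rn_sum (I : Type) (s : seq I) (P : pred I) (F : I -> V) :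
  rn (\sum_(i <- s | P i) F i) <= \sum_(i <- s | P i) rn (F i).
Proof.
elim/big_rec2: _ => [|i x v _ vx]; first by rewrite rn0.
by rewrite (le_trans (rnD _ _))// lerD2l.
Qed.

Lemma rn_small v : (forall e, 0 < e -> rn v < e) -> v = 0.
Proof.
move=> h; apply: rn0_eq0; apply/eqP; rewrite eq_le rn_ge0 andbT leNgt.
by apply/negP => /h; rewrite ltxx.
Qed.

Definition rlim (u : nat -> V) (l : V) :=
  forall e : R, 0 < e -> exists N, forall n, (N <= n)%N -> rn (u n - l) < e.

Lemma rlimP (u : nat -> V) l : (u @ \oo --> l) <-> rlim u l.
Proof.
split=> [/cvgrPdist_lt cv e e0|cv].
  have [|N _ uN] := cv (ofreal e); first by rewrite -(ofreal0 R k) ofreal_lt.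
  by exists N => n /uN /=; rewrite distrC -ofreal_rn ofreal_lt.
apply/cvgrPdist_lt => e e0.
have ee : ofreal (absv e) = e by rewrite ofreal_absv ger0_norm// ltW.
have [|N uN] := cv (absv e); first by rewrite -(@ofreal_lt R k) ofreal0 ee.
by exists N => // n /= /uN; rewrite -(@ofreal_lt R k) ee ofreal_rn distrC.
Qed.

Lemma rlim_uniq (u : nat -> V) l l' : rlim u l -> rlim u l' -> l = l'.
Proof.
move=> ul ul'; apply/eqP; rewrite -subr_eq0; apply/eqP/rn_small => e e0.
have e20 : 0 < e / 2 by rewrite divr_gt0.
have [N uN] := ul _ e20; have [N' uN'] := ul' _ e20.
apply: (le_lt_trans (rn_tri _ (u (maxn N N')) _)).
by rewrite (splitr e) ltrD// ?uN' ?leq_maxr// rnB uN ?leq_maxl.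
Qed.

Lemma rlimD (u u' : nat -> V) l l' : rlim u l -> rlim u' l' ->
  rlim (fun n => u n + u' n) (l + l').
Proof.
move=> ul ul' e e0.
have e20 : 0 < e / 2 by rewrite divr_gt0.
have [N uN] := ul _ e20; have [N' uN'] := ul' _ e20.
exists (maxn N N') => n; rewrite geq_max => /andP[Nn N'n].
by rewrite opprD addrACA (le_lt_trans (rnD _ _))// (splitr e) ltrD ?uN ?uN'.
Qed.

Lemma rlimZ a (u : nat -> V) l : rlim u l -> rlim (fun n => a *: u n) (a *: l).
Proof.
move=> ul e e0; have a1 : 0 < absv a + 1 by rewrite ltr_wpDl ?absv_ge0.
have [|N uN] := ul (e / (absv a + 1)); first by rewrite divr_gt0.
exists N => n /uN; rewrite -scalerBr rnZ ltr_pdivlMr// mulrC; apply: le_lt_trans.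
by rewrite ler_wpM2r ?rn_ge0// lerDl.
Qed.

Lemma rlim_cst l : rlim (fun=> l) l.
Proof. by move=> e e0; exists 0%N => n _; rewrite subrr rn0. Qed.

Lemma rlim_eq (u u' : nat -> V) l : u =1 u' -> rlim u l -> rlim u' l.
Proof. by move=> uu' ul e /ul[N uN]; exists N => n /uN; rewrite uu'. Qed.

Lemma rlim_le (u : nat -> V) l (B : R) N :
  rlim u l -> (forall n, (N <= n)%N -> rn (u n) <= B) -> rn l <= B.
Proof.
move=> ul uB; apply/ler_addgt0Pr => e e0; have [N' uN'] := ul _ e0.
rewrite -[l](subrK (u (maxn N N'))) (le_trans (rnD _ _))// addrC lerD//.
  by rewrite uB ?leq_maxl.
by rewrite ltW// rnB uN' ?leq_maxr.
Qed.

Lemma rlim_cauchy (u : nat -> V) l : rlim u l -> scauchy (fun x y => rn (x - y)) u.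
Proof.
move=> ul e e0; have e20 : 0 < e / 2 by rewrite divr_gt0.
have [N uN] := ul _ e20; exists N => m n Nm Nn.
apply: (le_lt_trans (rn_tri _ l _)).
by rewrite (splitr e) ltrD ?uN// rnB uN.
Qed.

Lemma closure_rnP (A : set V) v :
  closure A v <-> forall e : R, 0 < e -> exists2 w, A w & rn (w - v) < e.
Proof.
split=> [cA e e0|cA].
  have [|w [Aw wv]] := cA (ball v (ofreal e)).
    by apply: nbhsx_ballx; rewrite -(ofreal0 R k) ofreal_lt.
  exists w => //; move: wv; rewrite -ball_normE /= -ofreal_rn ofreal_lt.
  by rewrite rnB.
move=> B /nbhs_ballP[e /= e0 vB].
have ee : ofreal (absv e) = e by rewrite ofreal_absv ger0_norm// ltW.
have [|w Aw wv] := cA (absv e); first by rewrite -(@ofreal_lt R k) ofreal0 ee.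
exists w; split => //; apply: vB; rewrite -ball_normE /= -ofreal_rn -ee ofreal_lt.
by rewrite rnB.
Qed.

Lemma closure_rlim (A : set V) v : closure A v ->
  exists2 u : nat -> V, forall n, A (u n) & rlim u v.
Proof.
move=> /closure_rnP cA.
have /choice[u uP] (n : nat) : exists w, A w /\ rn (w - v) < n.+1%:R^-1.
  by have [|w Aw wv] := cA n.+1%:R^-1; [rewrite invr_gt0|exists w].
exists u => [n|e e0]; first exact: (uP n).1.
exists (Num.truncn e^-1) => n en; apply: (lt_le_trans (uP n).2).
rewrite -[leRHS]invrK lef_pV2 ?posrE ?invr_gt0//.
by rewrite ltW// (lt_le_trans (truncnS_gt _))// ler_nat.
Qed.

End Normed.

Lemma rn_complete (V : completeNormedModType K) (u : nat -> V) :
  scauchy (fun x y => rn (x - y)) u -> exists l, rlim u l.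
Proof.
move=> cu; suff /cvg_ex[l /rlimP ul] : cvgn u by exists l.
apply: cauchy_cvg; apply: cauchy_exP => e /= e0.
have ee : ofreal (absv e) = e by rewrite ofreal_absv ger0_norm// ltW.
have [|N uN] := cu (absv e); first by rewrite -(@ofreal_lt R k) ofreal0 ee.
exists (u N); exists N => // n /= Nn; rewrite -ball_normE /=.
by rewrite -ofreal_rn -ee ofreal_lt uN.
Qed.

End RealNorm.

(** * Finite combinations and unconditional families *)

Section FiniteSupport.
Variables (R : realType) (k : scalar_kind).
Local Notation K := (scalars R k).
Local Notation absv := (@absv R k).
Local Notation ofreal := (@ofreal R k).

(** The list may exceed the support, so that any two finitely supported functions share one list. *)
Definition supp_in (I : choiceType) (s : seq I) (a : I -> K) :=
  uniq s /\ forall i, i \notin s -> a i = 0.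

Definition fsupp (I : choiceType) (a : I -> K) := exists s, supp_in s a.

Definition dlt (I : choiceType) (i : I) : I -> K := fun j => (j == i)%:R.

Section Val.
Variables (I : choiceType) (V : normedModType K).
Implicit Types (x : I -> V) (a b : I -> K) (s : seq I).

(* The junk value, for a with infinite support, is 0. *)
Definition vsum x a : V := \sum_(i <- xget [::] [set s | supp_in s a]) a i *: x i.

Lemma sum_support (W : zmodType) (F : I -> W) s t : uniq s -> uniq t ->
  (forall i, i \notin s -> F i = 0) -> (forall i, i \notin t -> F i = 0) ->
  \sum_(i <- s) F i = \sum_(i <- t) F i.
Proof.
move=> us ut Fs Ft.
rewrite (bigID (mem t)) /= [X in _ + X]big1 ?addr0; last by move=> i /Ft ->.
rewrite [RHS](bigID (mem s)) /= [X in _ + X]big1 ?addr0; last by move=> i /Fs ->.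
rewrite -[LHS]big_filter -[RHS]big_filter; apply: perm_big.
apply: uniq_perm; rewrite ?filter_uniq// => i.
by rewrite !mem_filter /= andbC.
Qed.

Lemma vsumE x a s : supp_in s a -> vsum x a = \sum_(i <- s) a i *: x i.
Proof.
move=> [us sa]; rewrite /vsum; set t := xget _ _.
have [ut ta] : supp_in t a by apply: (@xgetI _ [::] [set s | supp_in s a] s); split.
apply: sum_support => [//|//|i /ta ->|i /sa ->]; exact: scale0r.
Qed.

Lemma supp_in_sub a s t : supp_in s a -> uniq t -> {subset s <= t} -> supp_in t a.
Proof. by move=> [us sa] ut st; split => // i it; apply: sa; apply: contra it => /st. Qed.

Lemma supp_in_fsupp s a : supp_in s a -> fsupp a. Proof. by exists s. Qed.

Lemma fsupp_common a b : fsupp a -> fsupp b -> exists s, supp_in s a /\ supp_in s b.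
Proof.
move=> [s sa] [t tb]; exists (undup (s ++ t)); split;
  [apply: (supp_in_sub sa)|apply: (supp_in_sub tb)]; rewrite ?undup_uniq// => i;
  by rewrite mem_undup mem_cat => ->//; rewrite orbT.
Qed.

Lemma fsupp0 : fsupp (fun _ : I => 0 : K).
Proof. by exists [::]; split. Qed.

Lemma supp_inD s a b : supp_in s a -> supp_in s b -> supp_in s (fun i => a i + b i).
Proof. by move=> [us sa] [_ sb]; split => // i si; rewrite sa ?sb ?addr0. Qed.

Lemma supp_inZ c s a : supp_in s a -> supp_in s (fun i => c * a i).
Proof. by move=> [us sa]; split => // i si; rewrite sa ?mulr0. Qed.

Lemma fsuppD a b : fsupp a -> fsupp b -> fsupp (fun i => a i + b i).
Proof.
move=> fa fb; have [s [sa sb]] := fsupp_common fa fb; exists s; exact: supp_inD.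
Qed.

Lemma fsuppZ c a : fsupp a -> fsupp (fun i => c * a i).
Proof. by move=> [s sa]; exists s; exact: supp_inZ. Qed.

Lemma fsuppN a : fsupp a -> fsupp (fun i => - a i).
Proof. by move=> [s [us sa]]; exists s; split => // i /sa ->; rewrite oppr0. Qed.

Lemma fsuppB a b : fsupp a -> fsupp b -> fsupp (fun i => a i - b i).
Proof. by move=> fa fb; apply: fsuppD => //; exact: fsuppN. Qed.

Lemma supp_in_le s a b : supp_in s a -> (forall i, absv (b i) <= absv (a i)) -> supp_in s b.
Proof.
move=> [us sa] ba; split => // i /sa ai.
by apply: absv0_eq0; apply/eqP; rewrite eq_le absv_ge0 andbT (le_trans (ba i))// ai absv0.
Qed.

Lemma fsupp_le a b : fsupp a -> (forall i, absv (b i) <= absv (a i)) -> fsupp b.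
Proof. by move=> [s sa] ba; exists s; exact: supp_in_le sa ba. Qed.

Lemma supp_in_dlt (i : I) : supp_in [:: i] (dlt i).
Proof. by split => // j; rewrite inE /dlt => /negbTE ->. Qed.

Lemma fsupp_dlt (i : I) : fsupp (dlt i). Proof. by exists [:: i]; exact: supp_in_dlt. Qed.

Lemma vsum_dlt x i : vsum x (dlt i) = x i.
Proof. by rewrite (vsumE _ (supp_in_dlt i)) big_seq1 /dlt eqxx scale1r. Qed.

Lemma vsumD x a b : fsupp a -> fsupp b ->
  vsum x (fun i => a i + b i) = vsum x a + vsum x b.
Proof.
move=> fa fb; have [s [sa sb]] := fsupp_common fa fb.
rewrite (vsumE _ (supp_inD sa sb)) (vsumE _ sa) (vsumE _ sb) -big_split /=.
by apply: eq_bigr => i _; rewrite scalerDl.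
Qed.

Lemma vsumZ x c a : fsupp a -> vsum x (fun i => c * a i) = c *: vsum x a.
Proof.
move=> [s sa]; rewrite (vsumE _ (supp_inZ c sa)) (vsumE _ sa) scaler_sumr.
by apply: eq_bigr => i _; rewrite scalerA.
Qed.

Lemma vsum_ext x a b : a =1 b -> vsum x a = vsum x b.
Proof. by move=> /funext ->. Qed.

Lemma vsum0 x : vsum x (fun=> 0) = 0.
Proof. by rewrite (@vsumE _ _ [::]) ?big_nil//; split. Qed.

Lemma vsumN x a : fsupp a -> vsum x (fun i => - a i) = - vsum x a.
Proof.
move=> fa; rewrite -scaleN1r -vsumZ//; apply: vsum_ext => i; by rewrite mulN1r.
Qed.

Lemma vsumB x a b : fsupp a -> fsupp b ->
  vsum x (fun i => a i - b i) = vsum x a - vsum x b.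
Proof. by move=> fa fb; rewrite vsumD ?vsumN//; exact: fsuppN. Qed.

Lemma fsupp_sum (J : Type) (t : seq J) (A : J -> I -> K) :
  (forall j, fsupp (A j)) -> fsupp (fun i => \sum_(j <- t) A j i).
Proof.
move=> fA; elim: t => [|j t IH].
  by have -> : (fun i => \sum_(j <- [::]) A j i) = (fun=> 0);
    [apply/funext => i; rewrite big_nil|exact: fsupp0].
have -> : (fun i => \sum_(j' <- j :: t) A j' i) = (fun i => A j i + \sum_(j' <- t) A j' i).
  by apply/funext => i; rewrite big_cons.
exact: fsuppD.
Qed.

Lemma vsum_sum (J : Type) (t : seq J) (A : J -> I -> K) x :
  (forall j, fsupp (A j)) ->
  vsum x (fun i => \sum_(j <- t) A j i) = \sum_(j <- t) vsum x (A j).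
Proof.
move=> fA; elim: t => [|j t IH].
  by rewrite big_nil -(vsum0 x); apply: vsum_ext => i; rewrite big_nil.
rewrite big_cons -IH -vsumD//; last exact: fsupp_sum.
by apply: vsum_ext => i; rewrite big_cons.
Qed.

Lemma vsum_cst_scale (c : I -> K) x a : fsupp a ->
  vsum (fun i => c i *: x i) a = vsum x (fun i => a i * c i).
Proof.
move=> [s [us sa]]; rewrite (vsumE _ (conj us sa)) (@vsumE _ _ s).
  by apply: eq_bigr => i _; rewrite scalerA.
by split => // i /sa ->; rewrite mul0r.
Qed.

End Val.

Section Reindex.
Variables (I J : choiceType) (V : normedModType K) (f : J -> I).
Hypothesis f_inj : injective f.

(** Extension by zero along [f]. It turns coefficients of the subfamily [x \o f] into coefficients
    of [x]. *)
Definition push (a : J -> K) : I -> K := fun i =>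
  if pselect (exists j, f j = i) is left h then a (projT1 (cid h)) else 0.

Lemma push_in a j : push a (f j) = a j.
Proof.
rewrite /push; case: pselect => [h|[]]; last by exists j.
by congr a; apply: f_inj; exact: projT2 (cid h).
Qed.

Lemma push_out a i : ~ (exists j, f j = i) -> push a i = 0.
Proof. by rewrite /push; case: pselect. Qed.

Lemma push_supp s a : supp_in s a -> supp_in (map f s) (push a).
Proof.
move=> [us sa]; split; first by rewrite map_inj_uniq.
move=> i; have [[j <-]|h _] := pselect (exists j, f j = i); last exact: push_out.
by rewrite push_in mem_map// => /sa.
Qed.

Lemma push_fsupp a : fsupp a -> fsupp (push a).
Proof. by move=> [s /push_supp sa]; exists (map f s). Qed.

Lemma vsum_push (x : I -> V) a : fsupp a -> vsum x (push a) = vsum (x \o f) a.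
Proof.
move=> [s sa]; rewrite (vsumE _ (push_supp sa)) (vsumE _ sa) big_map.
by apply: eq_bigr => j _; rewrite push_in.
Qed.

Lemma push_le a b : (forall j, absv (b j) <= absv (a j)) ->
  forall i, absv (push b i) <= absv (push a i).
Proof.
move=> ba i; have [[j <-]|h] := pselect (exists j, f j = i); first by rewrite !push_in.
by rewrite !push_out.
Qed.

Lemma comp_fsupp (a : I -> K) : fsupp a -> fsupp (a \o f).
Proof.
move=> [s [us sa]].
exists (pmap (fun i => if pselect (exists j, f j = i) is left h
                       then Some (projT1 (cid h)) else None) s); split.
  rewrite (pmap_uniq (g := f))// => i; case: pselect => //= h.
  by rewrite (projT2 (cid h)).
move=> j nj; apply: sa; apply: contra nj => fjs; rewrite mem_pmap.
apply/mapP; exists (f j) => //; case: pselect => [h|[]]; last by exists j.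
by congr Some; apply: f_inj; rewrite (projT2 (cid h)).
Qed.

End Reindex.

Section Dominance.

(** Here [y] dominates [x]: the linear map sending each [y i] to [x i] has norm at most [C] on
    finite combinations. *)
Definition dom (I : choiceType) (V W : normedModType K) (C : R) (x : I -> V) (y : I -> W) :=
  forall a, fsupp a -> rn (vsum x a) <= C * rn (vsum y a).

Definition eqv (I : choiceType) (V W : normedModType K) (C : R) (x : I -> V) (y : I -> W) :=
  dom C x y /\ dom C y x.

(** Multipliers of modulus at most 1 cover restrictions to subsets and changes of sign or phase at
    once. *)
Definition uncond (I : choiceType) (V : normedModType K) (D : R) (x : I -> V) :=
  forall a b, fsupp a -> (forall i, absv (b i) <= absv (a i)) ->
    rn (vsum x b) <= D * rn (vsum x a).

Lemma dom_reindex (I J : choiceType) (V W : normedModType K) C (x : I -> V) (y : I -> W)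
  (f : J -> I) : injective f -> dom C x y -> dom C (x \o f) (y \o f).
Proof.
by move=> fi xy a fa; rewrite -!(vsum_push fi)// xy//; exact: push_fsupp.
Qed.

Lemma eqv_reindex (I J : choiceType) (V W : normedModType K) C (x : I -> V) (y : I -> W)
  (f : J -> I) : injective f -> eqv C x y -> eqv C (x \o f) (y \o f).
Proof. by move=> fi [? ?]; split; exact: dom_reindex. Qed.

Lemma uncond_reindex (I J : choiceType) (V : normedModType K) D (x : I -> V)
  (f : J -> I) : injective f -> uncond D x -> uncond D (x \o f).
Proof.
move=> fi ux a b fa ba; rewrite -!(vsum_push fi)//; last exact: fsupp_le ba.
by apply: ux; [exact: push_fsupp|exact: push_le].
Qed.

Lemma dom_trans (I : choiceType) (U V W : normedModType K) C C' (x : I -> U) (y : I -> V)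
  (z : I -> W) : 0 <= C -> dom C x y -> dom C' y z -> dom (C * C') x z.
Proof.
move=> C0 xy yz a fa; rewrite (le_trans (xy a fa))// -mulrA ler_wpM2l//.
exact: yz.
Qed.

Lemma dom_le (I : choiceType) (V W : normedModType K) C C' (x : I -> V) (y : I -> W) :
  C <= C' -> dom C x y -> dom C' x y.
Proof.
by move=> CC xy a fa; rewrite (le_trans (xy a fa))// ler_wpM2r ?rn_ge0.
Qed.

Lemma dom_scale (I : choiceType) (V : normedModType K) D C (x : I -> V) (c : I -> K) :
  0 <= D * C -> 0 <= C -> uncond D x -> (forall i, absv (c i) <= C) -> dom (D * C) (fun i => c i *: x i) x.
Proof.
move=> DC0 C0 ux cC a fa; rewrite vsum_cst_scale//.
have CE : rn (vsum x (fun i => ofreal C * a i)) = C * rn (vsum x a).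
  by rewrite vsumZ// rnZ absv_ofreal ger0_norm.
rewrite -mulrA -CE; apply: ux; first exact: fsuppZ.
by move=> i; rewrite mulrC !absvM absv_ofreal ger0_norm// ler_wpM2r ?absv_ge0.
Qed.

Lemma uncond_ge1 (I : choiceType) (V : normedModType K) D (x : I -> V) i :
  x i != 0 -> uncond D x -> 1 <= D.
Proof.
move=> xi /(_ _ _ (fsupp_dlt i) (fun=> lexx _)); rewrite vsum_dlt.
by rewrite ler_pMl ?rn_gt0.
Qed.

Lemma coord_le (I : choiceType) (V : normedModType K) D (x : I -> V) a i :
  uncond D x -> fsupp a -> absv (a i) * rn (x i) <= D * rn (vsum x a).
Proof.
move=> ux fa; rewrite -rnZ -{1}(vsum_dlt x i) -vsumZ; last exact: fsupp_dlt.
apply: ux => // j; rewrite /dlt; case: eqP => [->|_]; first by rewrite mulr1.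
by rewrite mulr0 absv0 absv_ge0.
Qed.

Lemma uncond_restr (I : choiceType) (V : normedModType K) D (x : I -> V) a (P : pred I) :
  uncond D x -> fsupp a -> rn (vsum x (fun i => if P i then a i else 0)) <= D * rn (vsum x a).
Proof.
by move=> ux fa; apply: ux => // i; case: (P i) => //; rewrite absv0 absv_ge0.
Qed.

End Dominance.

Lemma supp_in_iota n (a : nat -> K) : (forall i, (n <= i)%N -> a i = 0) -> supp_in (iota 0 n) a.
Proof.
by move=> an; split; rewrite ?iota_uniq// => i; rewrite mem_iota add0n /= -leqNgt => /an.
Qed.

Lemma fsupp_bound (a : nat -> K) : fsupp a -> exists n, forall i, (n <= i)%N -> a i = 0.
Proof.
move=> [s [us sa]]; exists (\max_(i <- s) i).+1 => i ni; apply: sa.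
by apply: contraL ni => si; rewrite -ltnNge ltnS (big_rem i)//= leq_max leqnn.
Qed.

Lemma vsum_ord_bound (V : normedModType K) n (x : nat -> V) a : (forall i, (n <= i)%N -> a i = 0) ->
  vsum x a = \sum_(i < n) a i *: x i.
Proof.
move=> /supp_in_iota /vsumE ->.
by rewrite -(big_mkord xpredT (fun i => a i *: x i)) /index_iota subn0.
Qed.

Definition trunc (n : nat) (a : nat -> K) : nat -> K := fun i => if (i < n)%N then a i else 0.

Lemma trunc_out n a i : (n <= i)%N -> trunc n a i = 0.
Proof. by rewrite /trunc ltnNge => ->. Qed.

Lemma fsupp_trunc n a : fsupp (trunc n a).
Proof. by exists (iota 0 n); apply: supp_in_iota => i; exact: trunc_out. Qed.

Lemma vsum_trunc (V : normedModType K) n (x : nat -> V) a : vsum x (trunc n a) = \sum_(i < n) a i *: x i.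
Proof.
rewrite (@vsum_ord_bound _ n); last by move=> i; exact: trunc_out.
by apply: eq_bigr => i _; rewrite /trunc ltn_ord.
Qed.

Lemma series_trunc (V : normedModType K) n (x : nat -> V) a :
  series (fun i => a i *: x i) n = vsum x (trunc n a).
Proof. by rewrite vsum_trunc /series /= big_mkord. Qed.

End FiniteSupport.
Arguments dlt {R k I} i.

(** * Infinite expansions, extension of maps by continuity, isomorphisms *)

Section Expansions.
Variables (R : realType) (k : scalar_kind).
Local Notation K := (scalars R k).
Local Notation absv := (@absv R k).
Local Notation ofreal := (@ofreal R k).

Definition expands (V : normedModType K) (x : nat -> V) (a : nat -> K) (v : V) :=
  rlim (fun n => vsum x (trunc n a)) v.

Lemma expandsP (V : normedModType K) (x : nat -> V) a v :
  (series (fun i => a i *: x i) @ \oo --> v) <-> expands x a v.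
Proof.
have E : series (fun i => a i *: x i) = fun n => vsum x (trunc n a).
  by apply/funext => n; exact: series_trunc.
by rewrite E rlimP.
Qed.

Lemma trunc_fsupp (a : nat -> K) : fsupp a ->
  exists N, forall n, (N <= n)%N -> trunc n a = a.
Proof.
move=> /fsupp_bound[N aN]; exists N => n Nn; apply/funext => i; rewrite /trunc.
by case: ltnP => // ni; rewrite aN// (leq_trans Nn).
Qed.

Lemma expands_fsupp (V : normedModType K) (x : nat -> V) a : fsupp a -> expands x a (vsum x a).
Proof.
move=> /trunc_fsupp[N aN] e e0; exists N => n /aN ->; by rewrite subrr rn0.
Qed.

Lemma expandsD (V : normedModType K) (x : nat -> V) a b v w : expands x a v -> expands x b w ->
  expands x (fun i => a i + b i) (v + w).
Proof.
move=> av bw; apply: rlim_eq (rlimD av bw) => n.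
rewrite -vsumD; [|exact: fsupp_trunc..]; apply: vsum_ext => i.
by rewrite /trunc; case: ltnP => //; rewrite addr0.
Qed.

Lemma expandsZ (V : normedModType K) (x : nat -> V) c a v : expands x a v ->
  expands x (fun i => c * a i) (c *: v).
Proof.
move=> av; apply: rlim_eq (rlimZ c av) => n.
rewrite -vsumZ; last exact: fsupp_trunc; apply: vsum_ext => i.
by rewrite /trunc; case: ltnP => //; rewrite mulr0.
Qed.

Lemma expandsB (V : normedModType K) (x : nat -> V) a b v w : expands x a v -> expands x b w ->
  expands x (fun i => a i - b i) (v - w).
Proof.
move=> av bw; rewrite -[X in v - X]scale1r -scaleNr.
have := expandsD av (expandsZ (-1) bw); congr expands.
by apply/funext => i; rewrite mulN1r.
Qed.

Lemma closed_span_vsum (V : normedModType K) (x : nat -> V) a : fsupp a ->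
  closed_span x (vsum x a).
Proof.
move=> /trunc_fsupp[N aN]; apply: subset_closure; exists N, a.
by rewrite -vsum_trunc aN.
Qed.

Lemma closed_spanP (V : normedModType K) (x : nat -> V) v :
  closed_span x v <-> exists2 A : nat -> nat -> K, forall m, fsupp (A m) & rlim (fun m => vsum x (A m)) v.
Proof.
split.
  move=> /closure_rlim[u uP uv].
  have /choice[A AP] (m : nat) : exists b, fsupp b /\ vsum x b = u m.
    have [n [a ->]] := uP m; exists (trunc n a); split; first exact: fsupp_trunc.
    exact: vsum_trunc.
  exists A => [m|]; first exact: (AP m).1.
  by apply: rlim_eq uv => m; rewrite (AP m).2.
move=> [A fA Av]; apply/closure_rnP => e /Av[N AN]; exists (vsum x (A N)); last exact: AN.
have [M AM] := trunc_fsupp (fA N); exists M, (A N).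
by rewrite -vsum_trunc AM.
Qed.

Lemma expands_closed_span (V : normedModType K) (x : nat -> V) a v :
  expands x a v -> closed_span x v.
Proof.
by move=> av; apply/closed_spanP; exists (fun m => trunc m a) => // m; exact: fsupp_trunc.
Qed.

Lemma closed_spanZD (V : normedModType K) (x : nat -> V) c v w :
  closed_span x v -> closed_span x w -> closed_span x (c *: v + w).
Proof.
move=> /closed_spanP[A fA Av] /closed_spanP[B fB Bw]; apply/closed_spanP.
exists (fun m i => c * A m i + B m i) => [m|]; first by apply: fsuppD => //; exact: fsuppZ.
apply: rlim_eq (rlimD (rlimZ c Av) Bw) => m.
by rewrite vsumD ?vsumZ//; exact: fsuppZ.
Qed.

Lemma closed_span_closed (V : normedModType K) (x : nat -> V) (u : nat -> V) v :
  (forall n, closed_span x (u n)) -> rlim u v -> closed_span x v.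
Proof.
move=> xu uv; apply: closed_closure; apply/closure_rnP => e /uv[N uN].
by exists (u N); [exact: xu|exact: uN].
Qed.

Section Unconditional.
Variables (V : normedModType K) (x : nat -> V) (D : R).
Hypotheses (ux : uncond D x) (x0 : forall i, x i != 0).

Let D0 : 0 < D. Proof. exact: lt_le_trans ltr01 (uncond_ge1 (x0 0%N) ux). Qed.

Lemma expands_coord a v i : expands x a v -> absv (a i) * rn (x i) <= D * rn v.
Proof.
move=> av; rewrite mulrC -ler_pdivrMl// mulrC; apply/ler_addgt0Pr => e e0.
have [N aN] := av _ e0; set n := maxn N i.+1.
have := coord_le i ux (fsupp_trunc n a); rewrite {1}/trunc leq_maxr.
rewrite mulrC -ler_pdivrMl// mulrC => /le_trans; apply.
rewrite -[X in rn X](subrK v) (le_trans (rnD _ _))// addrC lerD2l ltW//.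
by rewrite aN// leq_maxl.
Qed.

Lemma expands_uniq a b v : expands x a v -> expands x b v -> a = b.
Proof.
move=> av bv; apply/funext => i.
have := expands_coord i (expandsB av bv); rewrite subrr rn0 mulr0.
rewrite pmulr_lle0 ?rn_gt0// => h; apply/eqP; rewrite -subr_eq0; apply/eqP/absv0_eq0.
by apply/eqP; rewrite eq_le h absv_ge0.
Qed.

(** Unconditionality upgrades the Cauchy condition on consecutive partial sums to smallness of all
    finite combinations supported far out, which is what rearrangements need. *)
Lemma expands_tail a v e : expands x a v -> 0 < e ->
  exists N, forall b, fsupp b -> (forall i, (i < N)%N -> b i = 0) ->
    (forall i, absv (b i) <= absv (a i)) -> rn (vsum x b) < e.
Proof.
move=> av e0; have [|N aN] := rlim_cauchy av (e := e / D); first exact: divr_gt0.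
exists N => b fb bN ba; have [M bM] := fsupp_bound fb.
have := aN (maxn M N) N (leq_maxr _ _) (leqnn _).
rewrite ltr_pdivlMr// mulrC; apply: le_lt_trans.
rewrite -vsumB; [|exact: fsupp_trunc..].
apply: ux; first by apply: fsuppB; exact: fsupp_trunc.
move=> i; rewrite /trunc; have [iN|Ni] := ltnP i N; first by rewrite bN// absv0 absv_ge0.
have [iM|Mi] := ltnP; first by rewrite subr0.
by rewrite bM ?absv0 ?absv_ge0// (leq_trans (leq_maxl M N)).
Qed.

Lemma expands_perm a v (p : nat -> nat) : bijective p -> expands x a v ->
  expands (x \o p) (a \o p) v.
Proof.
move=> pb av e e0; have pi := bij_inj pb; have [q pq qp] := pb.
have e20 : 0 < e / 2 by rewrite divr_gt0.
have [N tN] := expands_tail av e20; have [N' aN'] := av _ e20.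
set M := maxn N N'.
(* From this length on, the rearranged partial sum contains every term of index below [M]. *)
exists (\max_(i < M) (q i).+1) => n nM.
have ft := fsupp_trunc n (a \o p); have fM := fsupp_trunc M a.
rewrite -(vsum_push pi)// -(subrK (vsum x (trunc M a)) (vsum x (push _ _))) -addrA.
rewrite (le_lt_trans (rnD _ _))// (splitr e) ltrD//; last by rewrite aN' ?leq_maxr.
rewrite -vsumB//; last exact: push_fsupp.
have pushE i : push p (trunc n (a \o p)) i = if (q i < n)%N then a i else 0.
  by rewrite -{1}(qp i) push_in// /trunc /= qp.
apply: tN; first by apply: fsuppB => //; exact: push_fsupp.
  move=> i iN; have iM : (i < M)%N by rewrite (leq_trans iN)// leq_maxl.
  rewrite pushE /trunc iM ifT ?subrr//.
  by apply: leq_trans nM; exact: (leq_bigmax (Ordinal iM)).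
move=> i; rewrite pushE /trunc; have [iM|_] := ltnP i M.
  rewrite ifT ?subrr ?absv0 ?absv_ge0//.
  by apply: leq_trans nM; exact: (leq_bigmax (Ordinal iM)).
by rewrite subr0; case: ifP => // _; rewrite absv0 absv_ge0.
Qed.

End Unconditional.

Lemma rlim_scalar (V : normedModType K) (u : nat -> K) l (v : V) :
  (forall e : R, 0 < e -> exists N, forall n, (N <= n)%N -> absv (u n - l) < e) ->
  rlim (fun n => u n *: v) (l *: v).
Proof.
move=> ul e e0; have v1 : 0 < rn v + 1 by rewrite ltr_wpDl ?rn_ge0.
have [|N uN] := ul (e / (rn v + 1)); first by rewrite divr_gt0.
exists N => n /uN; rewrite -scalerBl rnZ ltr_pdivlMr//; apply: le_lt_trans.
by rewrite ler_wpM2l ?absv_ge0// lerDl.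
Qed.

Lemma rlim_sum (V : normedModType K) (I : Type) (s : seq I) (u : I -> nat -> V) l :
  (forall i, rlim (u i) (l i)) -> rlim (fun n => \sum_(i <- s) u i n) (\sum_(i <- s) l i).
Proof.
move=> ul; elim: s => [|i s IH].
  by rewrite big_nil; apply: rlim_eq (rlim_cst _) => n; rewrite big_nil.
by rewrite big_cons; apply: rlim_eq (rlimD (ul i) IH) => n; rewrite big_cons.
Qed.

Section Expand.
Variables (V : normedModType K) (x : nat -> V) (D : R).
Hypotheses (ux : uncond D x) (x0 : forall i, x i != 0).

Let D0 : 0 < D. Proof. exact: lt_le_trans ltr01 (uncond_ge1 (x0 0%N) ux). Qed.

(** By [coord_le] each coefficient of the approximating finite combinations is Cauchy. Passing to
    the limit within a fixed truncation gives an error bound that does not depend on the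
    truncation. *)
Lemma closed_span_expands v : closed_span x v -> exists a, expands x a v.
Proof.
move=> /closed_spanP[A fA Av].
have /choice[a aP] (i : nat) : exists l, forall e : R, 0 < e ->
    exists N, forall n, (N <= n)%N -> absv (A n i - l) < e.
  apply: scalar_complete => e e0.
  have e1 : 0 < e * rn (x i) / D by rewrite divr_gt0// mulr_gt0// rn_gt0.
  have [N AN] := rlim_cauchy Av e1; exists N => m n Nm Nn.
  rewrite -(ltr_pM2r (rn_gt0 (x0 i))).
  apply: (le_lt_trans (coord_le i ux (fsuppB (fA m) (fA n)))).
  by rewrite vsumB// mulrC -ltr_pdivlMr// AN.
(* Truncating the difference of two approximants costs [D] times 2 e1, and the approximant itself is
   within e1 of [v]. *)
exists a => e e0; set e1 := e / (2 * D + 1).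
have e10 : 0 < e1 by rewrite divr_gt0// ltr_wpDl// mulr_ge0// ltW.
have [m Am] := Av _ e10; have [N AN] := trunc_fsupp (fA m); exists N => n Nn.
have tl : rlim (fun m' => vsum x (trunc n (A m')) - vsum x (trunc n (A m)))
    (vsum x (trunc n a) - vsum x (A m)).
  rewrite AN//; apply: rlimD (rlim_cst _); rewrite vsum_trunc.
  apply: (@rlim_eq _ _ _ (fun m' => \sum_(i < n) A m' i *: x i)).
    by move=> m'; rewrite vsum_trunc.
  by apply: rlim_sum => i; exact: rlim_scalar (aP i).
apply: (le_lt_trans (rn_tri _ (vsum x (A m)) _)).
have -> : e = e1 * (2 * D) + e1.
  rewrite -[X in _ = _ + X]mulr1 -mulrDr /e1 divfK// gt_eqF// ltr_wpDl// mulr_ge0//.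
  exact: ltW.
apply: ler_ltD; last exact: Am.
apply: (rlim_le tl (N := m)) => m' mm'.
rewrite -vsumB; [|exact: fsupp_trunc..].
apply: (@le_trans _ _ (D * rn (vsum x (fun i => A m' i - A m i)))).
  apply: ux; first exact: fsuppB.
  by move=> i; rewrite /trunc; case: ltnP => //; rewrite subrr absv0 absv_ge0.
rewrite vsumB// (mulrC 2) mulrA -[e1 * D]mulrC -mulrA ler_wpM2l ?(ltW D0)//.
apply: (le_trans (rn_tri _ v _)); rewrite mulr2n mulrDr mulr1 lerD// ltW ?Am//.
by rewrite rnB Am.
Qed.

Lemma uncond_basis : unconditional_basis (closed_span x) x.
Proof.
split; first split.
- by move=> n; rewrite -(vsum_dlt x n); apply: closed_span_vsum; exact: fsupp_dlt.
- move=> y /closed_span_expands[a ay]; exists a; split; first exact/expandsP.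
  by move=> b /expandsP yb; exact: (expands_uniq ux x0 ay yb).
move=> a y /expandsP ay p pb; apply/expandsP.
exact: (expands_perm ux x0 pb ay).
Qed.

End Expand.

Lemma lip_within (V W : normedModType K) (A : set V) (T : V -> W) (C : R) :
  (forall u v, A u -> A v -> rn (T u - T v) <= C * rn (u - v)) ->
  {within A, continuous T}.
Proof.
move=> TC; apply/subspace_continuousP => v Av; apply/cvgrPdist_lt => e e0.
have ee : ofreal (absv e) = e by rewrite ofreal_absv ger0_norm// ltW.
have e0' : 0 < absv e by rewrite -(@ofreal_lt R k) ofreal0 ee.
have C1 : 0 < `|C| + 1 by rewrite ltr_wpDl.
rewrite near_withinE; near=> u => Au.
rewrite -ofreal_rn -ee ofreal_lt (le_lt_trans (TC _ _ Av Au))//.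
apply: (@le_lt_trans _ _ ((`|C| + 1) * rn (v - u))).
  by rewrite ler_wpM2r ?rn_ge0// (le_trans (ler_norm _))// lerDl.
rewrite mulrC -ltr_pdivlMr// -(@ofreal_lt R k) ofreal_rn; near: u.
apply: cvgr_dist_lt; first exact: cvg_id.
by rewrite -(ofreal0 R k) ofreal_lt divr_gt0.
Unshelve. all: by end_near. Qed.

Lemma within_rlim (V W : normedModType K) (A : set V) (T : V -> W) v e :
  {within A, continuous T} -> A v -> 0 < e ->
  exists2 d : R, 0 < d & forall u, A u -> rn (u - v) < d -> rn (T u - T v) < e.
Proof.
move=> /subspace_continuousP cT Av e0.
have /cvgrPdist_lt/(_ (ofreal e)) := cT v Av.
rewrite -{1}(ofreal0 R k) ofreal_lt => /(_ e0).
rewrite near_withinE => /nbhs_ballP[d /= d0 dv].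
have dd : ofreal (absv d) = d by rewrite ofreal_absv ger0_norm// ltW.
exists (absv d) => [|u Au uv]; first by rewrite -(@ofreal_lt R k) ofreal0 dd.
rewrite rnB -(@ofreal_lt R k) ofreal_rn; apply: dv => //.
by rewrite -ball_normE /= -ofreal_rn -dd ofreal_lt rnB.
Qed.

Section Extension.
Variables (V W : normedModType K) (x : nat -> V) (y : nat -> W) (C : R).
Hypotheses (C0 : 0 <= C) (yx : dom C y x).
Variable (D : R).
Hypotheses (ux : uncond D x) (x0 : forall i, x i != 0).
Hypothesis (y_complete : forall a v, expands x a v -> exists w, expands y a w).

(** The value is 0 where [v] has no expansion. The assumption [y_complete] replaces completeness of
    [W], so that [W] may be one of the sequence spaces, which are declared as normed modules
    only. *)
Definition extend (v : V) : W :=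
  xget 0 [set w | exists2 a, expands x a v & expands y a w].

Lemma extend_expands a v : expands x a v -> expands y a (extend v).
Proof.
move=> av; have [w aw] := y_complete av; rewrite /extend.
have [|b bv bw] := @xgetPex _ 0 [set w | exists2 a, expands x a v & expands y a w].
  by exists w, a.
by rewrite (expands_uniq ux x0 av bv).
Qed.

Lemma extend_unique a v w : expands x a v -> expands y a w -> extend v = w.
Proof. by move=> av; apply: rlim_uniq; exact: extend_expands. Qed.

Lemma extend_vsum a : fsupp a -> extend (vsum x a) = vsum y a.
Proof. by move=> fa; apply: (@extend_unique a); exact: expands_fsupp. Qed.

Lemma extend_basis i : extend (x i) = y i.
Proof. by rewrite -(vsum_dlt x) extend_vsum ?vsum_dlt//; exact: fsupp_dlt. Qed.

Lemma extend_linear c u v : closed_span x u -> closed_span x v ->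
  extend (c *: u + v) = c *: extend u + extend v.
Proof.
move=> /(closed_span_expands ux x0)[a au] /(closed_span_expands ux x0)[b bv].
apply: (extend_unique (a := fun i => c * a i + b i)).
  by apply: expandsD => //; exact: expandsZ.
by apply: expandsD; [apply: expandsZ|]; exact: extend_expands.
Qed.

Lemma extend_bound v : closed_span x v -> rn (extend v) <= C * rn v.
Proof.
move=> /(closed_span_expands ux x0)[a av].
apply/ler_addgt0Pr => e e0; have C1 : 0 < C + 1 by rewrite ltr_wpDl.
have [N vN] := av _ (divr_gt0 e0 C1).
apply: (rlim_le (extend_expands av) (N := N)) => n /vN vn.
apply: (le_trans (yx (fsupp_trunc n a))).
rewrite -[X in rn X](subrK v) (le_trans (ler_wpM2l C0 (rnD _ _)))//.
rewrite mulrDr addrC lerD2l (@le_trans _ _ ((C + 1) * rn (vsum x (trunc n a) - v)))//.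
  by rewrite ler_wpM2r ?rn_ge0// lerDl.
by rewrite mulrC -ler_pdivlMr// ltW.
Qed.

Lemma extend_span v : closed_span x v -> closed_span y (extend v).
Proof.
move=> /(closed_span_expands ux x0)[a av].
exact: expands_closed_span (extend_expands av).
Qed.

Lemma extend_lip u v : closed_span x u -> closed_span x v ->
  rn (extend u - extend v) <= C * rn (u - v).
Proof.
move=> xu xv; have := extend_linear (-1) xv xu.
rewrite !scaleN1r addrC => E; rewrite [X in rn X]addrC -E; apply: extend_bound.
by rewrite addrC -scaleN1r; exact: closed_spanZD.
Qed.

End Extension.

Lemma complete_expands (V : normedModType K) (W : completeNormedModType K) (x : nat -> V)
    (y : nat -> W) C : 0 <= C -> dom C y x ->
  forall a v, expands x a v -> exists w, expands y a w.
Proof.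
move=> C0 yx a v av; apply: rn_complete => e e0.
have C1 : 0 < C + 1 by rewrite ltr_wpDl.
have [N aN] := rlim_cauchy av (divr_gt0 e0 C1); exists N => m n Nm Nn.
rewrite -vsumB; [|exact: fsupp_trunc..].
apply: (le_lt_trans (yx _ (fsuppB (fsupp_trunc m a) (fsupp_trunc n a)))).
rewrite vsumB; [|exact: fsupp_trunc..].
have := aN _ _ Nm Nn; rewrite ltr_pdivlMr// mulrC; apply: le_lt_trans.
by rewrite ler_wpM2r ?rn_ge0// lerDl.
Qed.

(** The lower estimate makes [extend] injective with Lipschitz inverse; together with completeness
    of [V] it lifts limits back, so that the whole closed span of [y] is reached. *)
Lemma eqv_equivalent (V : completeNormedModType K) (W : normedModType K) (x : nat -> V)
    (y : nat -> W) C D : 0 <= C -> eqv C x y -> uncond D x -> (forall i, x i != 0) ->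
  (forall a v, expands x a v -> exists w, expands y a w) -> equivalent x y.
Proof.
move=> C0 [xy yx] ux x0 ye; pose T := extend x y.
have Tlow v : closed_span x v -> rn v <= C * rn (T v).
  move=> /(closed_span_expands ux x0)[a av].
  apply/ler_addgt0Pr => e e0; have C1 : 0 < C + 1 by rewrite ltr_wpDl.
  have aT := extend_expands ux x0 ye av.
  have [N vN] := aT _ (divr_gt0 e0 C1).
  apply: (rlim_le av (N := N)) => n /vN vn.
  apply: (le_trans (xy _ (fsupp_trunc n a))).
  rewrite -[X in rn X](subrK (T v)) (le_trans (ler_wpM2l C0 (rnD _ _)))//.
  rewrite mulrDr addrC lerD2l.
  rewrite (@le_trans _ _ ((C + 1) * rn (vsum y (trunc n a) - T v)))//.
    by rewrite ler_wpM2r ?rn_ge0// lerDl.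
  by rewrite mulrC -ler_pdivlMr// ltW.
have Tonto w : closed_span y w -> exists v, closed_span x v /\ T v = w.
  move=> /closed_spanP[A fA Aw].
  have [v Av] : exists v, rlim (fun m => vsum x (A m)) v.
    apply: rn_complete => e e0; have C1 : 0 < C + 1 by rewrite ltr_wpDl.
    have [N AN] := rlim_cauchy Aw (divr_gt0 e0 C1); exists N => m n Nm Nn.
    rewrite -vsumB//; apply: (le_lt_trans (xy _ (fsuppB (fA m) (fA n)))).
    rewrite vsumB//; have := AN _ _ Nm Nn; rewrite ltr_pdivlMr// mulrC; apply: le_lt_trans.
    by rewrite ler_wpM2r ?rn_ge0// lerDl.
  have xv : closed_span x v by apply/closed_spanP; exists A.
  exists v; split => //; apply: rlim_uniq Aw.
  move=> e e0; have C1 : 0 < C + 1 by rewrite ltr_wpDl.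
  have [N AN] := Av _ (divr_gt0 e0 C1); exists N => n /AN An.
  rewrite -(extend_vsum ux x0 ye (fA n)).
  have le := extend_lip C0 yx ux x0 ye (closed_span_vsum (fA n)) xv.
  apply: (le_lt_trans le).
  move: An; rewrite ltr_pdivlMr// mulrC; apply: le_lt_trans.
  by rewrite ler_wpM2r ?rn_ge0// lerDl.
pose S w := xget 0 [set v | closed_span x v /\ T v = w].
have SP w : closed_span y w -> closed_span x (S w) /\ T (S w) = w.
  by move=> /Tonto[v vP]; apply: (@xgetI _ _ [set v | closed_span x v /\ T v = w] v).
have Tinj u v : closed_span x u -> closed_span x v -> rn (u - v) <= C * rn (T u - T v).
  move=> xu xv; have := extend_linear ux x0 ye (-1) xv xu.
  rewrite !scaleN1r addrC => E; rewrite [X in _ <= _ * rn X]addrC -E; apply: Tlow.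
  by rewrite addrC -scaleN1r; exact: closed_spanZD.
exists T; split; last by move=> n; exact: (extend_basis ux x0 ye n).
split.
- by move=> c u v; exact: (extend_linear ux x0 ye).
- by apply: (lip_within (C := C)) => u v; exact: (extend_lip C0 yx ux x0 ye).
- by move=> u; exact: (extend_span ux x0 ye).
exists S; split.
- apply: (lip_within (C := C)) => u v yu yv.
  have [xu Tu] := SP _ yu; have [xv Tv] := SP _ yv.
  by rewrite -{2}Tu -{2}Tv; exact: Tinj.
- by move=> w /SP[].
- move=> u xu; have [xs Ts] := SP _ (extend_span ux x0 ye xu).
  apply/eqP; rewrite -subr_eq0; apply/eqP/rn0_eq0/eqP; rewrite eq_le rn_ge0 andbT.
  by rewrite (le_trans (Tinj _ _ xs xu))// Ts subrr rn0 mulr0.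
- by move=> w /SP[].
Qed.

Section FromIsomorphism.
Variables (V W : normedModType K) (A : set V) (B : set W) (T : V -> W).
Hypothesis A_lin : forall (c : K) u v, A u -> A v -> A (c *: u + v).
Hypothesis A0 : A 0.

Lemma linear_within_bound : (forall (c : K) u v, A u -> A v -> T (c *: u + v) = c *: T u + T v) ->
  {within A, continuous T} -> exists2 C : R, 0 <= C & forall u, A u -> rn (T u) <= C * rn u.
Proof.
move=> Tl cT.
have T0 : T 0 = 0.
  have := Tl 1 0 0 A0 A0; rewrite !scale1r addr0 => /eqP.
  by rewrite -subr_eq0 opprD addNKr oppr_eq0 => /eqP.
have [d d0 dT] := within_rlim cT A0 ltr01.
have TZ c u : A u -> T (c *: u) = c *: T u.
  by move=> Au; rewrite -[c *: u]addr0 Tl// T0 addr0.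
have AZ c u : A u -> A (c *: u) by move=> Au; rewrite -[c *: u]addr0; exact: A_lin.
exists (2 / d) => [|u Au]; first by rewrite divr_ge0// ltW.
have [->|u0] := eqVneq u 0; first by rewrite T0 !rn0 mulr0.
(* Scaling [u] to norm d / 2 puts it in the ball on which [T] has norm below 1. *)
have un := rn_gt0 u0; pose c := d / 2 / rn u.
have c0 : 0 < c by rewrite !divr_gt0.
have := dT _ (AZ (ofreal c) u Au); rewrite T0 !subr0 TZ// !rnZ absv_ofreal gtr0_norm//.
rewrite {1}/c divfK ?gt_eqF// ltr_pdivrMr// ltr_pMr// ltr1n => /(_ isT) /ltW.
rewrite mulrC -ler_pdivlMr// => /le_trans; apply.
by rewrite /c invf_div mul1r mulrC invf_div.
Qed.

End FromIsomorphism.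

Lemma isomorphism_bounds (V W : normedModType K) (A : set V) (B : set W) (T : V -> W) :
  (forall (c : K) u v, A u -> A v -> A (c *: u + v)) -> A 0 -> 
  (forall (c : K) u v, B u -> B v -> B (c *: u + v)) ->
  isomorphism A B T -> exists2 C : R, 0 <= C &
   forall u, A u -> rn (T u) <= C * rn u /\ rn u <= C * rn (T u).
Proof.
move=> Al A0 Bl [Tl cT TB [S [cS SA ST TS]]].
have T0 : T 0 = 0.
  have := Tl 1 0 0 A0 A0; rewrite !scale1r addr0 => /eqP.
  by rewrite -subr_eq0 opprD addNKr oppr_eq0 => /eqP.
have B0 : B 0 by rewrite -T0; exact: TB.
have Sl (c : K) u v : B u -> B v -> S (c *: u + v) = c *: S u + S v.
  move=> Bu Bv; rewrite -{1}(TS u)// -{1}(TS v)// -Tl ?ST//; try exact: SA.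
  by apply: Al; exact: SA.
have [C C0 TC] := linear_within_bound Al A0 Tl cT.
have [C' C'0 SC] := linear_within_bound Bl B0 Sl cS.
exists (C + C') => [|u Au]; first exact: addr_ge0.
split; first by rewrite (le_trans (TC _ Au))// ler_wpM2r ?rn_ge0// lerDl.
have := SC _ (TB _ Au); rewrite ST// => /le_trans; apply.
by rewrite ler_wpM2r ?rn_ge0// lerDr.
Qed.

End Expansions.

(** The intervals from [m j] to [m j.+1] partition the natural numbers. This serves to glue objects
    built interval by interval. *)
Lemma locate_exists (m : nat -> nat) : m 0%N = 0%N -> (forall j, (m j < m j.+1)%N) ->
  exists idx : nat -> nat, (forall n, (m (idx n) <= n < m (idx n).+1)%N) /\
    forall n j, (m j <= n < m j.+1)%N -> idx n = j.
Proof.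
move=> m0 mS.
have mono i j : (i <= j)%N -> (m i <= m j)%N.
  by move=> /subnK <-; elim: (j - i)%N => // d IH; rewrite (leq_trans IH)// addSn ltnW.
have mge j : (j <= m j)%N by elim: j => // j IH; rewrite (leq_ltn_trans IH).
have /choice[idx idxP] (n : nat) : exists j, (m j <= n < m j.+1)%N.
  have ex : exists j, (n < m j.+1)%N by exists n; exact: leq_ltn_trans (mge n) (mS n).
  have jP := ex_minnP ex; case: jP => j nj jmin; exists j; rewrite nj andbT.
  case: j nj jmin => [|j] nj jmin; first by rewrite m0.
  by rewrite leqNgt; apply/negP => /jmin; rewrite ltnn.
exists idx; split => // n j /andP[jn nj]; have /andP[in_ ni] := idxP n.
apply/eqP; rewrite eqn_leq; apply/andP; split; rewrite leqNgt; apply/negP => /mono h.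
  by have := leq_trans (leq_trans nj h) in_; rewrite ltnn.
by have := leq_trans (leq_trans ni h) jn; rewrite ltnn.
Qed.

(** * The constant of an unconditional basis *)

Section UnconditionalConstant.
Variables (R : realType) (k : scalar_kind).
Local Notation K := (scalars R k).
Local Notation absv := (@absv R k).
Local Notation ofreal := (@ofreal R k).

(** Otherwise sets with a sum of norm above 1 occur arbitrarily far out and can be placed in
    successive intervals. A permutation that lists each such set first within its interval violates
    the Cauchy condition. *)
Lemma unordered_bounded (V : normedModType K) (y : nat -> V) :
  (forall p : nat -> nat, bijective p ->
     exists v, rlim (fun n => \sum_(i < n) y (p i)) v) ->
  exists B, forall s, uniq s -> rn (\sum_(i <- s) y i) <= B.
Proof.
move=> hp.
suff [m mP] : exists m, forall s, uniq s -> (forall i, i \in s -> (m <= i)%N) ->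
    rn (\sum_(i <- s) y i) <= 1.
  exists (\sum_(i < m) rn (y i) + 1) => s us.
  rewrite (bigID (fun i => (i < m)%N)) /= (le_trans (rnD _ _))// lerD//.
    apply: (le_trans (rn_sum _ _ _)).
    rewrite -(big_mkord xpredT (fun i => rn (y i))) -[leLHS]big_filter.
    rewrite [leRHS](bigID (mem s)) /= -[X in _ <= X + _]big_filter.
    rewrite (perm_big [seq i <- index_iota 0 m | i \in s]); last first.
      apply: uniq_perm; rewrite ?filter_uniq ?iota_uniq// => i.
      by rewrite !mem_filter mem_index_iota /= andbC.
    by rewrite lerDl sumr_ge0// => i _; exact: rn_ge0.
  rewrite -big_filter; apply: mP; rewrite ?filter_uniq// => i.
  by rewrite mem_filter -leqNgt => /andP[].
apply: contrapT => /forallNP hm.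
have /choice[S SP] (m : nat) : exists s, [/\ uniq s, (forall i, i \in s -> (m <= i)%N) &
    1 < rn (\sum_(i <- s) y i)].
  have /existsNP[s /not_implyP[us /not_implyP[ms /negP]]] := hm m.
  by rewrite -ltNge; exists s.
pose m := fix m j := if j is j'.+1 then maxn (m j').+1 (\max_(i <- S (m j')) i).+1 else 0%N.
have mS j : (m j < m j.+1)%N by rewrite /= leq_maxl.
have mj j i : i \in S (m j) -> (m j <= i < m j.+1)%N.
  move=> iS; have [_ /(_ _ iS) -> _] := SP (m j).
  by rewrite /= leq_max; apply/orP; right; rewrite ltnS (big_rem i)//= leq_max leqnn.
have m0 : m 0%N = 0%N by [].
clearbody m.
have [idx [idxP idxU]] := locate_exists m0 mS.
(* The new order of the j-th interval; [p] and its inverse [q] concatenate these lists. *)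
pose L j := S (m j) ++ [seq i <- index_iota (m j) (m j.+1) | i \notin S (m j)].
have Lp j : perm_eq (L j) (index_iota (m j) (m j.+1)).
  have [uS _ _] := SP (m j); apply: uniq_perm; rewrite ?iota_uniq//.
    rewrite cat_uniq uS filter_uniq ?iota_uniq// andbT /=.
    by apply/hasPn => i; rewrite mem_filter => /andP[].
  move=> i; rewrite mem_cat mem_filter mem_index_iota.
  by have [/mj ->|] := boolP (i \in S (m j)).
have Ls j : size (L j) = (m j.+1 - m j)%N by rewrite (perm_size (Lp j)) size_iota.
have Lu j : uniq (L j) by rewrite (perm_uniq (Lp j)) iota_uniq.
have Lm j i : (i \in L j) = (m j <= i < m j.+1)%N by rewrite (perm_mem (Lp j)) mem_index_iota.
pose p n := nth 0%N (L (idx n)) (n - m (idx n)).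
pose q i := (m (idx i) + index i (L (idx i)))%N.
have psz n : (n - m (idx n) < size (L (idx n)))%N.
  by rewrite Ls; have := idxP n; lia.
have pidx n : idx (p n) = idx n by apply: idxU; rewrite -Lm mem_nth.
have qidx i : idx (q i) = idx i.
  apply: idxU; rewrite /q leq_addr /=.
  have : i \in L (idx i) by rewrite Lm.
  rewrite -index_mem Ls; have := mS (idx i); lia.
have pb : bijective p.
  exists q => n.
    by rewrite /q pidx index_uniq//; have := idxP n; lia.
  rewrite /p qidx /q addKn nth_index// Lm; exact: idxP.
have [v /rlim_cauchy/(_ _ ltr01)[N NP]] := hp p pb.
have mge j : (j <= m j)%N by elim: j => // j IH; rewrite (leq_ltn_trans IH).
have [uS _ lt1] := SP (m N); set sz := size (S (m N)).
have := NP (m N + sz)%N (m N) (leq_trans (mge N) (leq_addr _ _)) (mge N).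
rewrite big_split_ord /= addrAC subrr add0r.
suff -> : \sum_(i < sz) y (p (m N + i)%N) = \sum_(i <- S (m N)) y i.
  by move=> /(lt_trans lt1); rewrite ltxx.
rewrite (big_nth 0%N) big_mkord; apply: eq_bigr => i _; congr y.
have idxN : idx (m N + i)%N = N.
  apply: idxU; rewrite leq_addr /=.
  have : (sz <= size (L N))%N by rewrite size_cat leq_addr.
  by rewrite Ls; have := ltn_ord i; have := mS N; lia.
by rewrite /p idxN addKn nth_cat ltn_ord.
Qed.

(* The library proves Baire's theorem for real scalars only. *)
Lemma baire (V : completeNormedModType K) (F : nat -> set V) :
  (forall v, exists m, F m v) ->
  exists m v0, exists2 d : R, 0 < d & forall v, rn (v - v0) < d ->
    forall e : R, 0 < e -> exists2 w, F m w & rn (v - w) < e.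
Proof.
move=> Fc; apply: contrapT => H.
(* [F m] is avoided on twice the radius, because the limit of the centres is only known to lie in
   the closed ball. *)
have step m (b : V * R) : exists b' : V * R, 0 < b.2 ->
    [/\ 0 < b'.2, b'.2 <= b.2 / 2, rn (b'.1 - b.1) < b.2 / 2 &
      forall w, rn (w - b'.1) < b'.2 * 2 -> ~ F m w].
  have [b0|b0] := ltP 0 b.2; last by exists b.
  apply: contrapT => H'; apply: H; exists m, b.1; exists (b.2 / 2); first by rewrite divr_gt0.
  move=> v vb e e0; apply: contrapT => H''.
  apply: H'; exists (v, Num.min (b.2 / 2) (e / 2)) => _ /=; split => //.
  - by rewrite lt_min !divr_gt0.
  - by rewrite ge_min lexx.
  move=> w; rewrite rnB => wv Fw; apply: H''; exists w => //.
  by apply: lt_le_trans wv _; rewrite -ler_pdivlMr// ge_min lexx orbT.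
have /choice[f fP] : forall mb : nat * (V * R), exists b' : V * R, 0 < mb.2.2 ->
    [/\ 0 < b'.2, b'.2 <= mb.2.2 / 2, rn (b'.1 - mb.2.1) < mb.2.2 / 2 &
      forall w, rn (w - b'.1) < b'.2 * 2 -> ~ F mb.1 w].
  by move=> [m b]; exact: step.
pose b := fix b n := if n is n'.+1 then f (n', b n') else (0 : V, 1 : R).
have b0 n : 0 < (b n).2 by elim: n => //= n IH; have [] := fP (n, b n) IH.
have bP n := fP (n, b n) (b0 n); rewrite /= in bP.
have near n d : rn ((b (n + d)%N).1 - (b n).1) + (b (n + d)%N).2 <= (b n).2.
  elim: d => [|d IH]; first by rewrite addn0 subrr rn0 add0r.
  have [p1 p2 p3 _] := bP (n + d)%N.
  apply: le_trans IH; rewrite addnS (le_trans (lerD (rn_tri _ (b (n + d)%N).1 _) (lexx _)))//.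
  by rewrite -addrA addrCA lerD2l /=; lra.
have half n : (b n).2 <= 2^-1 ^+ n.
  elim: n => [|n IH]; first by rewrite expr0.
  by have [_ + _ _] := bP n; rewrite exprS /= => /le_trans; apply; rewrite mulrC ler_wpM2l.
have [l bl] : exists l, rlim (fun n => (b n).1) l.
  apply: rn_complete => e e0.
  have h1 : `|2^-1 : R| < 1 by rewrite ger0_norm ?invf_lt1 ?ltr1n.
  have e20 : 0 < e / 2 by rewrite divr_gt0.
  have /cvgrPdist_lt/(_ _ e20)[N _ NP] := cvg_expr h1.
  have close n : (N <= n)%N -> rn ((b n).1 - (b N).1) < e / 2.
    move=> Nn; have := near N (n - N)%N; rewrite subnKC// => h.
    apply: (@le_lt_trans _ _ (b N).2).
      by rewrite (le_trans _ h)// lerDl ltW.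
    apply: (le_lt_trans (half N)); have := NP N (leqnn N).
    by rewrite /= sub0r normrN ger0_norm// exprn_ge0.
  exists N => m n /close Nm /close Nn.
  apply: (le_lt_trans (rn_tri _ (b N).1 _)).
  by rewrite (splitr e) ltrD// rnB.
have [m Fm] := Fc l; have [_ _ _ /(_ l)] := bP m; apply => //.
apply: (@le_lt_trans _ _ (b m.+1).2); last by rewrite ltr_pMr ?b0// ltr1n.
rewrite rnB; have bl' : rlim (fun n => (b m.+1).1 - (b n).1) ((b m.+1).1 - l).
  apply: rlimD; first exact: rlim_cst.
  by rewrite -(scaleN1r l); apply: rlim_eq (rlimZ (-1) bl) => n; rewrite scaleN1r.
apply: (rlim_le bl' (N := m.+1)) => n mn.
have := near m.+1 (n - m.+1)%N; rewrite subnKC// rnB => h.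
by rewrite (le_trans _ h)// lerDl ltW.
Qed.

(** The norm is convex in each multiplier, hence largest when all are 0 or 1, that is, at a subset
    sum. In the induction [w] absorbs the terms already decided. *)
Lemma convex_multiplier (V : normedModType K) (I : eqType) (s : seq I) (y : I -> V) (t : I -> R) B :
  (forall i, 0 <= t i <= 1) -> uniq s ->
  (forall P : pred I, rn (\sum_(i <- s | P i) y i) <= B) ->
  rn (\sum_(i <- s) ofreal (t i) *: y i) <= B.
Proof.
move=> t01 us H.
suff : forall w, (forall P : pred I, rn (w + \sum_(i <- s | P i) y i) <= B) ->
    rn (w + \sum_(i <- s) ofreal (t i) *: y i) <= B.
  by move=> /(_ 0); rewrite add0r; apply => P; rewrite add0r.
elim: s us {H} => [|i s IH] /= us w H.
  by have := H xpredT; rewrite !big_nil.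
have /andP[t0 t1] := t01 i; have /andP[is_ us'] := us.
rewrite big_cons.
rewrite (_ : w + _ = ofreal (t i) *: (w + y i + \sum_(j <- s) ofreal (t j) *: y j) +
   ofreal (1 - t i) *: (w + \sum_(j <- s) ofreal (t j) *: y j)); last first.
  rewrite ofrealB ofreal1 scalerBl scale1r [in RHS](addrAC w) [X in _ = X + _]scalerDr.
  by rewrite [RHS]addrC [RHS]addrA subrK [X in w + X]addrC addrA.
apply: (le_trans (rnD _ _)); rewrite !rnZ !absv_ofreal !ger0_norm ?subr_ge0//.
have -> : B = t i * B + (1 - t i) * B by ring.
apply: lerD; apply: ler_wpM2l; rewrite ?subr_ge0//; apply: IH => // P.
- have := H (fun j => if j \in s then P j else true).
  rewrite big_cons (negbTE is_) big_seq_cond (eq_bigl (fun j => (j \in s) && P j)); last first.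
    by move=> j; case: (j \in s).
  by rewrite -big_seq_cond addrA.
- have := H (fun j => if j \in s then P j else false).
  rewrite big_cons (negbTE is_) big_seq_cond (eq_bigl (fun j => (j \in s) && P j)); last first.
    by move=> j; case: (j \in s).
  by rewrite -big_seq_cond.
Qed.

Lemma real_multiplier (V : normedModType K) (I : eqType) (s : seq I) (y : I -> V) (t : I -> R) B :
  (forall i, `|t i| <= 1) -> uniq s ->
  (forall P : pred I, rn (\sum_(i <- s | P i) y i) <= B) ->
  rn (\sum_(i <- s) ofreal (t i) *: y i) <= 2 * B.
Proof.
move=> t1 us H.
rewrite (_ : \sum_(i <- s) _ = \sum_(i <- s) ofreal (Num.max (t i) 0) *: y i -
    \sum_(i <- s) ofreal (Num.max (- t i) 0) *: y i); last first.
  rewrite -sumrB; apply: eq_bigr => i _; rewrite -scalerBl -ofrealB; congr (ofreal _ *: _).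
  by case: (ltrP (t i) 0) => h; case: (ltrP (- t i) 0) => h'; lra.
apply: (le_trans (rnD _ _)); rewrite rnN mulr2n mulrDl mul1r.
by apply: lerD; apply: convex_multiplier => // i; have := t1 i; rewrite ler_norml => /andP[];
  [case: (ltrP (t i) 0) => h|case: (ltrP (- t i) 0) => h]; lra.
Qed.

(** Splitting into real and imaginary parts and then into positive and negative parts costs a factor
    2 each time. *)
Lemma scalar_multiplier (V : normedModType K) (I : eqType) (s : seq I) (y : I -> V) (t : I -> K) B :
  (forall i, absv (t i) <= 1) -> uniq s ->
  (forall P : pred I, rn (\sum_(i <- s | P i) y i) <= B) ->
  rn (\sum_(i <- s) t i *: y i) <= 4 * B.
Proof.
move=> t1 us H.
rewrite (_ : \sum_(i <- s) _ = \sum_(i <- s) ofreal (rpart (t i)) *: y i +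
    iunit R k *: \sum_(i <- s) ofreal (ipart (t i)) *: y i); last first.
  rewrite scaler_sumr -big_split /=; apply: eq_bigr => i _.
  by rewrite scalerA -scalerDl -scalarE.
have B2 : rn (\sum_(i <- s) ofreal (ipart (t i)) *: y i) <= 2 * B.
  by apply: real_multiplier => // i; exact: le_trans (ipart_le _) (t1 i).
have B1 : rn (\sum_(i <- s) ofreal (rpart (t i)) *: y i) <= 2 * B.
  by apply: real_multiplier => // i; exact: le_trans (rpart_le _) (t1 i).
apply: (le_trans (rnD _ _)); rewrite rnZ.
have -> : 4 * B = 2 * B + 2 * B by ring.
apply: lerD => //; apply: le_trans B2; rewrite ler_piMl ?rn_ge0//; exact: absv_iunit.
Qed.

Section Complemented.
Variables (V : completeNormedModType K) (Y : set V).
Hypothesis Yc : complemented Y.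

Lemma complemented_bound : exists2 P : {linear V -> V},
  (forall v, P (P v) = P v) /\ range P = Y &
  exists2 C : R, 0 < C & forall v, rn (P v) <= C * rn v.
Proof.
have [P [cP PP rP]] := Yc; exists P => //.
have [||||C C0 CP] := @linear_within_bound _ _ V V setT P.
- by [].
- by [].
- by move=> c u v _ _; rewrite linearP.
- exact: continuous_subspaceT.
exists (C + 1) => [|v]; first by rewrite ltr_wpDl.
by apply: le_trans (CP v Logic.I) _; rewrite ler_wpM2r ?rn_ge0// lerDl.
Qed.

End Complemented.

End UnconditionalConstant.

(** * An unconditionality constant, by the method of the open mapping theorem *)

Section BasisConstant.
Variables (R : realType) (k : scalar_kind).
Local Notation K := (scalars R k).
Local Notation absv := (@absv R k).
Local Notation ofreal := (@ofreal R k).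

(** A zero vector could be given any coefficient in the expansion of 0. *)
Lemma unique_expansion_nonzero (V : normedModType K) (x : nat -> V) :
  (exists! a : nat -> K, expands x a 0) -> forall i, x i != 0.
Proof.
move=> [a0 [a0P a0U]] i; apply/eqP => xi0.
have h : expands x (fun j => a0 j + @dlt R k nat i j) 0.
  apply: (rlim_eq _ a0P) => n.
  rewrite !vsum_trunc; apply: eq_bigr => j _; rewrite scalerDl /dlt.
  by case: eqP => [->|_]; rewrite ?xi0 ?scaler0 ?scale0r addr0.
have /(congr1 (fun f => f i)) := a0U _ h; rewrite /dlt eqxx => /eqP.
by rewrite -subr_eq0 opprD addNKr oppr_eq0 oner_eq0.
Qed.

Section OpenMapping.
Variables (V : completeNormedModType K) (x : nat -> V) (P : {linear V -> V}) (C : R).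
Hypotheses (C0 : 0 < C) (PC : forall v, rn (P v) <= C * rn v).
Hypothesis basis : forall v, exists! a : nat -> K, expands x a (P v).
Hypothesis bounded : forall a v, expands x a (P v) ->
  exists B, forall s, uniq s -> rn (\sum_(i <- s) a i *: x i) <= B.

Let coef_ex v : exists a : nat -> K, expands x a (P v) /\ forall b, expands x b (P v) -> a = b.
Proof. by have [a [av au]] := basis v; exists a. Qed.

Let co (v : V) : nat -> K := projT1 (cid (coef_ex v)).
Let coP v : expands x (co v) (P v). Proof. exact: (projT2 (cid (coef_ex v))).1. Qed.
Let coU v b : expands x b (P v) -> co v = b. Proof. exact: (projT2 (cid (coef_ex v))).2. Qed.

Let coD u v : co (u + v) = fun i => co u i + co v i.
Proof. by apply: coU; rewrite linearD; apply: expandsD; exact: coP. Qed.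

Let coZ c v : co (c *: v) = fun i => c * co v i.
Proof. by apply: coU; rewrite linearZ /=; apply: expandsZ; exact: coP. Qed.

Let cosum (s : seq nat) v : V := \sum_(i <- s) co v i *: x i.

Let cosumD s u v : cosum s (u + v) = cosum s u + cosum s v.
Proof. by rewrite /cosum -big_split /= coD; apply: eq_bigr => i _; rewrite scalerDl. Qed.

Let cosumZ s c v : cosum s (c *: v) = c *: cosum s v.
Proof. by rewrite /cosum scaler_sumr coZ; apply: eq_bigr => i _; rewrite scalerA. Qed.

Let cosumB s u v : cosum s (u - v) = cosum s u - cosum s v.
Proof. by rewrite cosumD -[- v]scaleN1r cosumZ scaleN1r. Qed.

(** By Baire's theorem the vectors with all subset sums bounded by some [m] are dense in a ball;
    differences and scaling carry this to every vector. Continuity of the coefficients is not yet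
    known, so a bound is obtained near [v], not at [v]. Expanding [P v] rather than vectors of the
    subspace lets the argument run in the complete space [V]. *)
Let approximation : exists2 M : R, 0 < M & forall (v : V) (e : R), 0 < e ->
  exists w, (forall s, uniq s -> rn (cosum s w) <= M * rn v) /\ rn (v - w) < e.
Proof.
pose F m := [set v | forall s, uniq s -> rn (cosum s v) <= m%:R].
have [v|m [v0 [d d0 H]]] := @baire R k V F.
  have [B BP] := bounded (coP v); exists (Num.truncn B).+1 => s us.
  by rewrite (le_trans (BP s us))// ltW// truncnS_gt.
(* A difference of two vectors with bound [m] has bound 2 m, and it is rescaled by 2 / d times the
   norm of [v]. *)
exists (4 * m.+1%:R / d) => [|v e e0]; first by rewrite divr_gt0// mulr_gt0.
have [->|vn0] := eqVneq v 0.
  exists 0; rewrite subrr rn0; split => // s us; rewrite mulr0.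
  by rewrite -(scale0r (0 : V)) cosumZ scale0r rn0.
have vn := rn_gt0 vn0; pose c := d / 2 / rn v; have c0 : 0 < c by rewrite !divr_gt0.
have ec0 : 0 < e * c / 2 by rewrite divr_gt0// mulr_gt0.
have [|w1 F1 w1v] := H (v0 + ofreal c *: v) _ _ ec0.
  rewrite addrC addKr rnZ absv_ofreal gtr0_norm// /c divfK ?gt_eqF//.
  by rewrite ltr_pdivrMr// ltr_pMr// ltr1n.
have [|w2 F2 w2v] := H v0 _ _ ec0; first by rewrite subrr rn0.
exists (ofreal c^-1 *: (w1 - w2)); split => [s us|].
  rewrite cosumZ rnZ absv_ofreal gtr0_norm ?invr_gt0// cosumB.
  rewrite (_ : 4 * m.+1%:R / d * rn v = c^-1 * (2 * m.+1%:R)); last first.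
    by rewrite /c !invfM !invrK; field; rewrite gt_eqF.
  rewrite ler_wpM2l ?invr_ge0 ?(ltW c0)// (le_trans (rnD _ _))// rnN.
  have mS : m%:R <= m.+1%:R :> R by rewrite ler_nat.
  by have := F1 s us; have := F2 s us; lra.
rewrite (_ : v - _ = ofreal c^-1 *: ((v0 + ofreal c *: v - w1) - (v0 - w2))); last first.
  set a := ofreal c *: v.
  have {1}-> : v = ofreal c^-1 *: a.
    by rewrite /a scalerA -ofrealM mulVf ?gt_eqF// ofreal1 scale1r.
  rewrite -scalerBr; congr (_ *: _).
  by rewrite !opprB -[v0 + a - w1]addrA addrAC [v0 + _]addrC subrK addrCA.
rewrite rnZ absv_ofreal gtr0_norm ?invr_gt0// mulrC ltr_pdivrMr//.
rewrite (le_lt_trans (rnD _ _))// rnN (splitr (e * c)) ltrD//.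
Qed.

(** Successive approximation, as in the open mapping theorem: [v] is written as a series of vectors
    whose subset sums decrease geometrically, and uniqueness of expansions identifies the sum of
    their coefficients with the coefficients of [v]. *)
Lemma basis_multiplier_bound :
  exists2 B : R, 0 < B & forall a v, expands x a (P v) ->
    forall s, uniq s -> rn (\sum_(i <- s) a i *: x i) <= B * rn v.
Proof.
have [M M0 MP] := approximation.
have /choice[g gP] : forall ve : V * R, exists w, 0 < ve.2 ->
    (forall s, uniq s -> rn (cosum s w) <= M * rn ve.1) /\ rn (ve.1 - w) < ve.2.
  move=> [v e] /=; have [e0|_] := ltP 0 e; last by exists 0.
  by have [w wP] := MP v e e0; exists w.
exists (2 * M) => [|a v av s us]; first by rewrite mulr_gt0.
have [v0|vn0] := eqVneq v 0.
  have E : co 0 = fun=> 0.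
    rewrite -(scale0r (0 : V)) coZ; apply/funext => i; exact: mul0r.
  rewrite -(coU av) v0 E rn0 mulr0 big1 ?rn0// => i _; exact: scale0r.
have r0 := rn_gt0 vn0; set r := rn v in r0 *.
(* [u j] is the remainder after [j] approximations, of norm at most r / 2^j; [w j] is the next
   approximant and [t j] the sum of the first [j] ones. *)
pose u := fix u j := if j is j'.+1 then u j' - g (u j', r * 2^-1 ^+ j) else v.
pose w j := g (u j, r * 2^-1 ^+ j.+1).
have h0 j : 0 < r * 2^-1 ^+ j :> R by rewrite mulr_gt0// exprn_gt0.
have uS j : u j.+1 = u j - w j by [].
have un j : rn (u j) <= r * 2^-1 ^+ j.
  case: j => [|j]; first by rewrite expr0 mulr1.
  by rewrite uS ltW//; have [] := gP (u j, _) (h0 j.+1).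
have wn j s' : uniq s' -> rn (cosum s' (w j)) <= M * r * 2^-1 ^+ j.
  move=> us'; have [/(_ _ us') /= h _] := gP (u j, _) (h0 j.+1).
  by rewrite (le_trans h)// -mulrA ler_wpM2l ?(ltW M0).
pose t j := v - u j.
have tS j : t j.+1 = t j + w j by rewrite /t uS opprB addrCA [RHS]addrC.
have tdiff s' j d : uniq s' -> rn (cosum s' (t (j + d)%N) - cosum s' (t j)) <=
    2 * M * r * 2^-1 ^+ j * (1 - 2^-1 ^+ d).
  move=> us'; elim: d => [|d IH]; first by rewrite addn0 subrr rn0 subrr mulr0.
  rewrite addnS tS cosumD addrAC (le_trans (rnD _ _))//.
  apply: (le_trans (lerD IH (wn _ _ us'))).
  rewrite exprS exprD; set z := 2^-1 ^+ d; set y := 2^-1 ^+ j.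
  by rewrite le_eqVlt; apply/orP; left; apply/eqP; field.
have tdiff' s' i j : uniq s' -> (i <= j)%N ->
    rn (cosum s' (t j) - cosum s' (t i)) <= 2 * M * r * 2^-1 ^+ i.
  move=> us' ij; have := tdiff s' i (j - i)%N us'; rewrite subnKC// => /le_trans; apply.
  have p0 : 0 <= 2 * M * r * 2^-1 ^+ i :> R.
    by rewrite !mulr_ge0 ?(ltW M0) ?(ltW r0) ?exprn_ge0.
  by rewrite ler_piMr// lerBlDr lerDl exprn_ge0.
have small e : 0 < e -> exists N, forall n, (N <= n)%N -> 2^-1 ^+ n < e :> R.
  move=> e0; have h1 : `|2^-1 : R| < 1 by rewrite ger0_norm ?invf_lt1 ?ltr1n.
  have /cvgrPdist_lt/(_ _ e0)[N _ NP] := cvg_expr h1; exists N => n /NP /=.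
  by rewrite sub0r normrN ger0_norm// exprn_ge0.
have x0 : forall i, x i != 0.
  by apply: unique_expansion_nonzero; have := basis 0; rewrite linear0.
have /choice[b bP] (i : nat) : exists l, forall e : R, 0 < e ->
    exists N, forall n, (N <= n)%N -> absv (co (t n) i - l) < e.
  apply: scalar_complete => e e0.
  have [|N NP] := small (e * rn (x i) / (2 * M * r)).
    by rewrite divr_gt0 ?mulr_gt0 ?rn_gt0.
  have main n m : (N <= n)%N -> (n <= m)%N -> absv (co (t m) i - co (t n) i) < e.
    move=> Nn nm; rewrite -(ltr_pM2r (rn_gt0 (x0 i))) -rnZ scalerBl.
    have := tdiff' [:: i] n m isT nm; rewrite /cosum !big_seq1 => h.
    apply: (le_lt_trans h); rewrite mulrC -ltr_pdivlMr ?NP// !mulr_gt0//.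
  exists N => m n Nm Nn; have [mn|/ltnW nm] := leqP m n; last exact: main.
  by rewrite absvB main.
have blim s' : rlim (fun n => cosum s' (t n)) (\sum_(i <- s') b i *: x i).
  by apply: rlim_sum => i; exact: rlim_scalar (bP i).
have bdiff s' n : uniq s' ->
    rn (\sum_(i <- s') b i *: x i - cosum s' (t n)) <= 2 * M * r * 2^-1 ^+ n.
  move=> us'; apply: (@rlim_le _ _ _ (fun m => cosum s' (t m) - cosum s' (t n)) _ _ n).
    by apply: rlimD => //; exact: rlim_cst.
  by move=> m nm; exact: tdiff'.
(* The subset sums of [t n] converge uniformly over all finite subsets, and [t n] tends to [v], so
   the limits can be interchanged. *)
have bv : expands x b (P v).
  move=> e e0; have e30 : 0 < e / 3 by rewrite divr_gt0.
  have p0 : 0 < 2 * M * r by rewrite !mulr_gt0.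
  have [N1 N1P] := small _ (divr_gt0 e30 p0).
  have [N2 N2P] := small _ (divr_gt0 e30 (mulr_gt0 C0 r0)).
  set m := maxn N1 N2; have [N NP] := coP (t m) e30.
  have fin : rn (P (t m) - P v) < e / 3.
    rewrite -linearB /t addrAC subrr add0r linearN rnN (le_lt_trans (PC _))//.
    rewrite (@le_lt_trans _ _ (C * (r * 2^-1 ^+ m)))// ?ler_wpM2l ?(ltW C0)//.
    by rewrite mulrA mulrC -ltr_pdivlMr ?mulr_gt0// N2P// leq_maxr.
  exists N => n /NP nP; rewrite vsum_trunc -(big_mkord xpredT (fun i => b i *: x i)).
  rewrite vsum_trunc -(big_mkord xpredT (fun i => co (t m) i *: x i)) in nP.
  rewrite (le_lt_trans (rn_tri _ (cosum (index_iota 0 n) (t m)) _))//.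
  have -> : e = e / 3 + (e / 3 + e / 3) by field.
  apply: ltrD.
    rewrite (le_lt_trans (bdiff _ m _)) ?iota_uniq//.
    by rewrite mulrC -ltr_pdivlMr// N1P// leq_maxl.
  by rewrite (le_lt_trans (rn_tri _ (P (t m)) _))// ltrD.
rewrite -(coU av) (coU bv).
have := bdiff s 0%N us; rewrite expr0 mulr1 /t /= subrr.
have -> : cosum s 0 = 0 by have := cosumZ s 0 0; rewrite !scale0r.
by rewrite subr0.
Qed.

End OpenMapping.

Section ComplementedBasis.
Variables (V : completeNormedModType K) (Y : set V) (x : nat -> V).
Hypotheses (Yc : complemented Y) (bx : unconditional_basis Y x).

Let Y_expands y : Y y -> exists! a : nat -> K, expands x a y.
Proof.
have [[_ sb] _] := bx; move=> /sb[a [aP aU]]; exists a; split; first exact/expandsP.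
by move=> b /expandsP; exact: aU.
Qed.

Lemma unconditional_basis_nonzero i : x i != 0.
Proof.
apply: unique_expansion_nonzero; apply: Y_expands.
by have [P [_ _ <-]] := Yc; exists 0 => //; rewrite linear0.
Qed.

Lemma closed_span_basis : closed_span x = Y.
Proof.
have [P [PP PY] [C C0 PC]] := complemented_bound Yc.
have xY i : Y (x i) by have [[xY _] _] := bx; exact: xY.
have PYE v : Y v <-> P v = v.
  by rewrite -PY; split=> [[w _ <-]|Pv]; [exact: PP|exists v].
apply/seteqP; split => v.
  move=> /closed_spanP[A fA Av]; apply/PYE; apply: (rlim_uniq _ Av) => e e0.
  have C1 : 0 < C + 1 by rewrite ltr_wpDl// ltW.
  have [N AN] := Av _ (divr_gt0 e0 C1); exists N => n /AN An.
  have -> : vsum x (A n) = P (vsum x (A n)).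
    have [s sA] := fA n; rewrite (vsumE _ sA) linear_sum; apply: eq_bigr => i _.
    by rewrite linearZ /=; congr (_ *: _); apply/esym/PYE.
  rewrite -linearB (le_lt_trans (PC _))//.
  move: An; rewrite ltr_pdivlMr// mulrC; apply: le_lt_trans.
  by rewrite ler_wpM2r ?rn_ge0// lerDl.
by move=> /Y_expands[a [/expands_closed_span]].
Qed.

(** Convergence of all rearrangements bounds the subset sums of each expansion, the category
    argument makes the bound uniform, and multipliers cost a further factor 4. *)
Lemma unconditional_constant : exists D, uncond D x.
Proof.
have [P [PP PY] [C C0 PC]] := complemented_bound Yc.
have YP v : Y (P v) by rewrite -PY; exists v.
have PYE v : Y v -> P v = v by rewrite -PY => -[w _ <-]; exact: PP.
have [||B B0 BP] := @basis_multiplier_bound V x P C C0 PC.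
- by move=> v; exact: Y_expands.
- move=> a v av; apply: unordered_bounded => p pb.
  have [_ ub] := bx; exists (P v).
  have /expandsP/ub/(_ p pb)/rlimP := av; apply: rlim_eq => n.
  by rewrite /series /= big_mkord.
exists (4 * B) => a b fa ba.
have [s sa] := fa; have [us sa0] := sa.
rewrite (vsumE _ (supp_in_le sa ba)).
pose t i := if a i == 0 then 0 else b i / a i.
rewrite (eq_bigr (fun i => t i *: (a i *: x i))); last first.
  move=> i _; rewrite scalerA /t; case: eqP => [ai|/eqP ai]; last by rewrite divfK.
  have := ba i; rewrite ai absv0 mulr0 => bi.
  suff -> : b i = 0 by []; apply: absv0_eq0; apply/eqP.
  by rewrite eq_le bi absv_ge0.
rewrite -mulrA; apply: scalar_multiplier => // [i|Q].
  rewrite /t; case: eqP => [_|/eqP ai]; first by rewrite absv0.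
  by rewrite absvM absvV ler_pdivrMr ?absv_gt0// mul1r.
rewrite -big_filter; apply: BP; last exact: filter_uniq.
rewrite PYE; first exact: expands_fsupp.
by rewrite -closed_span_basis; exact: closed_span_vsum.
Qed.

End ComplementedBasis.

End BasisConstant.

(** * Permutative equivalence and finite genus *)

Section GenusInterface.
Variables (R : realType) (k : scalar_kind).
Local Notation K := (scalars R k).
Local Notation absv := (@absv R k).
Local Notation ofreal := (@ofreal R k).

Lemma complementedI (V : normedModType K) (Y : set V) (Q : V -> V) (C : R) :
  (forall c u v, Q (c *: u + v) = c *: Q u + Q v) ->
  (forall v, rn (Q v) <= C * rn v) ->
  (forall v, Y (Q v)) -> (forall v, Y v -> Q v = v) -> complemented Y.
Proof.
move=> Ql QC YQ QY.
pose Q' : {linear V -> V} := HB.pack Q (GRing.isLinear.Build _ _ _ _ _ Ql).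
exists Q'; split.
- have lip u v : rn (Q u - Q v) <= C * rn (u - v).
    have -> : Q u - Q v = Q (u - v).
      by rewrite addrC -scaleN1r -Ql scaleN1r addrC.
    exact: QC.
  apply/continuous_subspace_setT; apply: (@lip_within _ _ _ _ _ _ C) => u v _ _.
  exact: lip.
- by move=> v; exact: QY.
- by apply/seteqP; split => v => [[w _ <-]|Yv]; [exact: YQ|exists v => //; exact: QY].
Qed.

Lemma closed_span_sub (V : normedModType K) (Y : set V) (w : nat -> V) :
  complemented Y -> (forall i, Y (w i)) -> closed_span w `<=` Y.
Proof.
move=> [P [cP PP PY]] Yw v /closed_spanP[A fA Av].
have PYE u : Y u <-> P u = u.
  by rewrite -PY; split=> [[u' _ <-]|Pu]; [exact: PP|exists u].
apply/PYE; apply: (rlim_uniq _ Av).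
apply/rlimP; have /rlimP Av' := Av.
rewrite (_ : (fun m => vsum w (A m)) = P \o (fun m => vsum w (A m))).
  exact: cvg_comp Av' (cP v).
apply/funext => m /=; have [s sA] := fA m; rewrite (vsumE _ sA) linear_sum; apply: eq_bigr => i _.
by rewrite linearZ /=; congr (_ *: _); apply/esym/PYE.
Qed.

Section Subsequence.
Variables (V : completeNormedModType K) (Y : set V) (x : nat -> V) (phi : nat -> nat).
Hypotheses (Yc : complemented Y) (bx : unconditional_basis Y x) (phi_inj : injective phi).

(** The projection is [P] followed by deletion of the coordinates outside the range of [phi]. The
    deletion is the extension of the map sending [x i] to [w i], which is either [x i] or 0. *)
Lemma complemented_subsequence : complemented (closed_span (x \o phi)).
Proof.
have x0 := unconditional_basis_nonzero Yc bx.
have [D ux] := unconditional_constant Yc bx.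
have D0 : 0 <= D by apply: le_trans (uncond_ge1 (x0 0%N) ux).
have [P [PP PY] [C C0 PC]] := complemented_bound Yc.
have xY := closed_span_basis Yc bx.
pose inr i := `[< exists j, phi j = i >].
pose w i := if inr i then x i else 0.
have wE a : fsupp a -> vsum w a = vsum x (fun i => if inr i then a i else 0).
  move=> [s sa]; rewrite (vsumE _ sa) (@vsumE _ _ _ _ _ _ s).
    by apply: eq_bigr => i _; rewrite /w; case: ifP; rewrite ?scaler0 ?scale0r.
  by apply: supp_in_le sa _ => i; case: ifP; rewrite ?absv0 ?absv_ge0.
have wx : dom D w x.
  by move=> a fa; rewrite wE//; exact: uncond_restr.
have ye := complete_expands D0 wx.
have xP v : closed_span x (P v) by rewrite xY -PY; exists v.
have wpush a : fsupp a -> vsum w (push phi a) = vsum (x \o phi) a.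
  move=> fa; rewrite wE ?vsum_push//; last exact: push_fsupp.
  rewrite -(vsum_push phi_inj x fa); apply: vsum_ext => i; case: ifPn => // /asboolPn h.
  by rewrite push_out.
apply: (@complementedI _ _ (fun v => extend x w (P v)) (D * C)).
- by move=> c u v; rewrite linearP (extend_linear ux x0 ye).
- move=> v; rewrite (le_trans (extend_bound D0 wx ux x0 ye (xP v)))//.
  by rewrite -mulrA ler_wpM2l.
- move=> v; have [a av] := closed_span_expands ux x0 (xP v).
  have /expands_closed_span/closed_spanP[A fA Aw] := extend_expands ux x0 ye av.
  apply: (closed_span_closed _ Aw) => n; rewrite wE//.
  set b := fun i => _; have fb : fsupp b.
    by apply: fsupp_le (fA n) _ => i; rewrite /b; case: ifP; rewrite ?absv0 ?absv_ge0.
  have -> : b = push phi (b \o phi).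
    apply/funext => i; rewrite /b; case: ifPn => [/asboolP[j <-]|/asboolPn h].
      by rewrite push_in//= ifT//; apply/asboolP; exists j.
    by rewrite push_out.
  rewrite vsum_push//; first by apply: closed_span_vsum; exact: comp_fsupp.
  exact: comp_fsupp.
- move=> v /closed_spanP[A fA Av].
  have xv : closed_span x v.
    apply/closed_spanP; exists (fun n => push phi (A n)) => [n|].
      exact: push_fsupp.
    by apply: rlim_eq Av => n; rewrite vsum_push.
  have -> : P v = v by move: xv; rewrite xY -PY => -[u _ <-]; exact: PP.
  apply: (rlim_uniq _ Av) => e e0; have D1 : 0 < D + 1 by rewrite ltr_wpDl.
  have [N AN] := Av _ (divr_gt0 e0 D1); exists N => n /AN An.
  rewrite -wpush// -(extend_vsum ux x0 ye); last exact: push_fsupp.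
  have xA : closed_span x (vsum x (push phi (A n))).
    by apply: closed_span_vsum; exact: push_fsupp.
  rewrite (le_lt_trans (extend_lip D0 wx ux x0 ye xA xv))//.
  rewrite vsum_push//; move: An; rewrite ltr_pdivlMr// mulrC; apply: le_lt_trans.
  by rewrite ler_wpM2r ?rn_ge0// lerDl.
Qed.

End Subsequence.

Lemma isomorphism_vsum (V W : normedModType K) (x : nat -> V) (A : set V) (B : set W) (T : V -> W) a :
  (forall (c : K) u v, A u -> A v -> A (c *: u + v)) -> A 0 ->
  isomorphism A B T -> (forall i, A (x i)) -> fsupp a ->
  A (vsum x a) /\ T (vsum x a) = vsum (T \o x) a.
Proof.
move=> Al A0 [Tl _ _ _] Ax [s sa]; rewrite !(vsumE _ sa) {sa}.
have T0 : T 0 = 0.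
  have := Tl 1 0 0 A0 A0; rewrite !scale1r addr0 => /eqP.
  by rewrite -subr_eq0 opprD addNKr oppr_eq0 => /eqP.
elim: s => [|i s [As Ts]]; first by rewrite !big_nil.
by rewrite !big_cons /= -Ts -Tl//; split => //; exact: Al.
Qed.

Lemma closed_span0 (V : normedModType K) (x : nat -> V) : closed_span x 0.
Proof. by rewrite -(vsum0 x); apply: closed_span_vsum; exact: fsupp0. Qed.

Lemma closed_span_basis_in (V : normedModType K) (x : nat -> V) i : closed_span x (x i).
Proof. by rewrite -(vsum_dlt x); apply: closed_span_vsum; exact: fsupp_dlt. Qed.

Lemma isomorphism_eqv (V W : normedModType K) (x : nat -> V) (A : set V) (B : set W) (T : V -> W) :
  (forall (c : K) u v, A u -> A v -> A (c *: u + v)) -> A 0 ->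
  (forall (c : K) u v, B u -> B v -> B (c *: u + v)) ->
  isomorphism A B T -> (forall i, A (x i)) -> exists2 C : R, 0 <= C & eqv C x (T \o x).
Proof.
move=> Al A0 Bl iT Ax; have [C C0 TC] := isomorphism_bounds Al A0 Bl iT.
exists C => //; split => a fa; have [As <-] := isomorphism_vsum Al A0 iT Ax fa;
  by have [] := TC _ As.
Qed.

Lemma equivalent_eqv (V W : normedModType K) (x : nat -> V) (y : nat -> W) :
  equivalent x y -> exists2 C : R, 0 <= C & eqv C x y.
Proof.
move=> [T [iT Txy]]; have -> : y = T \o x by apply/funext => n; rewrite /= Txy.
apply: isomorphism_eqv iT _.
- exact: closed_spanZD.
- exact: closed_span0.
- exact: closed_spanZD.
- exact: closed_span_basis_in.
Qed.

Lemma perm_equivalent_eqv (V W : normedModType K) (x : nat -> V) (y : nat -> W) :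
  perm_equivalent x y -> exists2 p : nat -> nat, bijective p & exists2 C : R, 0 <= C & eqv C x (y \o p).
Proof. by move=> [p pb /equivalent_eqv[C C0 xy]]; exists p => //; exists C. Qed.

Definition unitize (I : Type) (V : normedModType K) (w : I -> V) : I -> V :=
  fun i => ofreal (rn (w i))^-1 *: w i.

Lemma unitize_normalized (V : normedModType K) (w : nat -> V) :
  (forall i, w i != 0) -> normalized (unitize w).
Proof.
move=> w0 i; rewrite -ofreal_rn rnZ absv_ofreal.
by rewrite ger0_norm ?invr_ge0 ?rn_ge0// mulVf ?ofreal1// gt_eqF// rn_gt0.
Qed.

Lemma uncond_scale (I : choiceType) (V : normedModType K) D (x : I -> V) (c : I -> K) :
  uncond D x -> uncond D (fun i => c i *: x i).
Proof.
move=> ux a b fa ba; rewrite !vsum_cst_scale//; last exact: fsupp_le ba.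
apply: ux => [|i]; last by rewrite !absvM ler_wpM2r ?absv_ge0.
by have [s [us sa]] := fa; exists s; split => // i /sa ->; rewrite mul0r.
Qed.

Lemma closed_span_scale (V : normedModType K) (x : nat -> V) (c : nat -> K) :
  (forall i, c i != 0) -> closed_span (fun i => c i *: x i) = closed_span x.
Proof.
move=> c0; apply/seteqP; split => v /closed_spanP[A fA Av]; apply/closed_spanP.
  exists (fun n i => A n i * c i) => [n|].
    by have [s [us sa]] := fA n; exists s; split => // i /sa ->; rewrite mul0r.
  by apply: rlim_eq Av => n; rewrite vsum_cst_scale.
have fA' n : fsupp (fun i => A n i / c i).
  by have [s [us sa]] := fA n; exists s; split => // i /sa ->; rewrite mul0r.
exists (fun n i => A n i / c i) => //.
apply: rlim_eq Av => n; rewrite vsum_cst_scale//; apply: vsum_ext => i.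
by rewrite divfK.
Qed.

Lemma ofreal_neq0 (r : R) : r != 0 -> ofreal r != 0.
Proof. by apply: contra => /eqP; rewrite -(ofreal0 R k) => /ofreal_inj ->. Qed.

Lemma unitize_basis (V : completeNormedModType K) (w : nat -> V) D :
  uncond D w -> (forall i, w i != 0) ->
  normalized_unconditional_basis (closed_span w) (unitize w).
Proof.
move=> uw w0; split; first exact: unitize_normalized.
have c0 i : ofreal (rn (w i))^-1 != 0.
  by rewrite ofreal_neq0// invr_neq0// gt_eqF// rn_gt0.
rewrite -(closed_span_scale w c0); apply: (@uncond_basis _ _ _ _ D).
  exact: uncond_scale.
by move=> i; rewrite scaler_eq0 negb_or c0 w0.
Qed.

Lemma normalized_rn (V : normedModType K) (x : nat -> V) : normalized x -> forall i, rn (x i) = 1.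
Proof. by move=> nx i; rewrite /rn nx absv1. Qed.

Section Unique.
Variables (V : completeNormedModType K) (Y : set V).
Hypotheses (Yu : unique_normalized_unconditional_basis Y).

Lemma span_basis_eqv (z w : nat -> V) D : normalized_unconditional_basis Y z ->
  uncond D w -> (forall i, w i != 0) -> closed_span w = Y ->
  exists2 p : nat -> nat, bijective p & exists2 C : R, 0 <= C & eqv C z (unitize w \o p).
Proof.
move=> bz uw w0 wY; apply: perm_equivalent_eqv; apply: (proj2 Yu) => //.
by rewrite -wY; exact: (unitize_basis uw w0).
Qed.

End Unique.

Lemma eqv_sym (I : choiceType) (V W : normedModType K) (C : R) (x : I -> V) (y : I -> W) :
  eqv C x y -> eqv C y x.
Proof. by move=> [? ?]; split. Qed.

Lemma eqv_trans (I : choiceType) (U V W : normedModType K) (C C' : R) (x : I -> U) (y : I -> V) (z : I -> W) :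
  0 <= C -> 0 <= C' -> eqv C x y -> eqv C' y z -> eqv (C * C') x z.
Proof.
move=> C0 C'0 [xy yx] [yz zy]; split; first exact: (dom_trans C0 xy yz).
by rewrite (mulrC C); exact: (dom_trans C'0 zy yx).
Qed.

Lemma eqv_uncond (I : choiceType) (V W : normedModType K) (C D : R) (x : I -> V) (y : I -> W) :
  0 <= C -> 0 <= D -> eqv C x y -> uncond D x -> uncond (C * D * C) y.
Proof.
move=> C0 D0 [xy yx] ux a b fa ba.
rewrite (le_trans (yx _ (fsupp_le fa ba)))// -!mulrA ler_wpM2l//.
rewrite (le_trans (ux _ _ fa ba))// ler_wpM2l//; exact: xy.
Qed.

Lemma eqv_coord (I : choiceType) (V W : normedModType K) (C : R) (x : I -> V) (y : I -> W) i :
  eqv C x y -> rn (x i) <= C * rn (y i) /\ rn (y i) <= C * rn (x i).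
Proof.
move=> [xy yx]; rewrite -(vsum_dlt x) -(vsum_dlt y).
by split; [apply: xy|apply: yx]; exact: fsupp_dlt.
Qed.

Lemma eqv_nonzero (I : choiceType) (V W : normedModType K) (C : R) (x : I -> V) (y : I -> W) :
  eqv C x y -> (forall i, x i != 0) -> forall i, y i != 0.
Proof.
move=> xy x0 i; apply/eqP => yi; have [] := eqv_coord i xy.
by rewrite yi rn0 mulr0 leNgt rn_gt0.
Qed.

Lemma eqv_unitize (I : choiceType) (V : normedModType K) (B D : R) (x : I -> V) :
  uncond D x -> (forall i, x i != 0) -> 0 <= D -> 0 <= B ->
  (forall i, rn (x i) <= B /\ B^-1 <= rn (x i)) -> eqv (D * B) x (unitize x).
Proof.
move=> ux x0 D0 B0 xB; split.
  have -> : dom (D * B) x (unitize x) = dom (D * B) (fun i => ofreal (rn (x i)) *: unitize x i) (unitize x).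
    congr dom; apply/funext => i; rewrite /unitize scalerA -ofrealM mulfV ?ofreal1 ?scale1r//.
    by rewrite gt_eqF// rn_gt0.
  apply: dom_scale => //; [exact: mulr_ge0|exact: uncond_scale|move=> i].
  by rewrite absv_ofreal ger0_norm ?rn_ge0//; have [] := xB i.
apply: dom_scale => //; [exact: mulr_ge0|move=> i].
rewrite absv_ofreal ger0_norm ?invr_ge0 ?rn_ge0//; have [h1 h2] := xB i.
have B1 : 0 < B by apply: lt_le_trans h1; exact: rn_gt0.
by rewrite -[B]invrK lef_pV2 ?posrE ?invr_gt0// rn_gt0.
Qed.

(** Uniqueness compares bases of one subspace only. Bases of isomorphic subspaces are first moved to
    a common one, where the images have to be normalized again. *)
Lemma transport_basis (V : completeNormedModType K) (Y Z : set V) (y : nat -> V) :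
  complemented Y -> complemented Z -> isomorphic Y Z -> normalized_unconditional_basis Y y ->
  exists z, normalized_unconditional_basis Z z /\ exists2 C : R, 0 <= C & eqv C y z.
Proof.
move=> Yc Zc [T iT] [ny by_].
have yY := closed_span_basis Yc by_.
have [D uy] := unconditional_constant Yc by_.
have y0 := unconditional_basis_nonzero Yc by_.
have D0 : 0 <= D by apply: le_trans (uncond_ge1 (y0 0%N) uy).
have lin (W : set V) : complemented W -> (forall (c : K) u v, W u -> W v -> W (c *: u + v)) /\ W 0.
  move=> [P [_ PP <-]]; split => [c _ _ [u _ <-] [v _ <-]|].
    by exists (c *: u + v) => //; rewrite linearP.
  by exists 0 => //; rewrite linear0.
have [Yl Y0] := lin _ Yc; have [Zl Z0] := lin _ Zc.
have Yy i : Y (y i) by have [[+ _] _] := by_; apply.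
have [C C0 yTy] := isomorphism_eqv Yl Y0 Zl iT Yy.
have uT := eqv_uncond C0 D0 yTy uy.
have T0 := eqv_nonzero yTy y0.
have TZ : closed_span (T \o y) = Z.
  apply/seteqP; split.
    by apply: closed_span_sub => // i; have [_ _ + _] := iT; apply.
  move=> v Zv; have [_ _ _ [S [_ SY _ TS]]] := iT.
  have Yu := SY _ Zv; rewrite -(TS _ Zv).
  have [C' C'0 TC] := isomorphism_bounds Yl Y0 Zl iT.
  have : closed_span y (S v) by rewrite yY.
  move=> /closed_spanP[A fA Av]; apply/closed_spanP; exists A => // e e0.
  have C1 : 0 < C' + 1 by rewrite ltr_wpDl.
  have [N AN] := Av _ (divr_gt0 e0 C1); exists N => n /AN An.
  have [Ys <-] := isomorphism_vsum Yl Y0 iT Yy (fA n).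
  have E : T (vsum y (A n)) - T (S v) = T (vsum y (A n) - S v).
    by have [Tl _ _ _] := iT; rewrite addrC -scaleN1r -Tl// scaleN1r addrC.
  have Yd : Y (vsum y (A n) - S v) by rewrite addrC -scaleN1r; exact: Yl.
  rewrite E; have [h _] := TC _ Yd; rewrite (le_lt_trans h)//.
  move: An; rewrite ltr_pdivlMr// mulrC; apply: le_lt_trans.
  by rewrite ler_wpM2r ?rn_ge0// lerDl.
exists (unitize (T \o y)); split; first by rewrite -TZ; exact: (unitize_basis uT T0).
have yn := normalized_rn ny.
have CDC : 0 <= C * D * C by rewrite !mulr_ge0.
have C10 : 0 <= C + 1 by rewrite addr_ge0.
have h : eqv (C * D * C * (C + 1)) (T \o y) (unitize (T \o y)).
  apply: eqv_unitize => // i; have [h1 h2] := eqv_coord i yTy; rewrite yn in h1 h2; split.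
    by apply: (le_trans h2); rewrite mulr1 lerDl.
  rewrite invf_ple ?posrE ?ltr_wpDl ?rn_gt0//.
  have := rn_gt0 (T0 i) => r0; rewrite -[leLHS]mul1r ler_pdivrMr//.
  by apply: (le_trans h1); rewrite ler_wpM2r ?rn_ge0// lerDl.
exists (C * (C * D * C * (C + 1))); first by rewrite !mulr_ge0.
by apply: eqv_trans yTy h; rewrite ?mulr_ge0.
Qed.

Section Genus.
Variables (n : nat) (X : completeNormedModType K).
Hypothesis genusX : genus n X.
Variables (Y : set X) (x : nat -> X).
Hypotheses (Yc : complemented Y) (bx : normalized_unconditional_basis Y x).

Definition incr (f : nat -> nat) := {homo f : i j / (i < j)%N}.

Lemma incr_inj f : incr f -> injective f.
Proof.
move=> fi i j fij; have [/fi|/fi|//] := ltngtP i j; by rewrite fij ltnn.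
Qed.

Lemma incr_comp f g : incr f -> incr g -> incr (f \o g).
Proof. by move=> fi gi i j /gi/fi. Qed.

Lemma subsequence_basis phi : incr phi ->
  complemented (closed_span (x \o phi)) /\
  normalized_unconditional_basis (closed_span (x \o phi)) (x \o phi).
Proof.
move=> /incr_inj phi_inj; have [nx ubx] := bx.
split; first exact: (complemented_subsequence Yc ubx phi_inj).
split=> [i|]; first exact: nx.
have [D ux] := unconditional_constant Yc ubx.
apply: (@uncond_basis _ _ _ _ D); first exact: uncond_reindex.
by move=> i; exact: (unconditional_basis_nonzero Yc ubx).
Qed.

Lemma subsequence_unique phi : incr phi ->
  unique_normalized_unconditional_basis (closed_span (x \o phi)).
Proof.
move=> /subsequence_basis[c [_ b]]; have [_ + _] := genusX; apply.
by split => //; exists (x \o phi).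
Qed.

(* phi minimizes the number of isomorphism types of closed spans of its own
   subsequences, so that each of them still spans a copy of the whole. *)
Lemma minimal_subsequence : exists2 phi, incr phi &
  forall psi, incr psi -> exists2 s : nat -> nat, injective s &
    exists2 C : R, 0 <= C & eqv C (x \o phi) (x \o phi \o psi \o s).
Proof.
have [_ _ [Z [Zc Zi Zs]]] := genusX.
pose S phi := [set i : 'I_n | `[< exists psi, incr psi /\
  isomorphic (closed_span (x \o phi \o psi)) (Z i) >]]%SET.
have [phi phii phimin] : exists2 phi, incr phi & forall psi, incr psi -> (#|S phi| <= #|S psi|)%N.
  pose Q m := `[< exists2 phi, incr phi & #|S phi| = m >].
  have exQ : exists m, Q m by exists #|S id|; apply/asboolP; exists id.
  case: (ex_minnP exQ) => m /asboolP[phi phii <-] mmin; exists phi => // psi psii.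
  by apply: mmin; apply/asboolP; exists psi.
exists phi => // psi psii.
have sub : (S (phi \o psi) \subset S phi)%SET.
  apply/fintype.subsetP => i; rewrite !inE => -[th [thi iso]].
  by exists (psi \o th); split => //; exact: incr_comp.
have SE : S (phi \o psi) = S phi.
  by apply/eqP; rewrite eqEcard sub phimin//; exact: incr_comp.
have [c1 b1] := subsequence_basis phii.
have cub1 : complemented_with_ub (closed_span (x \o phi)).
  by split => //; exists (x \o phi); have [] := b1.
have [i0 iso0] := Zs _ cub1.
(* No isomorphism type is lost in passing to [psi], so the type of the span of [x \o phi] itself
   recurs at a further subsequence [th]. *)
have : i0 \in S phi.
  by rewrite !inE; exists id; split; [by move=> ? ?|exact: iso0].
rewrite -SE !inE => -[th [thi iso1]].
have [|c2 b2] := @subsequence_basis (phi \o psi \o th).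
  by do 2!apply: incr_comp => //.
have [z1 [bz1 [C1 C10 e1]]] := transport_basis c1 (proj1 (Zc i0)) iso0 b1.
have [z2 [bz2 [C2 C20 e2]]] := transport_basis c2 (proj1 (Zc i0)) iso1 b2.
have [_ + _] := genusX; move=> /(_ _ (Zc i0))[_ /(_ z1 z2 bz1 bz2)].
move=> /perm_equivalent_eqv[p pb [C C0 e12]].
have pi := bij_inj pb.
exists (th \o p); first exact: inj_comp (incr_inj thi) pi.
exists (C1 * (C * C2)); first by rewrite !mulr_ge0.
apply: (eqv_trans (y := z1)); rewrite ?mulr_ge0//.
apply: (eqv_trans (y := z2 \o p)) => //.
exact: (eqv_reindex pi (eqv_sym e2)).
Qed.

End Genus.

End GenusInterface.

(** * Recognizing the unit vector bases *)

Section UnitBases.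
Variables (R : realType) (k : scalar_kind).
Local Notation K := (scalars R k).
Local Notation absv := (@absv R k).
Local Notation ofreal := (@ofreal R k).

Section SequenceSpace.
Variables (W : normedModType K) (e : nat -> W) (c : W -> nat -> K).
Hypothesis fatou : forall w B, (forall M, rn (vsum e (trunc M (c w))) <= B) -> rn w <= B.
Hypothesis cB : forall w b, fsupp b -> c (w - vsum e b) = fun i => c w i - b i.
Hypothesis c_onto : forall a, scauchy (fun u v => rn (u - v)) (fun n => vsum e (trunc n a)) ->
  exists w, c w = a.

(** [c] gives the coordinates. A Cauchy expansion determines an element with these coordinates by
    [c_onto], and [fatou], the lower semicontinuity of the norm along truncations, bounds the
    distance to it. *)
Lemma sequence_space_expands a :
  scauchy (fun u v => rn (u - v)) (fun n => vsum e (trunc n a)) -> exists w, expands e a w.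
Proof.
move=> ca; have [w cw] := c_onto ca; exists w => d d0.
have [N aN] := ca _ (divr_gt0 d0 (ltr0n _ 2)); exists N => n Nn.
rewrite rnB; apply: (@le_lt_trans _ _ (d / 2)); last by rewrite ltr_pdivrMr// ltr_pMr// ltr1n.
apply: fatou => M; rewrite cB; last exact: fsupp_trunc.
rewrite cw; have := aN (maxn M n) n _ Nn.
rewrite leq_max Nn orbT => /(_ isT) /ltW; apply: le_trans.
rewrite -vsumB; [|exact: fsupp_trunc..].
have [Mn|/ltnW nM] := leqP M n.
  rewrite (@vsum_ext _ _ _ _ _ (trunc M _) (fun=> 0)) ?vsum0 ?rn0 ?rn_ge0// => i.
  rewrite /trunc; case: ltnP => // iM; rewrite ifT ?subrr//.
  exact: leq_trans iM Mn.
rewrite (@vsum_ext _ _ _ _ _ (trunc M _) (fun i => trunc M a i - trunc n a i))// => i.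
rewrite /trunc; case: ltnP => iM; case: ltnP => in_; rewrite ?subr0 ?subrr//.
by have := leq_trans nM iM; rewrite leqNgt in_.
Qed.

End SequenceSpace.

Lemma eqv_expands (V W : normedModType K) (x : nat -> V) (e : nat -> W) C :
  0 <= C -> dom C e x ->
  (forall a, scauchy (fun u v => rn (u - v)) (fun n => vsum e (trunc n a)) -> exists w, expands e a w) ->
  forall a v, expands x a v -> exists w, expands e a w.
Proof.
move=> C0 ex he a v av; apply: he => d d0.
have C1 : 0 < C + 1 by rewrite ltr_wpDl.
have [N aN] := rlim_cauchy av (divr_gt0 d0 C1); exists N => m n Nm Nn.
rewrite -vsumB; [|exact: fsupp_trunc..].
apply: (le_lt_trans (ex _ (fsuppB (fsupp_trunc m a) (fsupp_trunc n a)))).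
rewrite vsumB; [|exact: fsupp_trunc..].
have := aN _ _ Nm Nn; rewrite ltr_pdivlMr// mulrC; apply: le_lt_trans.
by rewrite ler_wpM2r ?rn_ge0// lerDl.
Qed.

Lemma equivalent_perm (V W : normedModType K) (x : nat -> V) (y : nat -> W) :
  equivalent x y -> perm_equivalent x y.
Proof. by exists id => //; exists id. Qed.

Let unit_sum (V : lmodType K) (e : nat -> V) (f : V -> nat -> K^o) (a : nat -> K) (s : seq nat) :
  f 0 = 0 -> (forall u v, f (u + v) = f u + f v) -> (forall c u, f (c *: u) = c *: f u) ->
  (forall n, f (e n) = @unit_seq R k n) -> supp_in s a -> f (\sum_(i <- s) a i *: e i) = a.
Proof.
move=> f0 fD fZ fe [us sa]; apply/funext => j.
have -> : f (\sum_(i <- s) a i *: e i) = \sum_(i <- s) (a i *: (@unit_seq R k i : nat -> K^o)).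
  elim: s {us sa} => [|i s IH]; first by rewrite !big_nil.
  by rewrite !big_cons fD fZ fe IH.
have scE i : (a i *: (@unit_seq R k i : nat -> K^o)) j = a i * (j == i)%:R by [].
rewrite fct_sumE (eq_bigr _ (fun i _ => scE i)).
have [js|js] := boolP (j \in s).
  rewrite (bigD1_seq j)//= big1 ?addr0 ?eqxx ?mulr1//.
  by move=> i ij; rewrite eq_sym (negbTE ij) mulr0.
rewrite big_seq big1 ?sa// => i is_.
case: eqP => [ji|_]; last by rewrite mulr0.
by move: js; rewrite ji is_.
Qed.

Lemma c0_val_vsum (a : nat -> K) : fsupp a -> c0_val (vsum (@c0_unit_basis R k) a) = a.
Proof. by move=> [s sa]; rewrite (vsumE _ sa); apply: (unit_sum (f := @c0_val R k)) sa. Qed.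

Lemma l1_val_vsum (a : nat -> K) : fsupp a -> l1_val (vsum (@l1_unit_basis R k) a) = a.
Proof. by move=> [s sa]; rewrite (vsumE _ sa); apply: (unit_sum (f := @l1_val R k)) sa. Qed.

Lemma l2_val_vsum (a : nat -> K) : fsupp a -> l2_val (vsum (@l2_unit_basis R k) a) = a.
Proof. by move=> [s sa]; rewrite (vsumE _ sa); apply: (unit_sum (f := @l2_val R k)) sa. Qed.

Lemma rn_c0 (u : c0 R k) : rn u = sup (range (fun i => absv (u i))).
Proof. by apply: (@ofreal_inj R k); rewrite ofreal_rn. Qed.

Lemma rn_l1 (u : l1 R k) : rn u = limn (series (fun i => absv (u i))).
Proof. by apply: (@ofreal_inj R k); rewrite ofreal_rn. Qed.

Lemma rn_l2 (u : l2 R k) : rn u = Num.sqrt (limn (series (fun i => absv (u i) ^+ 2))).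
Proof. by apply: (@ofreal_inj R k); rewrite ofreal_rn. Qed.

Lemma c0_coord (u : c0 R k) i : absv (u i) <= rn u.
Proof. by rewrite rn_c0; exact: absv_le_c0. Qed.

Lemma c0_bound (u : c0 R k) B : (forall i, absv (u i) <= B) -> rn u <= B.
Proof.
move=> uB; rewrite rn_c0; apply: ge_sup; first exact: (c0_has_sup u).1.
by move=> _ [i _ <-].
Qed.

Let lim_finite (f : nat -> R) n : (forall i, (n <= i)%N -> f i = 0) ->
  limn (series f) = \sum_(i < n) f i.
Proof.
move=> fn; apply: cvg_lim => //; apply: cvg_near_cst; exists n => // m /= nm.
rewrite -(big_mkord xpredT f) -[RHS]addr0 /series /= (big_cat_nat (n := n))//=.
by congr (_ + _); rewrite big_nat_cond big1// => i /andP[/andP[/fn]].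
Qed.

Lemma rn_l1_trunc n a : rn (vsum (@l1_unit_basis R k) (trunc n a)) = \sum_(i < n) absv (a i).
Proof.
rewrite rn_l1 l1_val_vsum; last exact: fsupp_trunc.
rewrite (@lim_finite _ n); last by move=> i ni; rewrite trunc_out// absv0.
by apply: eq_bigr => i _; rewrite /trunc ltn_ord.
Qed.

Lemma rn_l2_trunc n a : rn (vsum (@l2_unit_basis R k) (trunc n a)) =
  Num.sqrt (\sum_(i < n) absv (a i) ^+ 2).
Proof.
rewrite rn_l2 l2_val_vsum; last exact: fsupp_trunc.
rewrite (@lim_finite _ n); last by move=> i ni; rewrite trunc_out// absv0 expr0n.
by congr Num.sqrt; apply: eq_bigr => i _; rewrite /trunc ltn_ord.
Qed.

Let series_bounded_cvg (f : nat -> R) B : (forall i, 0 <= f i) ->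
  (forall n, \sum_(i < n) f i <= B) -> cvgn (series f).
Proof.
move=> f0 fB; apply: nondecreasing_is_cvgn.
  by apply: nondecreasing_series => i _ _.
by exists B => _ [n _ <-]; rewrite /series /= big_mkord.
Qed.

Let cauchy_bounded (W : normedModType K) (u : nat -> W) :
  scauchy (fun x y => rn (x - y)) u -> exists2 B, 0 <= B & forall n, rn (u n) <= B.
Proof.
move=> /(_ _ ltr01)[N uN]; exists (rn (u N) + 1 + \sum_(i < N) rn (u i)).
  by rewrite !addr_ge0 ?rn_ge0// sumr_ge0// => i _; exact: rn_ge0.
move=> n; have s0 (P : pred 'I_N) : 0 <= \sum_(i < N | P i) rn (u i).
  by rewrite sumr_ge0// => i _; exact: rn_ge0.
have [Nn|nN] := leqP N n.
  rewrite -[leLHS]addr0; apply: lerD; last exact: (s0 xpredT).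
  rewrite -[X in rn X](subrK (u N)) (le_trans (rnD _ _))// addrC lerD2l.
  by rewrite ltW// uN.
rewrite -[leLHS]add0r; apply: lerD; first by rewrite addr_ge0 ?rn_ge0.
by rewrite (bigD1 (Ordinal nN))//= lerDl; exact: (s0 (fun i => i != Ordinal nN)).
Qed.

Lemma c0_expands a :
  scauchy (fun u v => rn (u - v)) (fun n => vsum (@c0_unit_basis R k) (trunc n a)) ->
  exists w, expands (@c0_unit_basis R k) a w.
Proof.
apply: (@sequence_space_expands _ _ (@c0_val R k)).
- move=> w B H; apply: c0_bound => i.
  have := le_trans (c0_coord (vsum (@c0_unit_basis R k) (trunc i.+1 (c0_val w))) i) (H i.+1).
  by rewrite c0_val_vsum; [rewrite /trunc ltnSn|exact: fsupp_trunc].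
- by move=> w b fb; rewrite -{2}(c0_val_vsum fb); apply/funext.
move=> {}a ca; suff ac : (a : nat -> K^o) \in @c0_pred R k by exists (C0 ac).
rewrite inE /=; apply/cvgrPdist_lt => e e0; have [N aN] := ca _ e0.
exists N => // i /= Ni; rewrite sub0r normrN ger0_norm ?absv_ge0//.
apply: le_lt_trans (aN i.+1 N (leqW Ni) (leqnn N)).
rewrite -vsumB; [|exact: fsupp_trunc..].
apply: le_trans (c0_coord _ i); rewrite c0_val_vsum.
  by rewrite /trunc ltnSn ltnNge Ni subr0.
by apply: fsuppB; exact: fsupp_trunc.
Qed.

Lemma l1_expands a :
  scauchy (fun u v => rn (u - v)) (fun n => vsum (@l1_unit_basis R k) (trunc n a)) ->
  exists w, expands (@l1_unit_basis R k) a w.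
Proof.
apply: (@sequence_space_expands _ _ (@l1_val R k)).
- move=> w B H; rewrite rn_l1; apply: limr_le; first exact: l1_cvg.
  by near=> n; rewrite /series /= big_mkord -rn_l1_trunc.
- by move=> w b fb; rewrite -{2}(l1_val_vsum fb); apply/funext.
move=> {}a /cauchy_bounded[B B0 aB].
suff ac : (a : nat -> K^o) \in @l1_pred R k by exists (L1 ac).
rewrite inE /=; apply: (@series_bounded_cvg _ B) => [i|n]; first exact: absv_ge0.
by rewrite -rn_l1_trunc.
Unshelve. all: by end_near. Qed.

Lemma l2_expands a :
  scauchy (fun u v => rn (u - v)) (fun n => vsum (@l2_unit_basis R k) (trunc n a)) ->
  exists w, expands (@l2_unit_basis R k) a w.
Proof.
apply: (@sequence_space_expands _ _ (@l2_val R k)).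
- move=> w B H; rewrite rn_l2.
  have B0 : 0 <= B by apply: le_trans (H 0%N); exact: rn_ge0.
  rewrite -[leRHS]ger0_norm// -sqrtr_sqr; apply: ler_wsqrtr.
  apply: limr_le; first exact: l2_cvg.
  near=> n; rewrite /series /= big_mkord -[leLHS]sqr_sqrtr.
    by rewrite -rn_l2_trunc lerXn2r ?nnegrE ?rn_ge0.
  by rewrite sumr_ge0// => i _; exact: sqr_ge0.
- by move=> w b fb; rewrite -{2}(l2_val_vsum fb); apply/funext.
move=> {}a /cauchy_bounded[B B0 aB].
suff ac : (a : nat -> K^o) \in @l2_pred R k by exists (L2 ac).
rewrite inE /=; apply: (@series_bounded_cvg _ (B ^+ 2)) => [i|n]; first exact: sqr_ge0.
rewrite -[leLHS]sqr_sqrtr.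
  by rewrite -rn_l2_trunc lerXn2r ?nnegrE ?rn_ge0.
by rewrite sumr_ge0// => i _; exact: sqr_ge0.
Unshelve. all: by end_near. Qed.

Section Recognize.
Variables (V : completeNormedModType K) (z : nat -> V) (C D : R).
Hypotheses (C0 : 0 <= C) (uz : uncond D z) (z0 : forall i, z i != 0).

Lemma perm_equivalent_c0 :
  (forall a B, fsupp a -> (forall i, absv (a i) <= B) -> rn (vsum z a) <= C * B) ->
  (forall a i, fsupp a -> absv (a i) <= C * rn (vsum z a)) ->
  perm_equivalent z (@c0_unit_basis R k).
Proof.
move=> h1 h2; have e : eqv C z (@c0_unit_basis R k).
  split=> a fa.
    by apply: h1 => // i; rewrite -{1}(c0_val_vsum fa); exact: c0_coord.
  by apply: c0_bound => i; rewrite c0_val_vsum//; exact: h2.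
apply: equivalent_perm; apply: (eqv_equivalent C0 e uz z0).
exact: (eqv_expands C0 (proj2 e) c0_expands).
Qed.

Let fsupp_truncE (a : nat -> K) : fsupp a -> exists n, a = trunc n a.
Proof. by move=> /trunc_fsupp[N aN]; exists N; rewrite aN. Qed.

Lemma perm_equivalent_l1 :
  (forall n (a : nat -> K), rn (vsum z (trunc n a)) <= C * \sum_(i < n) absv (a i)) ->
  (forall n (a : nat -> K), \sum_(i < n) absv (a i) <= C * rn (vsum z (trunc n a))) ->
  perm_equivalent z (@l1_unit_basis R k).
Proof.
move=> h1 h2; have e : eqv C z (@l1_unit_basis R k).
  by split=> a /fsupp_truncE[n ->]; rewrite rn_l1_trunc.
apply: equivalent_perm; apply: (eqv_equivalent C0 e uz z0).
exact: (eqv_expands C0 (proj2 e) l1_expands).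
Qed.

Lemma perm_equivalent_l2 :
  (forall n (a : nat -> K), rn (vsum z (trunc n a)) <= C * Num.sqrt (\sum_(i < n) absv (a i) ^+ 2)) ->
  (forall n (a : nat -> K), Num.sqrt (\sum_(i < n) absv (a i) ^+ 2) <= C * rn (vsum z (trunc n a))) ->
  perm_equivalent z (@l2_unit_basis R k).
Proof.
move=> h1 h2; have e : eqv C z (@l2_unit_basis R k).
  by split=> a /fsupp_truncE[n ->]; rewrite rn_l2_trunc.
apply: equivalent_perm; apply: (eqv_equivalent C0 e uz z0).
exact: (eqv_expands C0 (proj2 e) l2_expands).
Qed.

End Recognize.

End UnitBases.

(** * Spreading subsequences *)

Section Ramsey.

Variable U : set_system nat.
Hypotheses (U_ultra : UltraFilter U) (U_free : \oo `<=` U).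

Lemma ultra_limit (g : nat -> nat) b : (forall n, (g n < b)%N) ->
  exists t, U [set n | g n = t].
Proof.
elim: b => [|b IH] in g *; first by move=> /(_ 0%N).
move=> gb; have [h|h] := in_ultra_setVsetC [set n | g n = b] U_ultra; first by exists b.
(* The value [b] occurs outside a large set only and is replaced by 0. For b = 0 the new bound would
   fail, but then a large set would be empty. *)
have [|t ht] := IH (fun n => if g n == b then 0%N else g n).
  move=> n; case: eqP => [gn|/eqP gn]; last by have := gb n; rewrite ltnS leq_eqVlt (negbTE gn).
  case: b {IH} gb h gn => // gb h _.
  have [m /= /eqP] := filter_ex h.
  by have := gb m; rewrite ltnS leqn0 => /eqP ->.
exists t; apply: filterS2 h ht => n /= /eqP/negbTE ->.
by [].
Qed.

Lemma ultra_forall (T : eqType) (s : seq T) (Q : T -> set nat) :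
  (forall p, p \in s -> U (Q p)) -> U [set n | forall p, p \in s -> Q p n].
Proof.
elim: s => [|p s IH] h; first by apply: filterS filterT => n _ p.
apply: filterS2 (h p (mem_head _ _)) (IH _) => [n Qp Qs q|q qs].
  by rewrite inE => /orP[/eqP ->//|/Qs].
by apply: h; rewrite inE qs orbT.
Qed.

Lemma ultra_gt N : U [set n | (N < n)%N].
Proof. by apply: U_free; exists N.+1. Qed.

(* Ramsey's theorem by iterated limits along U: [L d s] is the limit of the
   colours of s followed by d further elements. *)
Lemma diagonal_ramsey (c : seq nat -> nat) (b : nat -> nat) :
  (forall s, (c s < b (size s))%N) ->
  exists2 m : nat -> nat, incr m & forall l, exists t, forall s,
    size s = l -> sorted ltn s -> all (fun i => l <= i)%N s -> c (map m s) = t.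
Proof.
move=> cb; pose B d sz := b (sz + d)%N.
have /choice[lim limP] : forall gb : (nat -> nat) * nat, exists t,
    (forall n, (gb.1 n < gb.2)%N) -> U [set n | gb.1 n = t].
  move=> [g b'] /=; have [h|h] := pselect (forall n, (g n < b')%N); last by exists 0%N.
  by have [t ht] := ultra_limit h; exists t.
pose L := fix L d s := if d is d'.+1 then lim (fun n => L d' (rcons s n), b (size s + d)%N) else c s.
have Lb d : forall s, (L d s < b (size s + d))%N.
  elim: d => [|d IH] s; first by rewrite addn0.
  have h n : (L d (rcons s n) < b (size s + d.+1))%N by have := IH (rcons s n); rewrite size_rcons addSnnS.
  have [n /= <-] := filter_ex (limP (fun n => L d (rcons s n), b (size s + d.+1)%N) h).
  exact: h.
have LS d s : U [set n | L d (rcons s n) = L d.+1 s].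
  apply: (limP (fun n => L d (rcons s n), b (size s + d.+1)%N)) => n /=.
  by have := Lb d (rcons s n); rewrite size_rcons addSnnS.
(* The next term lies in finitely many large sets: for every subset of the terms [st] chosen so far
   and every depth up to their number, appending it must yield the limit colour. *)
have /choice[g gP] (st : seq nat) : exists n, (forall i, i \in st -> (i < n)%N) /\
    forall (mk : (size st).-tuple bool) d, (d <= size st)%N ->
      L d (rcons (mask mk st) n) = L d.+1 (mask mk st).
  have h1 : U [set n | forall i, i \in st -> (i < n)%N].
    by apply: (@ultra_forall _ st (fun i => [set n | (i < n)%N])) => i _; exact: ultra_gt.
  have h2 := @ultra_forall _ (enum {: (size st).-tuple bool * 'I_(size st).+1})
    (fun p => [set n | L p.2 (rcons (mask p.1 st) n) = L p.2.+1 (mask p.1 st)]) (fun p _ => LS _ _).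
  have [n [n1 n2]] := filter_ex (filterI h1 h2).
  exists n; split => // mk d dst.
  have dst' : (d < (size st).+1)%N by [].
  by apply: (n2 (mk, Ordinal dst')); rewrite mem_enum.
pose st := fix st i := if i is i'.+1 then rcons (st i') (g (st i')) else [::].
pose m i := g (st i).
have stE i : st i = map m (iota 0 i).
  by elim: i => // i IH; rewrite -addn1 iotaD map_cat /= -IH addn1 /= cats1.
have stsz i : size (st i) = i by rewrite stE size_map size_iota.
have m_incr : incr m.
  move=> i j ij; have [+ _] := gP (st j); apply; rewrite stE.
  by apply/mapP; exists i => //; rewrite mem_iota.
exists m => // l; exists (L l [::]) => s sl ss sge.
suff H : forall d s', (size s' + d)%N = l -> sorted ltn s' -> all (fun i => l <= i)%N s' ->
    L d (map m s') = L l [::].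
  by apply: (H 0%N) => //; rewrite addn0.
move=> d s'; elim/last_ind: s' d => [|s' i IH] d; first by rewrite add0n => ->.
rewrite size_rcons addSnnS => sd ss' /[!all_rcons]/andP[li ls'].
rewrite map_rcons; rewrite -(IH d.+1)//; last first.
  by move: ss'; rewrite -cats1 => /(subseq_sorted ltn_trans); apply; exact: prefix_subseq.
have s'i : {subset s' <= iota 0 i}.
  move=> j js'; rewrite mem_iota add0n /=.
  by move: ss'; rewrite -cats1 (sorted_pairwise ltn_trans) pairwise_cat => /andP[/allrelP/(_ j i js')]; rewrite inE eqxx => ->.
have sub : subseq (map m s') (st i).
  rewrite stE; apply: map_subseq.
  have -> : s' = [seq j <- iota 0 i | j \in s'].
    apply: (irr_sorted_eq ltn_trans ltnn).
    - by move: ss'; rewrite -cats1 => /(subseq_sorted ltn_trans); apply; exact: prefix_subseq.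
    - by apply: (sorted_filter ltn_trans); exact: iota_ltn_sorted.
    - by move=> j; rewrite mem_filter; have [/s'i ->|] := boolP (j \in s').
  exact: filter_subseq.
have /subseqP[mk mksz mkE] := sub.
have [_ gst] := gP (st i).
(* Only depths up to [i] were treated when [m i] was chosen; this is why the entries are required to
   be at least [l]. *)
have dst : (d <= size (st i))%N by rewrite stsz; lia.
by have := gst (Tuple (introT eqP mksz)) d dst; rewrite /= -mkE.
Qed.

End Ramsey.

Lemma free_ultrafilter : exists U : set_system nat, UltraFilter U /\ \oo `<=` U.
Proof. exact: ultraFilterLemma. Qed.

Section Enumeration.

Definition mono (l : nat) (s : 'I_l -> nat) := {homo s : i j / (i < j)%N}.

Lemma mono_ord_inj l (s : 'I_l -> nat) : mono s -> injective s.
Proof.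
move=> fi i j fij; apply: val_inj => /=; have [/fi|/fi|//] := ltngtP i j; by rewrite fij ltnn.
Qed.

Lemma codom_mono l (s : 'I_l -> nat) : mono s -> sorted ltn (codom s).
Proof.
move=> ms; rewrite /codom /image_mem sorted_map.
apply: (@sub_sorted _ (fun i j : 'I_l => (i < j)%N)); first by move=> i j /ms.
by have := iota_ltn_sorted 0 l; rewrite -val_enum_ord sorted_map.
Qed.

Lemma all_codom l (s : 'I_l -> nat) (P : pred nat) : (forall i, P (s i)) -> all P (codom s).
Proof. by move=> h; apply/allP => _ /codomP[i ->]. Qed.

Lemma sort_mono l (u : 'I_l -> nat) : injective u ->
  exists2 p : 'I_l -> 'I_l, injective p & mono (u \o p).
Proof.
case: l u => [|l] u ui; first by exists id => // -[].
pose r (i j : 'I_l.+1) := (u i <= u j)%N.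
pose s := sort r (enum 'I_l.+1).
have ss : size s = l.+1 by rewrite size_sort size_enum_ord.
have us : uniq s by rewrite sort_uniq enum_uniq.
have so : sorted r s by apply: sort_sorted => i j; exact: leq_total.
exists (fun i => nth ord0 s i).
  by move=> i j /eqP; rewrite nth_uniq ?ss// => /eqP/val_inj.
move=> i j ij /=; rewrite ltn_neqAle; apply/andP; split.
  apply/negP => /eqP/ui/eqP; rewrite nth_uniq ?ss//.
  by move=> /eqP ijE; rewrite ijE ltnn in ij.
have rt : transitive r by move=> ? ? ?; rewrite /r; exact: leq_trans.
by apply: (sorted_leq_nth rt _ ord0 so); rewrite ?inE ?ss ?(ltnW ij)// => ?; exact: leqnn.
Qed.

End Enumeration.

(** * Colouring finite tuples by their norms on a grid *)

Section FiniteTypes.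
Variables (R : realType) (k : scalar_kind).
Local Notation K := (scalars R k).
Local Notation absv := (@absv R k).
Local Notation ofreal := (@ofreal R k).
Variable (V : normedModType K).

Lemma vsum_ord l (u : 'I_l -> V) (a : 'I_l -> K) : vsum u a = \sum_(i < l) a i *: u i.
Proof.
rewrite (@vsumE _ _ _ _ _ _ (enum 'I_l)) ?big_enum//.
by split; rewrite ?enum_uniq// => i; rewrite mem_enum.
Qed.

Lemma fsupp_ord l (a : 'I_l -> K) : fsupp a.
Proof. by exists (enum 'I_l); split; rewrite ?enum_uniq// => i; rewrite mem_enum. Qed.

Definition grid_point l q (g : {ffun 'I_l -> 'I_q.+1}) : 'I_l -> K :=
  fun i => ofreal ((g i)%:R / q%:R).

(** One may take coefficients in the unit interval with largest one 1, whose combination of [u'] has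
    norm at least 1 / D. Rounding to the grid and equality of integer parts each cause an error of
    at most 1 / (4 D), which that norm absorbs. Two factors [D] come from passing to moduli and
    back, the third from rounding down. *)
Lemma grid_dom l q (D : R) (u u' : 'I_l -> V) : 1 <= D -> 4 * D * l%:R <= q%:R -> (0 < q)%N ->
  uncond D u -> uncond D u' -> (forall i, rn (u i) = 1) -> (forall i, rn (u' i) = 1) ->
  (forall g : {ffun 'I_l -> 'I_q.+1}, Num.truncn (4 * D * rn (vsum u (grid_point g))) =
     Num.truncn (4 * D * rn (vsum u' (grid_point g)))) ->
  dom (2 * D ^+ 3) u u'.
Proof.
move=> D1 lq q0 uu uu' nu nu' same a fa.
have D0 : 0 < D by exact: lt_le_trans D1.
have q0' : 0 < q%:R :> R by rewrite ltr0n.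
pose M := \big[Num.max/0]_(i < l) absv (a i).
have aM i : absv (a i) <= M by exact: le_bigmax.
have M0 : 0 <= M by exact: bigmax_ge_id.
have [/eqP Mz|Mz] := boolP (M == 0).
  have -> : a = fun=> 0.
    apply/funext => i; apply: absv0_eq0; apply/eqP.
    by rewrite eq_le absv_ge0 andbT -Mz.
  by rewrite !vsum0 !rn0 mulr0.
have {}M0 : 0 < M by rewrite lt_neqAle eq_sym Mz.
pose t i := absv (a i) / M.
have t01 i : 0 <= t i <= 1.
  by rewrite divr_ge0 ?absv_ge0 ?(ltW M0)//= ler_pdivrMr// mul1r.
have [i0 ti0] : exists i0, t i0 = 1.
  have [i0 _ iM] : exists2 i0, true & M = absv (a i0).
    apply: contrapT => h; move: Mz; apply/negP; rewrite negbK.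
    have : M = 0 \/ exists i, M = absv (a i).
      rewrite /M; elim/big_ind : _ => [|x y [->|[i ->]] [->|[j ->]]|i _]; first by left.
      - by left; rewrite maxxx.
      - by right; exists j; rewrite max_r// absv_ge0.
      - by right; exists i; rewrite max_l// absv_ge0.
      - by right; rewrite /Num.max; case: ltP => _; [exists j|exists i].
      - by right; exists i.
    by case=> [->//|[i iE]]; case: h; exists i.
  by exists i0; rewrite /t -iM divff// gt_eqF.
have gq i : (Num.truncn (q%:R * t i) < q.+1)%N.
  have /andP[h0 h1] := t01 i.
  rewrite ltnS -(ler_nat R) (@le_trans _ _ (q%:R * t i))//; last by rewrite ler_piMr// ler0n.
  by rewrite truncn_le mulr_ge0// ler0n.
pose g : {ffun 'I_l -> 'I_q.+1} := [ffun i => Ordinal (gq i)].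
have gE i : grid_point g i = ofreal ((Num.truncn (q%:R * t i))%:R / q%:R).
  by rewrite /grid_point ffunE.
have qt0 i : 0 <= q%:R * t i by have /andP[h _] := t01 i; rewrite mulr_ge0// ler0n.
have gt i : (Num.truncn (q%:R * t i))%:R / q%:R <= t i.
  by rewrite ler_pdivrMr// [leRHS]mulrC truncn_le.
have gt' i : t i - (Num.truncn (q%:R * t i))%:R / q%:R <= q%:R^-1.
  rewrite lerBlDl -[X in _ + X]mul1r -mulrDl ler_pdivlMr// [leLHS]mulrC ltW//.
  by rewrite natr1 truncnS_gt.
pose T i := ofreal (t i).
have s1 : rn (vsum u a) <= D * (M * rn (vsum u T)).
  have -> : M * rn (vsum u T) = rn (vsum u (fun i => ofreal M * T i)).
    by rewrite vsumZ ?rnZ ?absv_ofreal ?gtr0_norm//; exact: fsupp_ord.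
  apply: uu; first exact: fsupp_ord.
  move=> i; rewrite /T /t -ofrealM mulrC divfK ?gt_eqF// absv_ofreal ger0_norm//.
  exact: absv_ge0.
have s2 : M * rn (vsum u' T) <= D * rn (vsum u' a).
  have -> : M * rn (vsum u' T) = rn (vsum u' (fun i => ofreal M * T i)).
    by rewrite vsumZ ?rnZ ?absv_ofreal ?gtr0_norm//; exact: fsupp_ord.
  apply: uu'; first exact: fsupp_ord.
  move=> i; rewrite /T /t -ofrealM mulrC divfK ?gt_eqF// absv_ofreal ger0_norm//.
  exact: absv_ge0.
have s3 : rn (vsum u T) <= rn (vsum u (grid_point g)) + l%:R / q%:R.
  rewrite (@vsum_ext _ _ _ _ u T (fun i => grid_point g i + ofreal (t i - (Num.truncn (q%:R * t i))%:R / q%:R))); last first.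
    by move=> i; rewrite gE -ofrealD addrC subrK.
  rewrite vsumD; [|exact: fsupp_ord..].
  rewrite (le_trans (rnD _ _))// lerD2l vsum_ord (le_trans (rn_sum _ _ _))//.
  rewrite (@le_trans _ _ (\sum_(i < l) q%:R^-1))//.
    apply: ler_sum => i _; rewrite rnZ nu mulr1 absv_ofreal ger0_norm ?subr_ge0//.
  by rewrite sumr_const card_ord -[leLHS]mulr_natl.
have s4 : rn (vsum u' (grid_point g)) <= D * rn (vsum u' T).
  apply: uu'; first exact: fsupp_ord.
  move=> i; have /andP[ti_ge0 _] := t01 i.
  by rewrite gE /T !absv_ofreal !ger0_norm// divr_ge0// ler0n.
have s5 : 1 <= D * rn (vsum u' T).
  by have := coord_le i0 uu' (fsupp_ord T); rewrite nu' mulr1 /T ti0 ofreal1 absv1.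
have s6 : 4 * D * rn (vsum u (grid_point g)) <= 4 * D * rn (vsum u' (grid_point g)) + 1.
  have h x : 0 <= 4 * D * rn x :> R by move=> *; rewrite !mulr_ge0 ?rn_ge0 ?(ltW D0).
  apply/ltW/(lt_le_trans (truncnS_gt _)); rewrite same -natr1 lerD2r truncn_le.
  exact: h.
have s7 : l%:R / q%:R <= (4 * D)^-1 :> R.
  rewrite ler_pdivrMr// mulrC -[leLHS]mul1r -ler_pdivrMr ?invr_gt0 ?mulr_gt0//.
  by rewrite invrK mulrC mul1r.
set A := rn (vsum u T) in s1 s3; set B := rn (vsum u (grid_point g)) in s3 s6.
set B' := rn (vsum u' (grid_point g)) in s4 s6; set A' := rn (vsum u' T) in s2 s4 s5.
have s8 : B <= B' + (4 * D)^-1.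
  rewrite -(ler_pM2l (_ : 0 < 4 * D)) ?mulr_gt0// mulrDr mulfV ?gt_eqF ?mulr_gt0//.
have s9 : (4 * D)^-1 <= A' / 4.
  rewrite invfM mulrC ler_wpM2r// -[leLHS]mul1r ler_pdivrMr// mulrC.
  exact: s5.
have A'0 : 0 <= A' by exact: rn_ge0.
have s10 : A <= 2 * D * A'.
  have : A' <= D * A' by rewrite ler_peMl.
  have -> : 2 * D * A' = D * A' + D * A' by ring.
  lra.
apply: (le_trans s1); rewrite (_ : 2 * D ^+ 3 * _ = D * (2 * D * (D * rn (vsum u' a)))); last by ring.
rewrite ler_wpM2l ?(ltW D0)//.
apply: (@le_trans _ _ (M * (2 * D * A'))); first by rewrite ler_wpM2l// ltW.
by rewrite mulrCA ler_wpM2l// mulr_ge0// ltW.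
Qed.

(** For normalized [y], grid combinations have norm at most [l], so by the choice of [q] the integer
    parts do not exceed [q] and [inord] changes nothing. *)
Definition grid_colour (D : R) (y : nat -> V) (l : nat) : seq nat -> nat :=
  let q := (Num.truncn (4 * D * l%:R)).+1 in
  fun s => enum_rank [ffun g : {ffun 'I_l -> 'I_q.+1} =>
    inord (Num.truncn (4 * D * rn (vsum (fun i : 'I_l => y (nth 0%N s i)) (grid_point g))))
      : 'I_q.+1].

Lemma grid_colour_eqv D y l (s s' : 'I_l -> nat) : 1 <= D -> uncond D y ->
  (forall i, rn (y i) = 1) -> injective s -> injective s' ->
  grid_colour D y l (codom s) = grid_colour D y l (codom s') -> eqv (2 * D ^+ 3) (y \o s) (y \o s').
Proof.
move=> D1 uy ny si si'; rewrite /grid_colour.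
have D0 : 0 < D by exact: lt_le_trans D1.
set q := (Num.truncn _).+1.
have codE (s0 : 'I_l -> nat) : (fun i : 'I_l => y (nth 0%N (codom s0) i)) = y \o s0.
  apply/funext => i /=; rewrite /codom /image_mem (nth_map i) ?size_enum_ord//.
  by rewrite nth_ord_enum.
rewrite !codE => /val_inj/enum_rank_inj/ffunP same.
have lq : 4 * D * l%:R <= q%:R by rewrite ltW// truncnS_gt.
have tq (s0 : 'I_l -> nat) (g : {ffun 'I_l -> 'I_q.+1}) :
    (Num.truncn (4 * D * rn (vsum (y \o s0) (grid_point g))) < q.+1)%N.
  rewrite ltnS leqW// le_truncn// -!mulrA !ler_wpM2l ?(ltW D0)//.
  rewrite vsum_ord (le_trans (rn_sum _ _ _))//.
  rewrite (@le_trans _ _ (\sum_(i < l) 1))//; last by rewrite sumr_const card_ord.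
  apply: ler_sum => i _; rewrite rnZ ny mulr1 /grid_point absv_ofreal ger0_norm; last by rewrite divr_ge0// ler0n.
  by rewrite ler_pdivrMr ?ltr0n// mul1r ler_nat -ltnS.
have same' (g : {ffun 'I_l -> 'I_q.+1}) : Num.truncn (4 * D * rn (vsum (y \o s) (grid_point g))) =
    Num.truncn (4 * D * rn (vsum (y \o s') (grid_point g))).
  by have := same g; rewrite !ffunE => /(congr1 val); rewrite /= !inordK//; exact: tq.
have us := uncond_reindex si uy; have us' := uncond_reindex si' uy.
by split; apply: (@grid_dom l q) => // i /=.
Qed.

(** All lengths are treated by one diagonal subsequence, so tuples of length [l] are controlled only
    from index [l] on. *)
Lemma asymptotic_subsequence D (y : nat -> V) : 1 <= D -> uncond D y ->
  (forall i, rn (y i) = 1) -> exists2 m, incr m &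
    forall l (s s' : 'I_l -> nat), mono s -> mono s' -> (forall i, l <= s i)%N -> (forall i, l <= s' i)%N ->
      eqv (2 * D ^+ 3) (y \o m \o s) (y \o m \o s').
Proof.
move=> D1 uy ny; have [U [Uu Uf]] := free_ultrafilter.
have [|m mi mP] := @diagonal_ramsey U Uu Uf (fun s => grid_colour D y (size s) s)
  (fun l => let q := (Num.truncn (4 * D * l%:R)).+1 in #|{ffun {ffun 'I_l -> 'I_q.+1} -> 'I_q.+1}|).
  by move=> s; exact: ltn_ord.
exists m => // l s s' ms ms' ls ls'.
have [t tP] := mP l.
have colE (s0 : 'I_l -> nat) : mono s0 -> (forall i, l <= s0 i)%N ->
    grid_colour D y l (codom (m \o s0)) = t.
  move=> ms0 ls0; rewrite -(tP (codom s0)).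
  - by rewrite size_map size_codom card_ord /codom /image_mem -map_comp.
  - by rewrite size_codom card_ord.
  - exact: codom_mono.
  - exact: all_codom.
apply: (@grid_colour_eqv _ _ _ (m \o s) (m \o s')) => //.
- exact: inj_comp (incr_inj mi) (mono_ord_inj ms).
- exact: inj_comp (incr_inj mi) (mono_ord_inj ms').
- by rewrite !colE.
Qed.

End FiniteTypes.

(** * From asymptotic to full spreading, by self-similarity *)

Section Spreading.
Variables (R : realType) (k : scalar_kind).
Local Notation K := (scalars R k).
Variable V : normedModType K.

Definition spreading (C : R) (z : nat -> V) :=
  forall l (s s' : 'I_l -> nat), mono s -> mono s' -> eqv C (z \o s) (z \o s').

Lemma eqv_le (I : choiceType) (W W' : normedModType K) (C C' : R) (x : I -> W) (y : I -> W') :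
  C <= C' -> eqv C x y -> eqv C' x y.
Proof. by move=> CC [xy yx]; split; exact: dom_le CC _. Qed.

Definition from_ord l (n : nat) : 'I_l -> nat := fun i => (n + i)%N.

Lemma from_ord_mono l n : mono (@from_ord l n).
Proof. by move=> i j ij; rewrite /from_ord ltn_add2l. Qed.

Section Far.
Variables (w : nat -> V) (C0 : R).
Hypotheses (C00 : 0 <= C0)
  (asym : forall l (s s' : 'I_l -> nat), mono s -> mono s' -> (forall i, l <= s i)%N ->
    (forall i, l <= s' i)%N -> eqv C0 (w \o s) (w \o s'))
  (self : forall psi, incr psi -> exists2 s : nat -> nat, injective s &
     exists2 C : R, 0 <= C & eqv C w (w \o psi \o s)).

(** The rearrangement [p] is allowed because the embeddings in [self] need not respect the order. *)
Let good (C : R) l (A : 'I_l -> nat) :=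
  exists2 p : 'I_l -> 'I_l, injective p & eqv C (w \o A \o p) (w \o @from_ord l l).

(* If the claim failed, bad finite sets A_0 < A_1 < ... could be embedded by
   [self] in a subsequence so sparse that most of the A_i land beyond index
   #|A_i|, where [asym] makes them good. *)
Lemma far_sets_good : exists m0, exists2 C : R, 0 <= C & forall l (A : 'I_l -> nat),
  injective A -> (forall i, m0 <= A i)%N -> good C A.
Proof.
apply: contrapT => H.
have /choice[A AP] : forall mj : nat * nat, exists lA : {l : nat & 'I_l -> nat},
    [/\ injective (projT2 lA), forall i, (mj.1 <= projT2 lA i)%N & ~ good mj.2%:R (projT2 lA)].
  move=> [m j] /=; apply: contrapT => H'; apply: H; exists m, j%:R => // l A Ai Am.
  by apply: contrapT => Ag; apply: H'; exists (existT (fun l => 'I_l -> nat) l A).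
pose top mj := (\max_(i < projT1 (A mj)) projT2 (A mj) i).+1.
pose p := fix p j := if j is j'.+1 then maxn (p j').+1 (top (p j', j')) else 0%N.
have pS j : (p j < p j.+1)%N by rewrite /= leq_maxl.
have pA j (i : 'I_(projT1 (A (p j, j)))) : (p j <= projT2 (A (p j, j)) i < p j.+1)%N.
  have [_ /(_ i) -> _] := AP (p j, j).
  by rewrite /= leq_max; apply/orP; right; rewrite ltnS; exact: (leq_bigmax i).
have [idx [_ idxU]] := locate_exists (erefl : p 0%N = 0%N) pS.
pose sz j := projT1 (A (p j, j)).
pose B j : 'I_(sz j) -> nat := projT2 (A (p j, j)).
have Bidx j i : idx (B j i) = j by apply: idxU; exact: pA.
(* [nu j] exceeds the size of every set of index up to 2 j; the successor makes it strictly
   increasing even if some sets are empty. *)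
pose nu j := (\sum_(i < j.*2.+1) (sz i).+1)%N.
have nu_incr : incr nu.
  have nuS j : (nu j < nu j.+1)%N.
    rewrite /nu doubleS [X in (_ < X)%N]big_ord_recr /= [X in (_ < X + _)%N]big_ord_recr /=.
    by rewrite addnS ltnS -addnA leq_addr.
  by apply: homo_ltn nuS; exact: ltn_trans.
have nu_ge i j : (i <= j.*2)%N -> (sz i <= nu j)%N.
  rewrite -ltnS => ij; rewrite /nu (bigD1 (Ordinal ij))//=.
  by rewrite (leq_trans (leqnSn _))// leq_addr.
have [s si [C C1 ws]] := self nu_incr.
pose j := (Num.truncn (C * C0)).+1.
(* The j + 1 disjoint sets of index j to 2 j have disjoint images under [s], and only j values lie
   below j, so some image avoids them all. *)
have [r rP] : exists r : 'I_j.+1, forall i : 'I_(sz (j + r)), (j <= s (B _ i))%N.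
  apply: contrapT => /forallNP h.
  have /choice[f fP] (r : 'I_j.+1) : exists a : 'I_j, exists i : 'I_(sz (j + r)), s (B _ i) = a.
    have /existsNP[i /negP] := h r; rewrite -ltnNge => ij; exists (Ordinal ij); by exists i.
  have fi : injective f.
    move=> r r' frr'; have [i iE] := fP r; have [i' iE'] := fP r'.
    have : B _ i = B _ i' by apply: si; rewrite iE iE' frr'.
    move=> /(congr1 idx); rewrite !Bidx => /eqP; rewrite eqn_add2l => /eqP; exact: val_inj.
  by have := leq_card f fi; rewrite !card_ord ltnn.
set i := (j + r)%N in rP.
have ij2 : (i <= j.*2)%N by rewrite /i -addnn leq_add2l -ltnS.
have [Bi _ bad] := AP (p i, i); apply: bad.
have nu_inj := incr_inj nu_incr.
have ui : injective (nu \o s \o B i).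
  by apply: inj_comp => //; exact: inj_comp.
have [q qi qm] := sort_mono ui; exists q => //.
apply: (@eqv_le _ _ _ (C * C0)).
  by rewrite ltW// (lt_le_trans (truncnS_gt _))// ler_nat /i leq_addr.
apply: (eqv_trans (y := w \o (nu \o s \o B i \o q))) => //.
  exact: (eqv_reindex (inj_comp Bi qi) ws).
apply: asym => //; first exact: from_ord_mono.
  by move=> a; apply: leq_trans (nu_ge _ _ ij2) _; exact: (ltnW_homo nu_incr (rP (q a))).
by move=> a; rewrite /from_ord leq_addr.
Qed.

(* By [far_sets_good], q0 N rearranges the N terms from m0 on into the N terms
   from N on, which are asymptotically spreading.  Along U the order in which
   q0 N puts a given pair stabilizes, and on a Ramsey-homogeneous set the q0 N
   are either all increasing or all decreasing. *)
Lemma spreading_subsequence : exists2 m, incr m & exists2 C : R, 0 <= C & spreading C (w \o m).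
Proof.
have [m0 [C C1 good_far]] := far_sets_good.
have [U [Uu Uf]] := free_ultrafilter.
have /choice[q0 q0P] (N : nat) : exists q : nat -> nat,
    (forall i j, (i < N)%N -> (j < N)%N -> q i = q j -> i = j) /\ (forall i, (i < N)%N -> (q i < N)%N) /\
    (forall l (s : 'I_l -> nat), injective s -> (forall i, s i < N)%N ->
      eqv C (fun i => w (m0 + s i)%N) (fun i => w (N + q (s i))%N)).
  have [||p pi wp] := good_far N (@from_ord N m0).
  - exact: (mono_ord_inj (@from_ord_mono N m0)).
  - by move=> i; rewrite /from_ord leq_addr.
  have [p' pp' p'p] := injF_bij pi.
  exists (fun i => if insub i is Some o then val (p' o) else 0%N); split; last split.
  - move=> i j iN jN; rewrite !insubT /= => /val_inj/(can_inj p'p)/(congr1 val).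
    by [].
  - by move=> i iN; rewrite insubT /=; exact: ltn_ord.
  move=> l s si sN; pose g (i : 'I_l) := p' (Ordinal (sN i)).
  have gi : injective g.
    by move=> i j /(can_inj p'p)/(congr1 val)/si.
  have := eqv_reindex gi wp; congr eqv; apply/funext => i; rewrite /g /= ?p'p//.
  by rewrite (insubT (fun m => m < N)%N (sN i)).
have q0i N i j : (i < N)%N -> (j < N)%N -> q0 N i = q0 N j -> i = j.
  by have [h _] := q0P N; exact: h.
have q0N N i : (i < N)%N -> (q0 N i < N)%N by have [_ [h _]] := q0P N; exact: h.
have q0e N l (s : 'I_l -> nat) : injective s -> (forall i, s i < N)%N ->
      eqv C (fun i => w (m0 + s i)%N) (fun i => w (N + q0 N (s i))%N).
  by have [_ [_ h]] := q0P N; exact: h.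
pose prec i j := `[< U [set N | (q0 N i < q0 N j)%N] >].
have [|m mi mP] := @diagonal_ramsey U Uu Uf
  (fun s => prec (nth 0 s 0)%N (nth 0 s 1)%N : nat) (fun=> 2%N).
  by move=> s; case: prec.
have [t tP] := mP 2%N.
(* Homogeneity for pairs holds for entries that are at least 2. *)
pose m' i := m (i + 2)%N.
have m'i : incr m' by move=> i j ij; apply: mi; rewrite ltn_add2r.
have precE i j : (i < j)%N -> prec (m' i) (m' j) = t :> nat.
  move=> ij; rewrite -(tP [:: (i + 2)%N; (j + 2)%N])//=.
    by rewrite ltn_add2r ij.
  by rewrite !leq_addl.
have order (i j : nat) : (i < j)%N -> U [set N | if t == 1%N then (q0 N (m' i) < q0 N (m' j))%N
    else (q0 N (m' j) < q0 N (m' i))%N].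
  move=> ij; have := precE _ _ ij; rewrite /prec; case: asboolP => h.
    by move=> <- /=.
  move=> <- /=; have [//|h'] := in_ultra_setVsetC [set N | (q0 N (m' i) < q0 N (m' j))%N] Uu.
  apply: filterS2 h' (ultra_gt Uf (m' j)) => N /= /negP; rewrite -leqNgt leq_eqVlt => /orP[/eqP qE|//] jN.
  have mij := m'i _ _ ij; have := q0i _ _ _ jN (ltn_trans mij jN) qE => mE.
  by rewrite mE ltnn in mij.
exists (fun i => (m0 + m' i)%N); first by move=> i j ij; rewrite ltn_add2l m'i.
exists (C * C0 * (C0 * C)); first by rewrite !mulr_ge0.
have finite l (s : 'I_l -> nat) : mono s -> exists2 N, (l <= N)%N & (forall i, m' (s i) < N)%N /\
    forall i j : 'I_l, (i < j)%N -> if t == 1%N then (q0 N (m' (s i)) < q0 N (m' (s j)))%N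
    else (q0 N (m' (s j)) < q0 N (m' (s i)))%N.
  move=> ms.
  have h1 := @ultra_forall U Uu _ (enum 'I_l) (fun i => [set N | m' (s i) < N]%N) (fun i _ => ultra_gt Uf _).
  have h2 := @ultra_forall U Uu _ (enum {: 'I_l * 'I_l}) (fun p => [set N | (p.1 < p.2)%N ->
    if t == 1%N then (q0 N (m' (s p.1)) < q0 N (m' (s p.2)))%N
    else (q0 N (m' (s p.2)) < q0 N (m' (s p.1)))%N]).
  have [|N [[lN h1N] h2N]] := filter_ex (filterI (filterI (ultra_gt Uf l) h1) (h2 _)).
    move=> [i j] _ /=; have [ij|ij] := boolP (i < j)%N; last by apply: filterS filterT.
    by apply: filterS (order _ _ (ms _ _ ij)) => N h _.
  exists N; first exact: ltnW.
  split=> [i|i j ij]; first by apply: h1N; rewrite mem_enum.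
  by apply: (h2N (i, j)) => //; rewrite mem_enum.
(* In the decreasing case tuples are compared with a reversed interval. The reversal depends on the
   length only, so it cancels between two tuples. *)
pose target l : 'I_l -> 'I_l := if t == 1%N then id else @rev_ord l.
have main l (s : 'I_l -> nat) : mono s ->
    eqv (C * C0) (w \o (fun i => m0 + m' i)%N \o s) (w \o @from_ord l l \o @target l).
  move=> ms; have [N lN [sN so]] := finite _ _ ms.
  have ti : injective (@target l) by rewrite /target; case: ifP => _ //; exact: rev_ord_inj.
  apply: (eqv_trans (y := fun i => w (N + q0 N (m' (s i)))%N)) => //.
    apply: (q0e N l (m' \o s)) => //; apply: inj_comp (mono_ord_inj ms).
    exact: incr_inj.
  have tt : involutive (@target l).
    by rewrite /target; case: ifP => _ i //; exact: rev_ordK.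
  pose u i := (N + q0 N (m' (s (@target l i))))%N.
  have um : mono u.
    move=> i j ij; rewrite /u ltn_add2l /target; case: ifP => tE.
      by have := so _ _ ij; rewrite tE.
    have := so (rev_ord j) (rev_ord i); rewrite tE; apply => /=.
    by have := ltn_ord j; lia.
  have h := asym um (@from_ord_mono l l); have := eqv_reindex ti (h _ _).
  have -> : (w \o u) \o @target l = fun i => w (N + q0 N (m' (s i)))%N.
    by apply/funext => i; rewrite /u /= tt.
  apply => i; first by rewrite /u (leq_trans lN)// leq_addr.
  by rewrite /from_ord leq_addr.
move=> l s s' ms ms'; apply: eqv_trans (main _ _ ms) _; rewrite ?mulr_ge0//.
by rewrite (mulrC C0); apply: eqv_sym; exact: main.
Qed.

End Far.

End Spreading.

(** * The perturbed basis *)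

Section ShiftedBasis.
Variables (R : realType) (k : scalar_kind).
Local Notation K := (scalars R k).
Local Notation absv := (@absv R k).
Local Notation ofreal := (@ofreal R k).

Lemma fun_vsumD (I : choiceType) (V : normedModType K) (x : I -> V) (a b : I -> K^o) :
  fsupp a -> fsupp b -> vsum x (a + b) = vsum x a + vsum x b.
Proof. exact: vsumD. Qed.

Lemma fun_vsumB (I : choiceType) (V : normedModType K) (x : I -> V) (a b : I -> K^o) :
  fsupp a -> fsupp b -> vsum x (a - b) = vsum x a - vsum x b.
Proof. exact: vsumB. Qed.

Lemma fun_fsuppD (I : choiceType) (a b : I -> K^o) : fsupp a -> fsupp b -> fsupp (a + b : I -> K^o).
Proof. exact: fsuppD. Qed.

Lemma fun_fsuppB (I : choiceType) (a b : I -> K^o) : fsupp a -> fsupp b -> fsupp (a - b : I -> K^o).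
Proof. exact: fsuppB. Qed.

Lemma fsupp_decomp (I : choiceType) (a : I -> K^o) s : supp_in s a ->
  a = \sum_(i <- s) a i *: (dlt i : I -> K^o).
Proof.
move=> [us sa]; apply/funext => j; rewrite fct_sumE.
have scE i : (a i *: (dlt i : I -> K^o)) j = a i * (j == i)%:R by [].
rewrite (eq_bigr _ (fun i _ => scE i)).
have [js|js] := boolP (j \in s).
  rewrite (bigD1_seq j)//= big1 ?addr0 ?eqxx ?mulr1//.
  by move=> i ij; rewrite eq_sym (negbTE ij) mulr0.
rewrite big_seq big1 ?sa// => i is_.
by case: eqP => [ji|_]; [move: js; rewrite ji is_|rewrite mulr0].
Qed.

Lemma linear_vsum (I J : choiceType) (V : normedModType K) (x : J -> V)
    (F : {linear (I -> K^o) -> (J -> K^o)}) (a : I -> K^o) :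
  (forall i, fsupp (F (dlt i) : J -> K^o)) -> fsupp a ->
  fsupp (F a : J -> K^o) /\ vsum x (F a) = vsum (fun i => vsum x (F (dlt i))) a.
Proof.
move=> fF [s sa]; rewrite [in F a](fsupp_decomp sa) linear_sum (vsumE _ sa).
elim: s {sa} => [|i s [fs IH]]; first by rewrite !big_nil; split; [exact: fsupp0|exact: vsum0].
rewrite !big_cons linearZ /=; split.
  by apply: fun_fsuppD => //; exact: fsuppZ.
by rewrite fun_vsumD// ?IH; [congr (_ + _); exact: vsumZ|exact: fsuppZ].
Qed.

(** The perturbed basis is naturally indexed by [J + nat], while bases are sequences. *)
Lemma countable_sum_bij (J : countType) : exists f : nat -> J + nat, bijective f.
Proof.
have : ([set: J + nat] #= [set: nat])%card.
  apply: eq_card_nat; first exact: countableP.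
  move=> /(sub_finite_set (@subsetT _ (inr @` [set: nat]))).
  rewrite (eq_finite_set (inj_card_eq _)); first exact: infinite_nat.
  by move=> i j _ _ [].
move=> /card_set_bijP[f]; rewrite setTT_bijective => -[g fg gf].
by exists g; exists f.
Qed.

(* T = 1 - E A + E copy_up A is an isomorphism onto a complement of the span of
   the vectors E (dlt (j, 0)), so that these and the images T (dlt i) form an
   unconditional basis of the span of z, equivalent to z by uniqueness. *)
Section Abstract.
Variables (X : completeNormedModType K) (Y : set X) (z : nat -> X) (D : R).
Hypotheses (bz : normalized_unconditional_basis Y z) (uz : uncond D z)
  (z0 : forall i, z i != 0) (zY : closed_span z = Y)
  (Yu : unique_normalized_unconditional_basis Y).

Local Notation N a := (rn (vsum z a)).

(** [E] synthesizes the family u_p = E (dlt p), in coordinates along [z], and [A] is a left inverse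
    that reads off coefficients, so E A is the projection on the span of the family. The bounds
    required below are those of this projection, of unconditionality, and of both shifts of
    copies. *)
Variables (J : countType) (A : {linear (nat -> K^o) -> (J * nat -> K^o)})
  (E : {linear (J * nat -> K^o) -> (nat -> K^o)}) (M : R).

Definition copy_up (b : J * nat -> K^o) : J * nat -> K^o :=
  fun p => if p.2 is c.+1 then b (p.1, c) else 0.
Definition copy_down (b : J * nat -> K^o) : J * nat -> K^o := fun p => b (p.1, p.2.+1).
Definition first_copy (b : J * nat -> K^o) : J * nat -> K^o :=
  fun p => if p.2 == 0%N then b p else 0.

Hypotheses (AE : forall b, A (E b) = b) (M0 : 0 <= M)
  (A_fin : forall i, fsupp (A (dlt i) : J * nat -> K))
  (E_fin : forall p, fsupp (E (dlt p) : nat -> K))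
  (EA_bound : forall a, fsupp a -> N (E (A a)) <= M * N a)
  (E_uncond : forall b b', fsupp b -> (forall p, absv (b' p) <= absv (b p)) -> N (E b') <= M * N (E b))
  (up_bound : forall b, fsupp b -> N (E (copy_up b)) <= M * N (E b))
  (down_bound : forall b, fsupp b -> N (E (copy_down b)) <= M * N (E b)).

Let up_lin : linear copy_up.
Proof.
move=> c b b'; apply/funext => -[j [|i]] //.
by rewrite -[LHS]/0 -[RHS]/(c * 0 + 0 : K) mulr0 addr0.
Qed.

Let down_lin : linear copy_down. Proof. by move=> c b b'. Qed.

Let first_lin : linear first_copy.
Proof.
move=> c b b'; apply/funext => -[j [|i]] //.
by rewrite -[LHS]/0 -[RHS]/(c * 0 + 0 : K) mulr0 addr0.
Qed.

HB.instance Definition _ := GRing.isLinear.Build K _ _ _ copy_up up_lin.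
HB.instance Definition _ := GRing.isLinear.Build K _ _ _ copy_down down_lin.
HB.instance Definition _ := GRing.isLinear.Build K _ _ _ first_copy first_lin.

Let down_up b : copy_down (copy_up b) = b. Proof. by apply/funext => -[]. Qed.
Let first_up b : first_copy (copy_up b) = 0. Proof. by apply/funext => -[j [|c]]. Qed.
Let up_down b : copy_up (copy_down b) = b - first_copy b.
Proof.
apply/funext => -[j [|c]].
  by rewrite -[LHS]/0 -[RHS]/(b (j, 0%N) - b (j, 0%N)) subrr.
by rewrite -[LHS]/(b (j, c.+1)) -[RHS]/(b (j, c.+1) - 0) subr0.
Qed.

(** The identity on the kernel of [A] and a shift of copies on the range of [E]. [untwist] shifts
    back; it is a left inverse, and on the other side only the copies of index 0 are lost. *)
Definition twist (a : nat -> K^o) : nat -> K^o := a - E (A a) + E (copy_up (A a)).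
Definition untwist (a : nat -> K^o) : nat -> K^o := a - E (A a) + E (copy_down (A a)).

Let twist_lin : linear twist.
Proof.
move=> c a b; rewrite /twist !linearP /= scalerDr scalerBr.
by rewrite scalerN [X in X + _ = _]addrACA [LHS]addrACA.
Qed.

HB.instance Definition _ := GRing.isLinear.Build K _ _ _ twist twist_lin.

Let A_twist a : A (twist a) = copy_up (A a).
Proof. by rewrite /twist linearD linearB /= !AE subrr add0r. Qed.

Let untwist_twist a : untwist (twist a) = a.
Proof.
by rewrite /untwist A_twist down_up /twist addrK subrK.
Qed.

Let twist_untwist a : twist (untwist a) = a - E (first_copy (A a)).
Proof.
have Au : A (untwist a) = copy_down (A a) by rewrite /untwist linearD linearB /= !AE subrr add0r.
by rewrite /twist Au up_down /untwist addrK linearB /= addrA subrK.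
Qed.

(** Synthesis along the perturbed basis, expressed in coordinates along [z]. *)
Definition combine (a : J + nat -> K^o) : nat -> K^o :=
  E (fun p => if p.2 == 0%N then a (inl p.1) else 0) + twist (fun i => a (inr i)).

Let pick_copy (a : J + nat -> K^o) : J * nat -> K^o := fun p => if p.2 == 0%N then a (inl p.1) else 0.

Let pick_lin : linear pick_copy.
Proof.
move=> c b b'; apply/funext => -[j [|i]] //.
by rewrite -[LHS]/0 -[RHS]/(c * 0 + 0 : K) mulr0 addr0.
Qed.

HB.instance Definition _ := GRing.isLinear.Build K _ _ _ pick_copy pick_lin.

Let combine_lin : linear combine.
Proof.
move=> c a b; rewrite /combine -!/(pick_copy _) linearP /=.
rewrite (_ : (fun i => (c *: a + b) (inr i)) = c *: ((fun i => a (inr i)) : nat -> K^o) + (fun i => b (inr i)))//.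
have -> := twist_lin c (fun i => a (inr i)) (fun i => b (inr i)).
by rewrite linearP /= [in RHS]scalerDr [LHS]addrACA.
Qed.

HB.instance Definition _ := GRing.isLinear.Build K _ _ _ combine combine_lin.

Let A_fs a : fsupp a -> fsupp (A a : J * nat -> K).
Proof.
move=> [s sa]; rewrite (fsupp_decomp sa) linear_sum; elim: s {sa} => [|i s IH].
  by rewrite big_nil; exact: fsupp0.
by rewrite big_cons linearZ /=; apply: fun_fsuppD => //; exact: fsuppZ.
Qed.

Let E_fs b : fsupp b -> fsupp (E b : nat -> K).
Proof.
move=> [s sa]; rewrite (fsupp_decomp sa) linear_sum; elim: s {sa} => [|i s IH].
  by rewrite big_nil; exact: fsupp0.
by rewrite big_cons linearZ /=; apply: fun_fsuppD => //; exact: fsuppZ.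
Qed.

Let up_fs b : fsupp b -> fsupp (copy_up b : J * nat -> K).
Proof.
move=> [s [us sb]]; exists [seq (p.1, p.2.+1) | p <- s]; split.
  by rewrite map_inj_uniq// => -[i c] [j d] [-> ->].
move=> [j [|c]] //= njs; rewrite /copy_up /=; apply: sb.
by apply: contra njs => js; apply/mapP; exists (j, c).
Qed.

Let down_fs b : fsupp b -> fsupp (copy_down b : J * nat -> K).
Proof.
move=> [s [us sb]]; exists (undup [seq (p.1, p.2.-1) | p <- s]); split; first exact: undup_uniq.
move=> [j c]; rewrite mem_undup => njs; rewrite /copy_down /=; apply: sb.
by apply: contra njs => js; apply/mapP; exists (j, c.+1).
Qed.

Let twist_fs a : fsupp a -> fsupp (twist a : nat -> K).
Proof.
move=> fa; apply: fun_fsuppD; last by apply: E_fs; apply: up_fs; exact: A_fs.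
by apply: fun_fsuppB => //; apply: E_fs; exact: A_fs.
Qed.

Let untwist_fs a : fsupp a -> fsupp (untwist a : nat -> K).
Proof.
move=> fa; apply: fun_fsuppD; last by apply: E_fs; apply: down_fs; exact: A_fs.
by apply: fun_fsuppB => //; apply: E_fs; exact: A_fs.
Qed.

Let N_D a b : fsupp a -> fsupp b -> N (a + b : nat -> K^o) <= N a + N b.
Proof. by move=> fa fb; rewrite fun_vsumD// rnD. Qed.

Let N_B a b : fsupp a -> fsupp b -> N (a - b : nat -> K^o) <= N a + N b.
Proof. by move=> fa fb; rewrite fun_vsumB// (le_trans (rnD _ _))// rnN. Qed.

Let M1 := 1 + M + M * M.

Let M1_ge0 : 0 <= M1.
Proof. by rewrite !addr_ge0 ?mulr_ge0. Qed.

Let twist_bound a : fsupp a -> N (twist a) <= M1 * N a.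
Proof.
move=> fa; have fA := A_fs fa; have fEA := E_fs fA; have fEu := E_fs (up_fs fA).
rewrite /M1 !mulrDl mul1r (le_trans (N_D (fun_fsuppB fa fEA) fEu))// lerD//.
  by rewrite (le_trans (N_B fa fEA))// lerD2l EA_bound.
by rewrite (le_trans (up_bound fA))// -mulrA ler_wpM2l// EA_bound.
Qed.

Let untwist_bound a : fsupp a -> N (untwist a) <= M1 * N a.
Proof.
move=> fa; have fA := A_fs fa; have fEA := E_fs fA; have fEu := E_fs (down_fs fA).
rewrite /M1 !mulrDl mul1r (le_trans (N_D (fun_fsuppB fa fEA) fEu))// lerD//.
  by rewrite (le_trans (N_B fa fEA))// lerD2l EA_bound.
by rewrite (le_trans (down_bound fA))// -mulrA ler_wpM2l// EA_bound.
Qed.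

Let basis_vector (p : J + nat) : X := vsum z (combine (dlt p)).

Let inr_part (a : J + nat -> K^o) : nat -> K^o := fun i => a (inr i).

Let inr_fs (a : J + nat -> K^o) : fsupp a -> fsupp (inr_part a : nat -> K).
Proof. by move=> fa; apply: (@comp_fsupp _ _ _ _ inr) => // i j []. Qed.

Let pick_fs (a : J + nat -> K^o) : fsupp a -> fsupp (pick_copy a : J * nat -> K).
Proof.
move=> [s [us sa]].
exists (undup [seq (j, 0%N) | j <- pmap (fun p => if p is inl j then Some j else None) s]).
split; first exact: undup_uniq.
move=> [j [|c]] //; rewrite mem_undup /pick_copy /= => nj; apply: sa.
apply: contra nj => js; apply/mapP; exists j => //; rewrite mem_pmap.
by apply/mapP; exists (inl j).
Qed.

Let combine_fs (a : J + nat -> K^o) : fsupp a -> fsupp (combine a : nat -> K).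
Proof.
move=> fa; apply: fun_fsuppD; first by apply: E_fs; exact: pick_fs.
exact: (twist_fs (inr_fs fa)).
Qed.

Let basis_vector_vsum (a : J + nat -> K^o) : fsupp a -> vsum basis_vector a = vsum z (combine a).
Proof.
by move=> fa; rewrite -(proj2 (@linear_vsum _ _ _ z combine a _ fa))// => p; apply: combine_fs; exact: fsupp_dlt.
Qed.

(** Both kinds of coefficients are recovered boundedly: the twisted part has no copy of index 0, so
    [first_copy] after [A] isolates the rest; what remains after subtraction is undone by
    [untwist]. *)
Let combine_lower (a : J + nat -> K^o) : fsupp a ->
  N (E (pick_copy a)) <= M * M * N (combine a) /\
  N (inr_part a) <= M1 * (1 + M * M) * N (combine a).
Proof.
move=> fa; have fc := combine_fs fa; have fp := pick_fs fa; have fi := inr_fs fa.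
have pE : pick_copy a = first_copy (A (combine a)).
  rewrite /combine linearD /= AE A_twist linearD /= first_up addr0.
  by apply/funext => -[j [|c]].
have h1 : N (E (pick_copy a)) <= M * M * N (combine a).
  rewrite pE; apply: (le_trans (E_uncond (A_fs fc) _)).
    by move=> p; rewrite /first_copy; case: ifP => // _; rewrite absv0 absv_ge0.
  by rewrite -mulrA ler_wpM2l// EA_bound.
split=> //; rewrite -[inr_part a]untwist_twist.
apply: (le_trans (untwist_bound (twist_fs fi))); rewrite -mulrA ler_wpM2l//.
have -> : twist (inr_part a) = combine a - E (pick_copy a).
  by rewrite /combine addrC addKr.
by rewrite (le_trans (N_B fc (E_fs fp)))// mulrDl mul1r lerD2l.
Qed.

Let basis_uncond : exists2 D', 0 <= D' & uncond D' basis_vector.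
Proof.
have D0 : 0 <= D by apply: le_trans (uncond_ge1 (z0 0%N) uz).
exists (M * (M * M) + M1 * (D * (M1 * (1 + M * M)))).
  by rewrite addr_ge0// !mulr_ge0// addr_ge0// mulr_ge0.
move=> a b fa ba; have fb := fsupp_le fa ba; rewrite !basis_vector_vsum//.
have [h1 h2] := combine_lower fa.
have fE := E_fs (pick_fs fb); have ft := twist_fs (inr_fs fb).
rewrite (le_trans (N_D fE ft))// mulrDl lerD//.
  rewrite (le_trans (E_uncond (pick_fs fa) _))//.
    by move=> [j [|c]]; [exact: ba|rewrite /pick_copy /= absv0].
  by rewrite -!mulrA ler_wpM2l// mulrA.
rewrite (le_trans (twist_bound (inr_fs fb)))// -!mulrA ler_wpM2l//.
rewrite (le_trans (uz (inr_fs fa) _))//; first by move=> i; exact: ba.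
by rewrite ler_wpM2l// mulrA.
Qed.

Let N_eq0 a : fsupp a -> N a = 0 -> a = 0.
Proof.
move=> fa Na; apply/funext => i; apply: absv0_eq0; apply/eqP; rewrite eq_le absv_ge0 andbT.
have := coord_le i uz fa; rewrite Na mulr0.
by rewrite pmulr_lle0 // rn_gt0.
Qed.

Let basis_nonzero p : basis_vector p != 0.
Proof.
apply/eqP => p0; have fd := @fsupp_dlt R k _ p.
have [h1 h2] := combine_lower fd.
have c0 : N (combine (dlt p)) = 0 by rewrite -/(basis_vector p) p0 rn0.
move: h1 h2; rewrite c0 !mulr0 => h1 h2.
have {}h1 : N (E (pick_copy (dlt p))) = 0 by apply/eqP; rewrite eq_le h1 rn_ge0.
have {}h2 : N (inr_part (dlt p)) = 0 by apply/eqP; rewrite eq_le h2 rn_ge0.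
have e1 : pick_copy (dlt p) = 0 by rewrite -[LHS]AE (N_eq0 (E_fs (pick_fs fd)) h1) linear0.
have e2 := N_eq0 (inr_fs fd) h2.
case: p {p0 c0 h1 h2 fd} e1 e2 => [j|i] e1 e2.
  have := congr1 (fun f => f (j, 0%N)) e1; rewrite /pick_copy /= /dlt eqxx.
  by move=> /eqP; rewrite oner_eq0.
have := congr1 (fun f => f i) e2; rewrite /inr_part /= /dlt eqxx.
by move=> /eqP; rewrite oner_eq0.
Qed.

Let basis_spans a : fsupp a -> exists2 a' : J + nat -> K, fsupp a' & vsum basis_vector a' = vsum z a.
Proof.
move=> fa; pose a' (p : J + nat) : K^o := match p with inl j => A a (j, 0%N) | inr i => untwist a i end.
have fa' : fsupp a'.
  have [s [us sA]] := A_fs fa; have [t [ut sU]] := untwist_fs fa.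
  exists (undup ([seq inl p.1 | p <- s] ++ [seq inr i | i <- t])); split; first exact: undup_uniq.
  move=> p; rewrite mem_undup mem_cat negb_or => /andP[ns nt].
  case: p ns nt => [j|i] ns nt /=; [apply: sA|apply: sU].
    by apply: contra ns => js; apply/mapP; exists (j, 0%N).
  by apply: contra nt => js; apply/mapP; exists i.
exists a' => //; rewrite basis_vector_vsum//; congr vsum.
rewrite /combine -[RHS](subrK (E (first_copy (A a)))) addrC -twist_untwist; congr (_ + E _).
by apply/funext => -[j [|c]].
Qed.

(** Uniqueness matches the whole perturbed basis with [z]; only the vectors of index [inl j] are
    kept. *)
Lemma shifted_basis_embeds : exists2 r : J -> nat, injective r & exists2 C : R, 0 <= C &
  eqv C (z \o r) (unitize (fun j => vsum z (E (dlt (j, 0%N))))).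
Proof.
have [f fb] := countable_sum_bij J.
have [g fg gf] := fb; have fi := can_inj fg; have gi := can_inj gf.
have [D' D'0 ub] := basis_uncond.
have uw := uncond_reindex fi ub.
have [|p pb [C C0 zw]] := span_basis_eqv Yu bz uw (fun i => basis_nonzero (f i)).
  rewrite -zY; apply/seteqP; split => v /closed_spanP[B fB Bv]; apply/closed_spanP.
    exists (fun n => combine (push f (B n))) => [n|].
      by apply: combine_fs; exact: push_fsupp.
    by apply: rlim_eq Bv => n; rewrite -basis_vector_vsum ?vsum_push//; exact: push_fsupp.
  have /choice[B' B'P] (n : nat) : exists a', fsupp a' /\ vsum basis_vector a' = vsum z (B n).
    by have [a' ? ?] := basis_spans (fB n); exists a'.
  exists (fun n => B' n \o f) => [n|]; first by apply: comp_fsupp => //; have [] := B'P n.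
  apply: rlim_eq Bv => n; have [fB' <-] := B'P n.
  have -> : B' n = push f (B' n \o f).
    apply/funext => q; rewrite -(gf q) push_in//.
  by rewrite vsum_push// /comp; [congr vsum; apply/funext => i; rewrite push_in|exact: comp_fsupp].
have [p' pp' p'p] := pb.
exists (fun j => p' (g (inl j))); first by move=> j j' /(can_inj p'p)/gi[].
exists C => //; have := eqv_reindex (f := fun j => p' (g (inl j))) _ zw.
have -> : (unitize (basis_vector \o f) \o p) \o (fun j => p' (g (inl j))) =
    unitize (fun j => vsum z (E (dlt (j, 0%N)))).
  apply/funext => j; rewrite /unitize /= p'p gf /basis_vector.
  suff -> : combine (dlt (inl j)) = E (dlt (j, 0%N)) by [].
  rewrite /combine (_ : (fun i => _) = (0 : nat -> K^o)); last by apply/funext.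
  rewrite linear0 addr0; congr (E _); apply/funext => -[j' [|c]] //=.
    by rewrite /dlt /= (inj_eq (@inl_inj _ _)) xpair_eqE eqxx andbT.
  by rewrite /dlt xpair_eqE andbF.
by apply; move=> j j' /(can_inj p'p)/gi[].
Qed.

End Abstract.

End ShiftedBasis.

(** * Block averages and the power law *)

Section Blocks.
Variables (R : realType) (k : scalar_kind).
Local Notation K := (scalars R k).
Local Notation absv := (@absv R k).
Local Notation ofreal := (@ofreal R k).

Lemma push_comp_le (I J : choiceType) (f : J -> I) (a : I -> K) i : injective f ->
  absv (push f (a \o f) i) <= absv (a i).
Proof.
move=> fi; have [[j <-]|h] := pselect (exists j, f j = i); first by rewrite push_in.
by rewrite push_out// absv0 absv_ge0.
Qed.

Lemma push_linear (I J : choiceType) (f : J -> I) : injective f ->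
  linear (push f : (J -> K^o) -> (I -> K^o)).
Proof.
move=> fi c a b; apply/funext => i.
have [[j <-]|h] := pselect (exists j, f j = i).
  by rewrite push_in// -[RHS]/(c * push f a (f j) + push f b (f j)) !push_in.
by rewrite push_out// -[RHS]/(c * push f a i + push f b i) !push_out// mulr0 addr0.
Qed.

Lemma vsum_comp (I J : choiceType) (V : normedModType K) (D : R) (x : I -> V) (f : J -> I) (a : I -> K) :
  injective f -> uncond D x -> fsupp a -> rn (vsum (x \o f) (a \o f)) <= D * rn (vsum x a).
Proof.
move=> fi ux fa; rewrite -vsum_push//; last exact: comp_fsupp.
by apply: ux => // i; exact: push_comp_le.
Qed.

Section Spread.
Variables (V : normedModType K) (z : nat -> V) (C : R).
Hypothesis sz : spreading C z.

Lemma spread_ord l (u u' : 'I_l -> nat) : injective u ->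
  (forall i j, (u i < u j)%N -> (u' i < u' j)%N) -> eqv C (z \o u) (z \o u').
Proof.
move=> ui uu'; have [p pi pm] := sort_mono ui; have [q pq qp] := injF_bij pi.
have pm' : mono (u' \o p) by move=> i j ij; apply: uu'; exact: pm.
have := eqv_reindex (can_inj qp) (sz pm pm').
by congr eqv; apply/funext => i /=; rewrite qp.
Qed.

Lemma spread_eqv (I : choiceType) (p p' : I -> nat) : injective p -> injective p' ->
  (forall i j, (p i < p j)%N -> (p' i < p' j)%N) -> eqv C (z \o p) (z \o p').
Proof.
move=> pi p'i pp'.
suff main a : fsupp a -> rn (vsum (z \o p) a) <= C * rn (vsum (z \o p') a) /\
    rn (vsum (z \o p') a) <= C * rn (vsum (z \o p) a).
  by split=> a /main[].
move=> [s [us sa]].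
case: s us sa => [|x0 s] us sa.
  by rewrite !(@vsumE _ _ _ _ _ _ [::])// !big_nil rn0 mulr0.
set t := x0 :: s in us sa; pose e (i : 'I_(size t)) := nth x0 t i.
have ei : injective e.
  by move=> i j /eqP; rewrite nth_uniq// => /eqP/val_inj.
have E (q : I -> nat) : vsum (z \o q) a = vsum (z \o (q \o e)) (a \o e).
  rewrite (@vsumE _ _ _ _ _ _ t)// vsum_ord (big_nth x0) big_mkord.
  by apply: eq_bigr => i _.
have [h1 h2] := spread_ord (inj_comp pi ei) (fun i j => pp' (e i) (e j)).
by rewrite !E; split; [apply: h1|apply: h2]; exact: fsupp_ord.
Qed.

(** The fundamental function of the basis, written lam in the overview; under spreading, other sets
    of n terms give comparable values. *)
Definition fundamental n : R := rn (\sum_(i < n) z i).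

Lemma spread_sum (I : finType) (p : I -> nat) : injective p ->
  rn (\sum_x z (p x)) <= C * fundamental #|I| /\ fundamental #|I| <= C * rn (\sum_x z (p x)).
Proof.
move=> pi; have ui : injective (p \o (@enum_val I predT)) by apply: inj_comp => //; exact: enum_val_inj.
have [q qi qm] := sort_mono ui.
have idm : mono (fun i : 'I_#|I| => val i) by [].
have [h1 h2] := sz qm idm.
have E1 : vsum (z \o ((p \o @enum_val I predT) \o q)) (fun=> 1) = \sum_x z (p x).
  rewrite vsum_ord (big_enum_val (A := predT) (fun x => z (p x))) [RHS](reindex_inj qi) /=.
  by apply: eq_bigr => i _; rewrite scale1r.
have E2 : vsum (z \o (fun i : 'I_#|I| => val i)) (fun=> 1) = \sum_(i < #|I|) z i.
  by rewrite vsum_ord; apply: eq_bigr => i _; rewrite scale1r.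
by rewrite /fundamental -E1 -E2; split; [apply: h1|apply: h2]; exact: fsupp_ord.
Qed.

End Spread.

(* Block (t, c) sits at level q = 2^c (2t+1) - 1, so that c -> c+1 is the
   increasing map q -> 2q+1 on levels: passing to the next copy preserves the
   order of positions, as spreading requires. *)
Section Cells.
Variable len : nat -> nat.

Definition cell := {tc : nat * nat & 'I_(len tc.1)}.
Definition level (tc : nat * nat) := (2 ^ tc.2 * tc.1.*2.+1).-1.
(** A block (t, c) at level [q] has t at most [q], so it fits in this room; the successor keeps
    [start] strictly increasing. *)
Definition room q := (\sum_(t < q.+1) len t).+1.
Definition start q := \sum_(q' < q) room q'.
Definition pos (x : cell) : nat := (start (level (tag x)) + tagged x)%N.
Definition next_copy (x : cell) : cell :=
  existT (fun tc : nat * nat => 'I_(len tc.1)) ((tag x).1, (tag x).2.+1) (tagged x).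

Lemma levelS t c : level (t, c.+1) = (level (t, c)).*2.+1.
Proof.
rewrite /level /= expnS -mulnA; set m := (2 ^ c * t.*2.+1)%N.
have : (0 < m)%N by rewrite muln_gt0 expn_gt0.
by case: m => // m _; rewrite mul2n doubleS.
Qed.

Lemma level0 t : level (t, 0%N) = t.*2.
Proof. by rewrite /level expn0 mul1n. Qed.

Lemma level_ge tc : (tc.1 <= level tc)%N.
Proof.
case: tc => t c; elim: c => [|c IH]; last by rewrite levelS (leq_trans IH)//; lia.
  by rewrite level0 -addnn leq_addr.
Qed.

Lemma level_inj : injective level.
Proof.
have par t c : odd (level (t, c)) = (c != 0%N).
  case: c => [|c]; last by rewrite levelS /= odd_double.
  by rewrite level0 odd_double.
move=> [t c] [t' c']; elim: c c' => [|c IH] [|c'] E.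
- by move: E; rewrite !level0 => /double_inj ->.
- by have := par t 0%N; rewrite E par.
- by have := par t' 0%N; rewrite -E par.
by move: E; rewrite !levelS => -[/double_inj/IH[-> ->]].
Qed.

Lemma startS q : start q.+1 = (start q + room q)%N.
Proof. by rewrite /start big_ord_recr. Qed.

Lemma start_lt q : (start q < start q.+1)%N.
Proof. by rewrite startS -addn1 leq_add2l. Qed.

Lemma start_le q q' : (q <= q')%N -> (start q <= start q')%N.
Proof.
move=> /subnK <-; elim: (q' - q)%N => // d IH.
by rewrite addSn (leq_trans IH)// ltnW// start_lt.
Qed.

Lemma pos_bounds x : (start (level (tag x)) <= pos x < start (level (tag x)).+1)%N.
Proof.
rewrite /pos leq_addr startS ltn_add2l /room ltnS /=.
case: x => [[t c] s] /=; have := level_ge (t, c); rewrite /= -ltnS => h.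
by rewrite (bigD1 (Ordinal h))//= ltnW// ltn_addr.
Qed.

Lemma pos_lt x y : (pos x < pos y)%N =
  (level (tag x) < level (tag y))%N || (tag x == tag y) && (tagged x < tagged y)%N.
Proof.
have /andP[x1 x2] := pos_bounds x; have /andP[y1 y2] := pos_bounds y.
have [h|h|h] := ltngtP (level (tag x)) (level (tag y)) => /=.
- by rewrite (leq_trans x2)// (leq_trans (start_le h)).
- have -> : tag x == tag y = false by apply/negP => /eqP xy; rewrite xy ltnn in h.
  by apply/negP => h'; have := leq_trans y2 (leq_trans (start_le h) x1); rewrite ltnNge ltnW.
by rewrite /pos h ltn_add2l (introT eqP (level_inj h)).
Qed.

Lemma pos_inj : injective pos.
Proof.
move=> x y xy; have := pos_lt x y; have := pos_lt y x; rewrite xy ltnn.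
have [//|//|/level_inj h] := ltngtP (level (tag x)) (level (tag y)).
case: x y xy h => [tc s] [tc' s'] /= xy h; subst tc'; rewrite eqxx /=.
have [//|//|/val_inj -> //] := ltngtP s s'.
Qed.

Lemma next_copy_inj : injective next_copy.
Proof.
move=> [[t c] s] [[t' c'] s'] E; have [e1 e2] := congr1 tag E; subst t' c'.
congr existT; apply: val_inj.
by have := congr1 (fun x : cell => nat_of_ord (tagged x)) E.
Qed.

Lemma pos_next_copy x y : (pos x < pos y)%N -> (pos (next_copy x) < pos (next_copy y))%N.
Proof.
rewrite !pos_lt; case: x y => [[t c] s] [[t' c'] s'] /=; rewrite !levelS ltnS ltn_double.
case/orP => [->//|/andP[/eqP[tt' cc'] ->]].
by rewrite andbT xpair_eqE tt' cc' !eqxx orbT.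
Qed.

End Cells.

(** * The averaging projection on blocks *)

Section BlockAverages.
Variables (X : completeNormedModType K) (Y : set X) (z : nat -> X) (C D : R).
Hypotheses (bz : normalized_unconditional_basis Y z) (uz : uncond D z) (zY : closed_span z = Y)
  (Yu : unique_normalized_unconditional_basis Y) (C0 : 0 <= C) (sz : spreading C z).

Let nz i : rn (z i) = 1. Proof. exact: (normalized_rn bz.1). Qed.
Let z0 i : z i != 0.
Proof. by apply/eqP => zi; have := nz i; rewrite zi rn0 => /eqP; rewrite eq_sym oner_eq0. Qed.
Let D1 : 1 <= D. Proof. exact: uncond_ge1 (z0 0%N) uz. Qed.
Let D0 : 0 <= D. Proof. exact: le_trans D1. Qed.

Variable len : nat -> nat.
Hypothesis len_gt0 : forall t, (0 < len t)%N.

Local Notation cell := (cell len).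
Local Notation pos := (@pos len).
Local Notation Cell tc s := (existT (fun p : nat * nat => 'I_(len p.1)) tc s : cell).

Let zp : cell -> X := z \o pos.

Definition block_average (a : nat -> K^o) : nat * nat -> K^o :=
  fun tc => (len tc.1)%:R^-1 * \sum_(s < len tc.1) a (pos (Cell tc s)).

Definition block_constant (b : nat * nat -> K^o) : nat -> K^o := push pos (b \o tag).

Lemma block_average_linear : linear block_average.
Proof.
move=> c a b; apply/funext => tc.
rewrite -[RHS]/(c * block_average a tc + block_average b tc) /block_average.
rewrite [X in _ = X + _]mulrCA -mulrDr; congr (_ * _).
by rewrite mulr_sumr -big_split.
Qed.

Lemma block_constant_linear : linear block_constant.
Proof.
move=> c a b; rewrite /block_constant -(push_linear (@pos_inj len)); congr push.
Qed.

HB.instance Definition _ := GRing.isLinear.Build K _ _ _ block_average block_average_linear.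
HB.instance Definition _ := GRing.isLinear.Build K _ _ _ block_constant block_constant_linear.

Let lenK t : (len t)%:R != 0 :> K. Proof. by rewrite pnatr_eq0 -lt0n. Qed.

Lemma block_averageK b : block_average (block_constant b) = b.
Proof.
apply/funext => tc; rewrite /block_average /block_constant.
rewrite (eq_bigr (fun=> b tc)); last first.
  by move=> s _; rewrite push_in//; exact: pos_inj.
by rewrite sumr_const card_ord -[RHS](mulKf (lenK tc.1)) [in RHS]mulr_natl.
Qed.

Let tag_fs (b : nat * nat -> K) : fsupp b -> fsupp (b \o tag : cell -> K).
Proof.
move=> [s [us sb]].
exists (undup (flatten [seq [seq Cell tc s' | s' <- enum 'I_(len tc.1)] | tc <- s])).
split; first exact: undup_uniq.
move=> [tc s'] /=; rewrite mem_undup => ns; apply: sb; apply: contra ns => tcs.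
apply/flatten_mapP; exists tc => //; apply/mapP; exists s' => //; exact: mem_enum.
Qed.

Let block_constant_vsum b : fsupp b -> vsum z (block_constant b) = vsum zp (b \o tag).
Proof. by move=> fb; rewrite vsum_push//; [exact: pos_inj|exact: tag_fs]. Qed.

Let up_tag b : copy_up b \o tag = push (@next_copy len) (b \o tag : cell -> K).
Proof.
apply/funext => -[[t [|c]] s].
  rewrite push_out// => -[[[t' c'] s']] /(congr1 tag).
  by move=> /(congr1 snd).
have -> : Cell (t, c.+1) s = next_copy (Cell (t, c) s) by [].
by rewrite push_in//; exact: next_copy_inj.
Qed.

Let up_block_bound b : fsupp b -> rn (vsum z (block_constant (copy_up b))) <= C * rn (vsum z (block_constant b)).
Proof.
move=> fb; have ft := tag_fs fb.
have e : eqv C (zp \o @next_copy len) zp.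
  apply: eqv_sym; apply: (spread_eqv sz (@pos_inj len)).
    exact: inj_comp (@pos_inj len) (@next_copy_inj len).
  exact: pos_next_copy.
rewrite [X in _ <= _ * rn X]block_constant_vsum// /block_constant vsum_push.
- by rewrite up_tag vsum_push//; [exact: (proj1 e)|exact: next_copy_inj].
- exact: pos_inj.
- by rewrite up_tag; apply: push_fsupp => //; exact: next_copy_inj.
Qed.

Let down_block_bound b : fsupp b ->
  rn (vsum z (block_constant (copy_down b))) <= C * D * rn (vsum z (block_constant b)).
Proof.
move=> fb; have ft := tag_fs fb.
have e : eqv C (zp \o @next_copy len) zp.
  apply: eqv_sym; apply: (spread_eqv sz (@pos_inj len)).
    exact: inj_comp (@pos_inj len) (@next_copy_inj len).
  exact: pos_next_copy.
have dE : copy_down b \o tag = (b \o tag) \o (@next_copy len) by apply/funext => -[[t c] s].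
have fd : fsupp ((b \o tag) \o (@next_copy len)) by apply: comp_fsupp => //; exact: next_copy_inj.
rewrite [X in _ <= _ * rn X]block_constant_vsum// /block_constant vsum_push.
- rewrite dE (le_trans ((proj2 e) _ fd))// -mulrA ler_wpM2l//.
  apply: vsum_comp => //; first exact: next_copy_inj.
  by apply: uncond_reindex => //; exact: pos_inj.
- exact: pos_inj.
- by rewrite dE.
Qed.

Let block_constant_uncond b b' : fsupp b -> (forall p, absv (b' p) <= absv (b p)) ->
  rn (vsum z (block_constant b')) <= D * rn (vsum z (block_constant b)).
Proof.
move=> fb bb; apply: uz; first by apply: push_fsupp; [exact: pos_inj|exact: tag_fs].
by apply: push_le; [exact: pos_inj|move=> x; exact: bb].
Qed.

(** All blocks are rotated cyclically by the same amount. Averaging over the amounts produces the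
    block averages. *)
Definition rotate (u : nat) (x : cell) : cell :=
  Cell (tag x) (Ordinal (ltn_pmod (tagged x + u) (len_gt0 (tag x).1))).

Lemma rotate_inj u : injective (rotate u).
Proof.
move=> [tc s] [tc' s'] E; have := congr1 tag E => /= tt; subst tc'.
have := congr1 (fun x : cell => nat_of_ord (tagged x)) E => /= /eqP.
rewrite eqn_modDr !modn_small// => /eqP/val_inj ->.
by [].
Qed.

(** A rotation preserves the order among the cells that wrap around and among those that do not, so
    spreading bounds it on each of the two parts. *)
Let wrap u (x : cell) := (len (tag x).1 <= tagged x + u %% len (tag x).1)%N.

Let rotate_mono u (x y : cell) : wrap u x = wrap u y -> (pos x < pos y)%N ->
  (pos (rotate u x) < pos (rotate u y))%N.
Proof.
rewrite !pos_lt; case: x y => [tc s] [tc' s'] wxy.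
case/orP => [/= ->//|/andP[/eqP /= tt ss]]; subst tc'.
rewrite /= eqxx ltnn /=; move: wxy; rewrite /wrap /= -(modnDmr s) -(modnDmr s').
have := ltn_pmod u (len_gt0 tc.1); have := ltn_ord s; have := ltn_ord s'; rewrite /=.
set L := len tc.1; set r := (u %% L)%N => s'L sL rL.
have mE x : (x < L)%N -> ((x + r) %% L = if L <= x + r then x + r - L else x + r)%N.
  move=> xL; case: leqP => h; last by rewrite modn_small.
  by rewrite -[in LHS](subnK h) modnDr modn_small//; lia.
move=> wxy; rewrite !mE// -wxy; have ssr : (s + r < s' + r)%N by rewrite ltn_add2r.
by case: ifP => // h; rewrite ltn_sub2r// (leq_ltn_trans h).
Qed.

Let rotate_part u (f : cell -> K) (b : bool) : fsupp f ->
  rn (vsum zp (fun x => if wrap u x == b then f (rotate u x) else 0)) <= C * D * rn (vsum zp f).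
Proof.
move=> ff; pose I := {x : cell | wrap u x == b}.
pose h (x : I) := rotate u (sval x).
have hi : injective h by move=> x y /rotate_inj/val_inj.
have -> : (fun x => if wrap u x == b then f (rotate u x) else 0) = push (sval : I -> cell) (f \o h).
  apply/funext => x; case: ifPn => hx.
    have -> : x = sval (exist _ x hx : I) by [].
    by rewrite push_in//; exact: val_inj.
  by rewrite push_out// => -[[y yw] /= yx]; rewrite -yx yw in hx.
have fh : fsupp (f \o h) by exact: comp_fsupp.
rewrite vsum_push//; last exact: val_inj.
have e : eqv C (zp \o (sval : I -> cell)) (zp \o h).
  apply: (spread_eqv sz (p := pos \o (sval : I -> cell)) (p' := pos \o h)).
  - exact: inj_comp (@pos_inj len) val_inj.
  - exact: inj_comp (@pos_inj len) hi.
  - move=> x y; apply: rotate_mono.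
    by have /eqP -> := svalP x; have /eqP -> := svalP y.
rewrite (le_trans ((proj1 e) _ fh))// -mulrA ler_wpM2l//.
by apply: vsum_comp => //; apply: uncond_reindex => //; exact: pos_inj.
Qed.

Let rotate_bound u (f : cell -> K) : fsupp f ->
  rn (vsum zp (f \o rotate u)) <= (C * D + C * D) * rn (vsum zp f).
Proof.
move=> ff; have fr : fsupp (f \o rotate u) by apply: comp_fsupp => //; exact: rotate_inj.
have fp b : fsupp (fun x => if wrap u x == b then f (rotate u x) else 0).
  by apply: fsupp_le fr _ => x; case: ifP => // _; rewrite absv0 absv_ge0.
rewrite (@vsum_ext _ _ _ _ _ _ (fun x => (if wrap u x == true then f (rotate u x) else 0) +
   (if wrap u x == false then f (rotate u x) else 0))); last first.
  by move=> x /=; case: (wrap u x); rewrite /= ?addr0 ?add0r.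
by rewrite vsumD// (le_trans (rnD _ _))// mulrDl lerD// rotate_part.
Qed.

Let sum_rotate L m (g : nat -> K) s : (s < L)%N ->
  \sum_(u < m * L) g ((s + u) %% L)%N = m%:R * \sum_(i < L) g i.
Proof.
move=> sL; have L0 : (0 < L)%N by exact: leq_ltn_trans sL.
elim: m => [|m IH]; first by rewrite mul0r big_ord0.
rewrite mulSn addnC big_split_ord /= IH -natr1 mulrDl mul1r; congr (_ + _).
have inj : injective (fun u : 'I_L => Ordinal (ltn_pmod (s + u) L0)).
  move=> u v /(congr1 val) /= /eqP; rewrite eqn_modDl !modn_small//.
  by move=> /eqP/val_inj.
rewrite [RHS](reindex_inj inj) /=; apply: eq_bigr => u _.
by rewrite addnCA modnMDl.
Qed.

Let average_fs (a : nat -> K^o) : fsupp a -> fsupp (block_average a : nat * nat -> K).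
Proof.
move=> fa; have [s [us sf]] := comp_fsupp (@pos_inj len) fa.
exists (undup (map tag s)); split; first exact: undup_uniq.
move=> tc; rewrite mem_undup => ntc; rewrite /block_average big1 ?mulr0// => i _.
apply: (sf (Cell tc i)); apply: contra ntc => h.
by apply/mapP; exists (Cell tc i).
Qed.

(** The projection is a mean of rotations, which are bounded uniformly in the amount of rotation. *)
Let average_bound (a : nat -> K^o) : fsupp a ->
  rn (vsum z (block_constant (block_average a))) <= (C * D + C * D) * D * rn (vsum z a).
Proof.
move=> fa; have ff := comp_fsupp (@pos_inj len) fa; have [s [us sf]] := ff.
pose f : cell -> K := a \o pos.
(* A common multiple of the lengths of the blocks that meet the support: over [L] rotations each of
   these blocks is traversed a whole number of times. *)
pose L := (\prod_(x <- s) len (tag x).1)%N.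
have L0 : (0 < L)%N by rewrite /L prodn_cond_gt0.
have L0' : L%:R != 0 :> K by rewrite pnatr_eq0 -lt0n.
have CD0 : 0 <= C * D by rewrite mulr_ge0.
rewrite block_constant_vsum; last exact: average_fs.
have avgE : block_average a \o tag = fun x : cell => L%:R^-1 * \sum_(u < L) f (rotate u x).
  apply/funext => -[tc i] /=; have [tcs|tcs] := boolP (tc \in map tag s).
    have /dvdnP[m mE] : (len tc.1 %| L)%N.
      by move/mapP: tcs => [x xs ->]; rewrite /L (big_rem x)//= dvdn_mulr.
    pose g j := if insub j is Some o then f (Cell tc o) else 0.
    have gE (o : 'I_(len tc.1)) : g o = f (Cell tc o) by rewrite /g valK.
    have -> : \sum_(u < L) f (rotate u (Cell tc i)) = \sum_(u < m * len tc.1) g ((i + u) %% len tc.1)%N.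
      rewrite -mE; apply: eq_bigr => u _; rewrite /rotate /=.
      by rewrite -gE.
    rewrite sum_rotate// mE natrM invfM.
    have m0 : m%:R != 0 :> K.
      by move: L0'; rewrite mE natrM mulf_eq0 negb_or => /andP[].
    rewrite (mulrC m%:R^-1) -mulrA (mulKf m0) /block_average; congr (_ * _).
    by apply: eq_bigr => o _; rewrite gE.
  have f0 (o : 'I_(len tc.1)) : f (Cell tc o) = 0.
    by apply: sf; apply: contra tcs => h; apply/mapP; exists (Cell tc o).
  rewrite /block_average big1 => [|o _]; last exact: f0.
  by rewrite mulr0 big1 ?mulr0// => o _; exact: f0.
have fr u : fsupp (f \o rotate u) by apply: comp_fsupp => //; exact: rotate_inj.
have fS : fsupp (fun x : cell => \sum_(u < L) f (rotate u x)).
  by have := @fsupp_sum _ _ _ _ (index_enum 'I_L) (fun u => f \o rotate u) fr.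
rewrite avgE vsumZ// rnZ absvV.
have -> : absv L%:R = L%:R.
  have -> : (L%:R : K) = ofreal L%:R.
    elim: (L) => [|n IH]; first by rewrite ofreal0.
    by rewrite -!natr1 ofrealD IH ofreal1.
  by rewrite absv_ofreal ger0_norm// ler0n.
have L0R : 0 < L%:R :> R by rewrite ltr0n.
rewrite ler_pdivrMl//.
have := @vsum_sum _ _ _ _ _ (index_enum 'I_L) (fun u => f \o rotate u) zp fr.
rewrite -[X in vsum zp X]/(fun x : cell => \sum_(u < L) f (rotate u x)) => ->.
apply: (le_trans (rn_sum _ _ _)).
apply: (@le_trans _ _ (\sum_(u < L) (C * D + C * D) * (D * rn (vsum z a)))).
  apply: ler_sum => u _; apply: (le_trans (rotate_bound u ff)).
  rewrite ler_wpM2l ?addr_ge0//; apply: vsum_comp => //; exact: pos_inj.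
by rewrite sumr_const card_ord -[leLHS]mulr_natl !mulrA.
Qed.

Lemma block_sum_eqv : exists2 r : nat -> nat, injective r & exists2 C' : R, 0 <= C' &
  eqv C' (z \o r) (unitize (fun t => \sum_(s < len t) z (pos (Cell (t, 0%N) s)))).
Proof.
pose M := D + C + C * D + (C * D + C * D) * D.
have CD0 : 0 <= C * D by rewrite mulr_ge0.
have CD1 : 0 <= (C * D + C * D) * D by rewrite mulr_ge0 ?addr_ge0.
have M0 : 0 <= M by rewrite !addr_ge0.
have [||||||r ri [C' C'0 e]] := @shifted_basis_embeds _ _ _ _ z D bz uz z0 zY Yu nat
  block_average block_constant M block_averageK M0.
- by move=> i; apply: average_fs; exact: fsupp_dlt.
- by move=> p; apply: push_fsupp; [exact: pos_inj|apply: tag_fs; exact: fsupp_dlt].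
- move=> a fa; apply: (le_trans (average_bound fa)); rewrite ler_wpM2r ?rn_ge0//.
  by rewrite /M lerDr !addr_ge0.
- move=> b b' fb bb; apply: (le_trans (block_constant_uncond fb bb)).
  by rewrite ler_wpM2r ?rn_ge0// /M -!addrA lerDl !addr_ge0.
- move=> b fb; apply: (le_trans (up_block_bound fb)).
  by rewrite ler_wpM2r ?rn_ge0// /M addrAC -addrA addrAC lerDr !addr_ge0.
- move=> b fb; apply: (le_trans (down_block_bound fb)).
  by rewrite ler_wpM2r ?rn_ge0// /M addrAC lerDr !addr_ge0.
exists r => //; exists C' => //.
suff <- : (fun t => vsum z (block_constant (dlt (t, 0%N)))) =
   (fun t => \sum_(s < len t) z (pos (Cell (t, 0%N) s))) by [].
apply/funext => t; rewrite block_constant_vsum; last exact: fsupp_dlt.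
rewrite (@vsumE _ _ _ _ _ _ [seq Cell (t, 0%N) s | s <- enum 'I_(len t)]).
  rewrite big_map big_enum /=; apply: eq_bigr => s _.
  by rewrite /dlt eqxx scale1r.
split.
  rewrite map_inj_uniq ?enum_uniq// => s s' E; apply: val_inj.
  by have := congr1 (fun x : cell => nat_of_ord (tagged x)) E.
move=> [tc s] ns; rewrite /dlt /=; case: eqP => // tcE; subst tc.
by move: ns; rewrite map_f// mem_enum.
Qed.

End BlockAverages.

End Blocks.

(** * The power law of the fundamental function *)

Section PowerLaw.
Variables (R : realType) (k : scalar_kind).
Local Notation K := (scalars R k).
Local Notation absv := (@absv R k).
Local Notation ofreal := (@ofreal R k).

Section Law.
Variables (X : completeNormedModType K) (Y : set X) (z : nat -> X) (C D : R).
Hypotheses (bz : normalized_unconditional_basis Y z) (uz : uncond D z) (zY : closed_span z = Y)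
  (Yu : unique_normalized_unconditional_basis Y) (C0 : 0 <= C) (sz : spreading C z).

Let nz i : rn (z i) = 1. Proof. exact: (normalized_rn bz.1). Qed.
Let z0 i : z i != 0.
Proof. by apply/eqP => zi; have := nz i; rewrite zi rn0 => /eqP; rewrite eq_sym oner_eq0. Qed.
Let D1 : 1 <= D. Proof. exact: uncond_ge1 (z0 0%N) uz. Qed.
Let D0 : 0 <= D. Proof. exact: le_trans D1. Qed.

Local Notation lam := (fundamental z).

Lemma fundamental_ge0 n : 0 <= lam n. Proof. exact: rn_ge0. Qed.

Lemma fundamental_vsum n : lam n = rn (vsum z (trunc n (fun=> 1))).
Proof. by rewrite vsum_trunc /fundamental; congr rn; apply: eq_bigr => i _; rewrite scale1r. Qed.

Lemma fundamental_mono m n : (m <= n)%N -> lam m <= D * lam n.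
Proof.
move=> mn; rewrite !fundamental_vsum; apply: uz; first exact: fsupp_trunc.
move=> i; rewrite /trunc; case: ltnP => im; last by rewrite absv0 absv_ge0.
by rewrite (leq_trans im mn).
Qed.

Lemma fundamental1 : lam 1 = 1.
Proof. by rewrite /fundamental big_ord1 nz. Qed.

Lemma fundamental_le n : lam n <= n%:R.
Proof.
rewrite /fundamental (le_trans (rn_sum _ _ _))// (eq_bigr (fun=> 1)) => [|i _]; last exact: nz.
by rewrite sumr_const card_ord.
Qed.

Lemma fundamental_gt0 n : (0 < n)%N -> 0 < lam n.
Proof.
move=> /fundamental_mono; rewrite fundamental1 => h.
rewrite lt_neqAle fundamental_ge0 andbT; apply/eqP => l0.
by move: h; rewrite -l0 mulr0 leNgt ltr01.
Qed.

(** A sequence of block lengths in which every positive length occurs infinitely often. *)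
Definition valuation_length (t : nat) := (logn 2 t.+1).+1.

Let len := valuation_length.

(** An injective [r] stays below [B] at finitely many places only. Hence blocks of prescribed
    lengths can be chosen one after another with [r] increasing, as the use of spreading
    requires. *)
Lemma valuation_length_infinite (r : nat -> nat) l B : injective r -> (0 < l)%N ->
  exists t, len t = l /\ (B < r t)%N.
Proof.
move=> ri l0; pose t (j : nat) := (2 ^ l.-1 * j.*2.+1).-1.
have tS j : (t j).+1 = (2 ^ l.-1 * j.*2.+1)%N.
  by rewrite prednK// muln_gt0 expn_gt0.
have tl j : len (t j) = l.
  rewrite /len /valuation_length tS lognM ?expn_gt0// pfactorK// logn_coprime.
    by rewrite addn0 prednK.
  by rewrite coprime2n /= odd_double.
have ti : injective t.
  move=> i j /(congr1 succn); rewrite !tS => /eqP; rewrite eqn_pmul2l ?expn_gt0//.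
  by move=> /eqP[] /double_inj.
apply: contrapT => H.
have small j : (r (t j) < B.+1)%N.
  by rewrite ltnS leqNgt; apply/negP => h; apply: H; exists (t j).
have fi : injective (fun j : 'I_B.+2 => Ordinal (small j)).
  by move=> i j /(congr1 val)/ri/ti/val_inj.
by have := leq_card _ fi; rewrite !card_ord ltnn.
Qed.

Let u t : X := \sum_(s < len t) z (pos (existT (fun p : nat * nat => 'I_(len p.1)) (t, 0%N) s)).

(** Weighted by its norm, about lam (l i), a unitized block is again a sum of l i terms of [z].
    Adding up the blocks gives a sum of terms of [z], and the unitized blocks are themselves
    equivalent to terms of [z]. *)
Lemma block_power_law : exists2 Q : R, 1 <= Q & forall n (l : nat -> nat), (forall i, (0 < l i)%N) ->
  rn (\sum_(i < n) ofreal (lam (l i)) *: z i) <= Q * lam (\sum_(i < n) l i)%N /\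
  lam (\sum_(i < n) l i)%N <= Q * rn (\sum_(i < n) ofreal (lam (l i)) *: z i).
Proof.
have len_gt0 t : (0 < len t)%N by [].
have [r ri [C' C'0 e]] := block_sum_eqv bz uz zY Yu C0 sz len_gt0; rewrite -/u in e.
have cellE t (s : 'I_(len t)) := existT (fun p : nat * nat => 'I_(len p.1)) (t, 0%N) s.
have uE t : rn (u t) <= C * lam (len t) /\ lam (len t) <= C * rn (u t).
  have := @spread_sum _ _ _ _ _ sz 'I_(len t)
    (fun s => pos (existT (fun p : nat * nat => 'I_(len p.1)) (t, 0%N) s)).
  rewrite card_ord; apply => s s' /pos_inj E; apply: val_inj.
  by have := congr1 (fun x : cell len => nat_of_ord (tagged x)) E.
pose D' := C' * D * C'.
have uu : uncond D' (unitize u) by apply: (eqv_uncond C'0 D0 e); exact: uncond_reindex.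
have D'0 : 0 <= D' by rewrite !mulr_ge0.
pose Q0 := C * C' * (D' * C) * C.
have Q00 : 0 <= Q0 by rewrite !mulr_ge0.
exists (Q0 + 1); first by rewrite lerDr.
move=> n l l0.
have /choice[g gP] (lB : nat * nat) : exists t, (0 < lB.1)%N -> len t = lB.1 /\ (lB.2 < r t)%N.
  have [h|h] := posnP lB.1; first by exists 0%N; rewrite h.
  by have [t tP] := valuation_length_infinite lB.2 ri h; exists t.
(* [tau i] is a block of length l i, chosen so that [r \o tau] increases. *)
pose tau := fix tau i := if i is i'.+1 then g (l i, r (tau i')) else g (l 0%N, 0%N).
have tau_len i : len (tau i) = l i by case: i => [|i]; [have [] := gP (l 0%N, 0%N) (l0 0%N)|have [] := gP (l i.+1, r (tau i)) (l0 i.+1)].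
have tau_incr : incr (r \o tau).
  have tauS i : (r (tau i) < r (tau i.+1))%N by have [] := gP (l i.+1, r (tau i)) (l0 i.+1).
  by apply: homo_ltn tauS; exact: ltn_trans.
pose ta (i : 'I_n) := tau i.
have tam : mono (r \o ta) by move=> i j; exact: tau_incr.
have tai : injective ta by move=> i j ij; apply: (mono_ord_inj tam); rewrite /= ij.
pose a (i : 'I_n) : K := ofreal (lam (l i)).
(* With the exact norms as coefficients the combination is a plain sum of terms of [z]; by [uE]
   these coefficients are comparable with [a]. *)
pose a' (i : 'I_n) : K := ofreal (rn (u (ta i))).
have idm : mono (fun i : 'I_n => val i) by [].
have N1E : \sum_(i < n) ofreal (lam (l i)) *: z i = vsum (z \o (fun i : 'I_n => val i)) a.
  by rewrite vsum_ord.
have [s1 s2] := sz tam idm.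
have [e1 e2] := eqv_reindex tai e.
have uta := uncond_reindex tai uu.
have un0 t : 0 < rn (u t).
  rewrite lt_neqAle rn_ge0 andbT; apply/eqP => u0; have [_] := uE t.
  by rewrite -u0 mulr0 leNgt fundamental_gt0.
have S1 : vsum (unitize u \o ta) a' = \sum_(x : {i : 'I_n & 'I_(len (ta i))})
    z (pos (existT (fun p : nat * nat => 'I_(len p.1)) (ta (tag x), 0%N) (tagged x))).
  rewrite vsum_ord (eq_bigr (fun i => u (ta i))).
    by rewrite /u sig_big_dep.
  by move=> i _; rewrite /= /unitize scalerA -ofrealM mulfV ?gt_eqF// ofreal1 scale1r.
have [S2 S3] : rn (vsum (unitize u \o ta) a') <= C * lam (\sum_(i < n) l i)%N /\
    lam (\sum_(i < n) l i)%N <= C * rn (vsum (unitize u \o ta) a').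
  rewrite S1; have -> : (\sum_(i < n) l i)%N = #|{: {i : 'I_n & 'I_(len (ta i))}}|.
    rewrite card_tagged sumnE big_map big_enum /=; apply: eq_bigr => i _.
    by rewrite card_ord -tau_len.
  apply: (spread_sum sz) => -[i s] [j s'] /pos_inj E.
  have ij : i = j by apply: tai; have := congr1 (fun x : cell len => (tag x).1) E.
  subst j; congr existT; apply: val_inj.
  by have := congr1 (fun x : cell len => nat_of_ord (tagged x)) E.
have A1 : rn (vsum (unitize u \o ta) a) <= D' * C * rn (vsum (unitize u \o ta) a').
  have -> : D' * C * rn (vsum (unitize u \o ta) a') = D' * rn (vsum (unitize u \o ta) (fun i => ofreal C * a' i)).
    by rewrite vsumZ ?rnZ ?absv_ofreal ?ger0_norm ?mulrA//; exact: fsupp_ord.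
  apply: uta; first exact: fsupp_ord.
  move=> i; rewrite -ofrealM !absv_ofreal !ger0_norm ?mulr_ge0 ?rn_ge0//.
  by rewrite -tau_len; have [] := uE (ta i).
have A2 : rn (vsum (unitize u \o ta) a') <= D' * C * rn (vsum (unitize u \o ta) a).
  have -> : D' * C * rn (vsum (unitize u \o ta) a) = D' * rn (vsum (unitize u \o ta) (fun i => ofreal C * a i)).
    by rewrite vsumZ ?rnZ ?absv_ofreal ?ger0_norm ?mulrA//; exact: fsupp_ord.
  apply: uta; first exact: fsupp_ord.
  move=> i; rewrite -ofrealM !absv_ofreal !ger0_norm ?mulr_ge0 ?rn_ge0//.
  by rewrite -tau_len; have [] := uE (ta i).
have fa := fsupp_ord a.
have leQ x : 0 <= x -> Q0 * x <= (Q0 + 1) * x by move=> x0; rewrite ler_wpM2r// lerDl.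
rewrite N1E; split.
  apply: le_trans (leQ _ (fundamental_ge0 _)).
  rewrite /Q0 -!mulrA (le_trans (s2 _ fa))// ler_wpM2l//.
  by rewrite (le_trans (e1 _ fa))// ler_wpM2l// (le_trans A1)// -!mulrA !ler_wpM2l//.
apply: le_trans (leQ _ (rn_ge0 (vsum (z \o (fun i : 'I_n => val i)) a))).
rewrite (le_trans S3)// (_ : Q0 * _ = C * (D' * C * (C' * (C * rn (vsum (z \o (fun i : 'I_n => val i)) a))))); last by rewrite /Q0; ring.
rewrite ler_wpM2l// (le_trans A2)// ler_wpM2l ?mulr_ge0// (le_trans (e2 _ fa))// ler_wpM2l//.
exact: s1.
Qed.

End Law.

(* Hyers-Ulam stability, with b = sup (f m - q) / m. *)
Lemma almost_additive (f : nat -> R) q : (forall m n, `|f (m + n)%N - f m - f n| <= q) ->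
  exists b, forall m, `|f m - m%:R * b| <= q.
Proof.
move=> fq.
have mult m n : `|f (m.+1 * n)%N - m.+1%:R * f n| <= m%:R * q.
  elim: m => [|m IH]; first by rewrite mul1n mul1r subrr normr0 mul0r.
  rewrite mulSn -[m.+2%:R]natr1 mulrDl mul1r -[X in _ <= X * q]natr1 mulrDl mul1r.
  have -> : f (n + m.+1 * n)%N - (m.+1%:R * f n + f n) =
    (f (m.+1 * n)%N - m.+1%:R * f n) + (f (n + m.+1 * n)%N - f n - f (m.+1 * n)%N) by ring.
  by rewrite (le_trans (ler_normD _ _))// lerD.
have q0 : 0 <= q by apply: le_trans (fq 0%N 0%N).
(* Both sides are compared with the value of [f] at (m + 1) (n + 1). *)
have cross m n : (f m.+1 - q) / m.+1%:R <= (f n.+1 + q) / n.+1%:R.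
  rewrite ler_pdivrMr// mulrAC ler_pdivlMr//.
  have := mult n m.+1; have := mult m n.+1; rewrite mulnC !ler_norml => /andP[h1 h2] /andP[h3 h4].
  have : m%:R * q <= m.+1%:R * q by rewrite ler_wpM2r// ler_nat.
  have : n%:R * q <= n.+1%:R * q by rewrite ler_wpM2r// ler_nat.
  lra.
pose S := [set y | exists m, y = (f m.+1 - q) / m.+1%:R].
have Sup : has_sup S.
  split; first by exists ((f 1%N - q) / 1%:R), 0%N.
  by exists ((f 1%N + q) / 1%:R) => _ [m ->]; exact: cross.
exists (sup S) => -[|m]; first by have := fq 0%N 0%N; rewrite mul0r subr0 addn0 subrr sub0r normrN.
rewrite ler_norml; apply/andP; split.
  have : sup S <= (f m.+1 + q) / m.+1%:R.
    by apply: ge_sup; [exact: Sup.1|move=> _ [j ->]; exact: cross].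
  by rewrite ler_pdivlMr//; lra.
have : (f m.+1 - q) / m.+1%:R <= sup S by apply: ub_le_sup; [exact: Sup.2|exists m].
by rewrite ler_pdivrMr//; lra.
Qed.

End PowerLaw.

(** * From the power law to the norm of all combinations *)

Section PowerNorm.
Variables (R : realType) (k : scalar_kind).
Local Notation K := (scalars R k).
Local Notation absv := (@absv R k).
Local Notation ofreal := (@ofreal R k).

Section Estimates.
Variables (X : completeNormedModType K) (Y : set X) (z : nat -> X) (C D : R).
Hypotheses (bz : normalized_unconditional_basis Y z) (uz : uncond D z) (zY : closed_span z = Y)
  (Yu : unique_normalized_unconditional_basis Y) (C0 : 0 <= C) (sz : spreading C z).

Let nz i : rn (z i) = 1. Proof. exact: (normalized_rn bz.1). Qed.
Let z0 i : z i != 0.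
Proof. by apply/eqP => zi; have := nz i; rewrite zi rn0 => /eqP; rewrite eq_sym oner_eq0. Qed.
Let D1 : 1 <= D. Proof. exact: uncond_ge1 (z0 0%N) uz. Qed.
Let D0 : 0 <= D. Proof. exact: le_trans D1. Qed.

Local Notation lam := (fundamental z).

Let lam_gt0 n : (0 < n)%N -> 0 < lam n. Proof. exact: (fundamental_gt0 bz uz). Qed.

(** Equal lengths in the block law make lam multiplicative up to a constant, so m -> ln (lam (2^m))
    is almost additive and close to a linear function of slope [b]. Monotonicity interpolates
    between powers of 2. *)
Lemma fundamental_power : exists al, exists2 Q : R, 1 <= Q & [/\ 0 <= al, al <= 1 &
  forall n, (0 < n)%N -> lam n <= Q * n%:R `^ al /\ n%:R `^ al <= Q * lam n].
Proof.
have [Q Q1 law] := block_power_law bz uz zY Yu C0 sz.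
have Q0 : 0 < Q by exact: lt_le_trans Q1.
have mult m n : (0 < m)%N -> lam m * lam n <= Q * lam (n * m) /\ lam (n * m) <= Q * (lam m * lam n).
  move=> m0; have [] := law n (fun=> m) (fun=> m0).
  have -> : \sum_(i < n) ofreal (lam m) *: z i = ofreal (lam m) *: \sum_(i < n) z i.
    by rewrite scaler_sumr.
  by rewrite rnZ absv_ofreal ger0_norm ?rn_ge0// sum_nat_const card_ord.
pose f m := ln (lam (2 ^ m)%N).
have p2 m : (0 < 2 ^ m)%N by rewrite expn_gt0.
have l2 m : 0 < lam (2 ^ m)%N by exact: lam_gt0.
have [b fb] : exists b, forall m, `|f m - m%:R * b| <= ln Q.
  apply: almost_additive => m n; rewrite /f expnD.
  have [h1 h2] := mult _ (2 ^ m)%N (p2 n).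
  have lmn : 0 < lam (2 ^ m * 2 ^ n)%N by apply: lam_gt0; rewrite muln_gt0 !p2.
  have := h1; rewrite -ler_ln ?posrE ?mulr_gt0// !lnM ?posrE//.
  have := h2; rewrite -ler_ln ?posrE ?mulr_gt0// !lnM ?posrE ?mulr_gt0//.
  by rewrite ler_norml; lra.
have ln2 : 0 < ln 2 :> R by rewrite ln_gt0// ltr1n.
have linear_bound (c e : R) : (forall m : nat, m%:R * c <= e) -> c <= 0.
  move=> h; rewrite leNgt; apply/negP => c0.
  have := h (Num.truncn (e / c)).+1; rewrite leNgt => /negP; apply.
  by rewrite -ltr_pdivrMr// truncnS_gt.
have b0 : 0 <= b.
  rewrite -oppr_le0; apply: (linear_bound _ (ln D + ln Q)) => m.
  have := fb m; rewrite ler_norml => /andP[_ h].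
  have : 0 <= ln D + f m.
    rewrite /f -lnM ?posrE//; last exact: lt_le_trans D1.
    by apply: ln_ge0; have := fundamental_mono uz (p2 m); rewrite (fundamental1 bz).
  by rewrite mulrN; lra.
have lnX m : ln (2 ^ m)%:R = m%:R * ln 2 :> R by rewrite natrX lnXn// mulr_natl.
have b1 : b <= ln 2.
  rewrite -subr_le0; apply: (linear_bound _ (ln Q)) => m.
  have := fb m; rewrite ler_norml => /andP[h _].
  have : f m <= m%:R * ln 2.
    by rewrite -lnX /f ler_ln ?posrE ?ltr0n//; exact: (fundamental_le bz).
  by rewrite mulrBr; lra.
(* [Q] comes from the linear approximation, [D] from monotonicity, and 2 bounds the growth exp b
   between consecutive powers of 2. *)
exists (b / ln 2), (2 * D * Q).
  by rewrite (le_trans Q1)// ler_peMl ?(ltW Q0)//; have := D1; lra.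
split; first by rewrite divr_ge0// ltW.
  by rewrite ler_pdivrMr// mul1r.
move=> n n0; set m := trunc_log 2 n.
have mn : (2 ^ m <= n)%N by exact: trunc_logP.
have nm : (n < 2 ^ m.+1)%N by exact: trunc_log_ltn.
have nE : n%:R `^ (b / ln 2) = expR (b / ln 2 * ln n%:R) :> R.
  by rewrite /powR pnatr_eq0 (gtn_eqF n0).
have n1 : m%:R * ln 2 <= ln n%:R :> R by rewrite -lnX ler_ln ?posrE ?ltr0n// ler_nat.
have n2 : ln n%:R <= m.+1%:R * ln 2 :> R by rewrite -lnX ler_ln ?posrE ?ltr0n// ler_nat ltnW.
have DQ : 0 < D * Q by rewrite mulr_gt0//; exact: lt_le_trans D1.
have D0' : 0 < D by exact: lt_le_trans D1.
have bl : b = b / ln 2 * ln 2 by rewrite divfK// gt_eqF.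
have bl0 : 0 <= b / ln 2 by rewrite divr_ge0// ltW.
have n1' : m%:R * b <= b / ln 2 * ln n%:R by rewrite {1}bl mulrCA ler_wpM2l.
have n2' : b / ln 2 * ln n%:R <= m.+1%:R * b by rewrite {2}bl mulrCA ler_wpM2l.
have mS : m.+1%:R * b = m%:R * b + b by rewrite -natr1 mulrDl mul1r.
rewrite nE; split.
  rewrite (le_trans (fundamental_mono uz (ltnW nm)))//.
  rewrite -ler_ln ?posrE ?mulr_gt0 ?expR_gt0// !lnM ?posrE ?mulr_gt0 ?expR_gt0// expRK.
  by have := fb m.+1; rewrite ler_norml /f => /andP[_]; lra.
have h : ln (lam (2 ^ m)%N) <= ln (D * lam n).
  by rewrite ler_ln ?posrE ?mulr_gt0 ?lam_gt0//; exact: (fundamental_mono uz mn).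
rewrite lnM ?posrE ?lam_gt0// in h.
rewrite -ler_ln ?posrE ?mulr_gt0 ?expR_gt0 ?lam_gt0//.
rewrite !lnM ?posrE ?mulr_gt0 ?expR_gt0 ?lam_gt0// expRK.
by have := fb m; rewrite ler_norml /f => /andP[]; lra.
Qed.

Definition pnorm (p : R) (I : Type) (s : seq I) (a : I -> K) : R :=
  (\sum_(i <- s) absv (a i) `^ p) `^ p^-1.

Definition power_type (p M : R) :=
  forall s a, supp_in s a -> rn (vsum z a) <= M * pnorm p s a /\ pnorm p s a <= M * rn (vsum z a).

Section Power.
Variable al : R.
Hypotheses (al0 : 0 < al) (al1 : al <= 1).

Let p := al^-1.
Let p0 : 0 < p. Proof. by rewrite invr_gt0. Qed.

Let powK x : 0 <= x -> (x `^ p) `^ al = x.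
Proof. by move=> x0; rewrite -powRrM mulVf ?gt_eqF// powRr1. Qed.

Let pow_le x y : 0 <= x -> x <= y -> x `^ al <= y `^ al.
Proof. by move=> x0 xy; apply: ge0_ler_powR; rewrite ?nnegrE ?(ltW al0)// (le_trans x0). Qed.

Let pow2 : 2 `^ al <= 2 :> R.
Proof. by rewrite ler1_powR ?ler1n. Qed.

Variable Q : R.
Hypotheses (Q1 : 1 <= Q) (lamP : forall n, (0 < n)%N -> lam n <= Q * n%:R `^ al /\ n%:R `^ al <= Q * lam n).

Let Q0 : 0 <= Q. Proof. exact: le_trans Q1. Qed.

(** Both sides are homogeneous, so the coefficients may be scaled until their p-th powers are
    integers l i up to a factor 2. Each coefficient is then comparable with lam (l i), and the block
    law evaluates the norm. *)
Lemma positive_power_estimate : exists2 M : R, 1 <= M & forall n (t : nat -> R), (forall i, 0 < t i) ->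
  rn (\sum_(i < n) ofreal (t i) *: z i) <= M * (\sum_(i < n) t i `^ p) `^ al /\
  (\sum_(i < n) t i `^ p) `^ al <= M * rn (\sum_(i < n) ofreal (t i) *: z i).
Proof.
have [Q' Q'1 law] := block_power_law bz uz zY Yu C0 sz.
have Q'0 : 0 <= Q' by exact: le_trans Q'1.
pose M := 2 * D * Q * Q' * Q * 2.
have M1 : 1 <= M by rewrite /M !mulr_ege1// ler1n.
have M0 : 0 <= M by exact: le_trans M1.
exists M => // n t t0; case: n => [|n].
  by rewrite !big_ord0 rn0 powR0 ?mulr0// gt_eqF.
(* With this scaling 1 <= T * t i, and (T * t i) `^ p is the integer l i up to
   a factor 2. *)
pose T := \sum_(i < n.+1) (t i)^-1.
have T0 : 0 < T.
  by rewrite /T big_ord_recl ltr_pwDl ?invr_gt0// sumr_ge0// => i _; rewrite invr_ge0 ltW.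
have Tt (i : 'I_n.+1) : 1 <= T * t i.
  rewrite -ler_pdivrMr// mul1r /T (bigD1 i)//= lerDl sumr_ge0// => j _.
  by rewrite invr_ge0 ltW.
have Tt0 i : 0 <= T * t i by rewrite mulr_ge0 ?ltW.
(* The maximum with 1 only matters for indices beyond [n]: the block law wants every length
   positive. *)
pose l (i : nat) := maxn 1 (Num.truncn ((T * t i) `^ p)).
have l0 i : (0 < l i)%N by rewrite /l leq_max.
have lB (i : 'I_n.+1) : (l i)%:R <= (T * t i) `^ p <= 2 * (l i)%:R.
  have h1 : 1 <= (T * t i) `^ p.
    by have := ge0_ler_powR (ltW p0) _ _ (Tt i); rewrite powR1; apply; rewrite nnegrE.
  have h2 : (0 < Num.truncn ((T * t i) `^ p))%N by rewrite truncn_gt0.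
  rewrite /l (maxn_idPr h2) truncn_le powR_ge0 /=.
  apply: (le_trans (ltW (truncnS_gt _))); rewrite -natr1 mulr2n mulrDl mul1r lerD2l.
  by rewrite ler1n.
have la1 (i : 'I_n.+1) : (l i)%:R `^ al <= T * t i.
  by rewrite -[leRHS]powK//; apply: pow_le; rewrite ?ler0n//; have /andP[] := lB i.
have la2 (i : 'I_n.+1) : T * t i <= 2 * (l i)%:R `^ al.
  rewrite -[leLHS]powK//; have /andP[_ h] := lB i.
  apply: (le_trans (pow_le (powR_ge0 _ _) h)).
  by rewrite powRM ?ler0n// ler_wpM2r// powR_ge0.
have [h1 h2] := law n.+1 l l0.
set Nl := rn (\sum_(i < n.+1) ofreal (lam (l i)) *: z i) in h1 h2.
set Nt := rn (\sum_(i < n.+1) ofreal (t i) *: z i).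
have L0 : (0 < \sum_(i < n.+1) l i)%N.
  by rewrite big_ord_recl ltn_addr.
have [g1 g2] := lamP L0; set L := (\sum_(i < n.+1) l i)%N in h1 h2 g1 g2 L0.
pose S := \sum_(i < n.+1) t i `^ p.
have S0 : 0 <= S by rewrite sumr_ge0// => i _; exact: powR_ge0.
have STE : \sum_(i < n.+1) (T * t i) `^ p = T `^ p * S.
  by rewrite mulr_sumr; apply: eq_bigr => i _; rewrite powRM// ltW.
have LS : L%:R <= T `^ p * S <= 2 * L%:R.
  rewrite -STE /L natr_sum mulr_sumr; apply/andP; split; apply: ler_sum => i _;
  by have /andP[] := lB i.
have TSal : (T `^ p * S) `^ al = T * S `^ al.
  by rewrite powRM ?powR_ge0// powK// ltW.
have fin (c : nat -> R) : rn (\sum_(i < n.+1) ofreal (c i) *: z i) = rn (vsum z (trunc n.+1 (fun i => ofreal (c i)))).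
  by rewrite vsum_trunc.
have TN : T * Nt = rn (\sum_(i < n.+1) ofreal (T * t i) *: z i).
  rewrite /Nt [in RHS](eq_bigr (fun i : 'I_n.+1 => ofreal T *: (ofreal (t i) *: z i))); last first.
    by move=> i _; rewrite scalerA ofrealM.
  by rewrite -scaler_sumr rnZ absv_ofreal gtr0_norm.
have cmp (c d : nat -> R) (m : R) : 0 <= m -> (forall i, 0 <= c i) -> (forall i, 0 <= d i) ->
    (forall i : 'I_n.+1, c i <= m * d i) ->
    rn (\sum_(i < n.+1) ofreal (c i) *: z i) <= D * (m * rn (\sum_(i < n.+1) ofreal (d i) *: z i)).
  move=> m0 c0 d0 cd.
  rewrite (fin d) -{1}(ger0_norm m0) -(absv_ofreal k) -rnZ -vsumZ; last exact: fsupp_trunc.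
  rewrite fin; apply: uz; first by apply: fsuppZ; exact: fsupp_trunc.
  move=> i; rewrite /trunc; case: ltnP => ni; last by rewrite mulr0.
  rewrite -ofrealM !absv_ofreal !ger0_norm ?mulr_ge0//.
  exact: (cd (Ordinal ni)).
have upper : T * Nt <= D * (2 * Q * Nl).
  rewrite TN /Nl; apply: (cmp (fun i => T * t i) (fun i => lam (l i))) => [|//|i|i].
  - by rewrite mulr_ge0.
  - exact: fundamental_ge0.
  rewrite (le_trans (la2 i))// -mulrA ler_wpM2l//.
  by have [_] := lamP (l0 i).
have lower : Nl <= D * (Q * (T * Nt)).
  rewrite TN /Nl; apply: (cmp (fun i => lam (l i)) (fun i => T * t i)) => [//|i|//|i].
    exact: fundamental_ge0.
  have [h _] := lamP (l0 i); rewrite (le_trans h)// ler_wpM2l//.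
rewrite -/S.
have Lal : L%:R `^ al <= T * S `^ al.
  by rewrite -TSal; apply: pow_le; rewrite ?ler0n//; have /andP[] := LS.
have Sal : T * S `^ al <= 2 * L%:R `^ al.
  rewrite -TSal; have /andP[_ h] := LS.
  have TS0 : 0 <= T `^ p * S by rewrite mulr_ge0 ?powR_ge0.
  apply: (le_trans (pow_le TS0 h)); rewrite powRM ?ler0n// ler_wpM2r// powR_ge0.
split; rewrite -(ler_pM2l T0).
  apply: (le_trans upper).
  rewrite (_ : T * (M * _) = D * (2 * Q * (Q' * (Q * (2 * (T * S `^ al)))))); last by rewrite /M; ring.
  rewrite ler_wpM2l// ler_wpM2l ?mulr_ge0// (le_trans h1)// ler_wpM2l// (le_trans g1)// ler_wpM2l//.
  by rewrite (le_trans Lal)// ler_peMl ?mulr_ge0 ?powR_ge0 ?(ltW T0) ?ler1n.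
rewrite (le_trans Sal)// (_ : T * (M * _) = 2 * (Q * (Q' * (D * (Q * (2 * (T * Nt))))))); last by rewrite /M; ring.
rewrite ler_wpM2l// (le_trans g2)// ler_wpM2l// (le_trans h2)// ler_wpM2l// (le_trans lower)//.
by rewrite ler_wpM2l// ler_wpM2l// ler_peMl ?ler1n// mulr_ge0 ?rn_ge0// ltW.
Qed.

(** Zero coefficients have to be made positive before the previous estimate applies, hence the
    maximum with a small number in [t]. *)
Lemma power_estimate : exists2 M : R, 1 <= M & power_type al^-1 M.
Proof.
have [M M1 est] := positive_power_estimate; rewrite -/p.
have M0 : 0 <= M by exact: le_trans M1.
exists (M * D * 2); first by rewrite !mulr_ege1// ler1n.
move=> s a sa; rewrite /pnorm /p invrK -/p.
have fa := supp_in_fsupp sa; have [n an] := fsupp_bound fa.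
have -> : \sum_(i <- s) absv (a i) `^ p = \sum_(i < n) absv (a i) `^ p.
  rewrite -(big_mkord xpredT (fun i => absv (a i) `^ p)); apply: sum_support; rewrite ?iota_uniq//.
  - by case: sa.
  - by move=> i; have [_ h] := sa => /h ->; rewrite absv0 powR0// gt_eqF.
  move=> i; rewrite mem_index_iota /= -leqNgt => /an ->.
  by rewrite absv0 powR0// gt_eqF.
set S := \sum_(i < n) _.
have S0 : 0 <= S by rewrite sumr_ge0// => i _; exact: powR_ge0.
have vE : vsum z a = \sum_(i < n) a i *: z i by exact: vsum_ord_bound.
pose t e i := Num.max (absv (a i)) e.
have t0 e i : 0 < e -> 0 < t e i by move=> e0; rewrite lt_max e0 orbT.
split.
  have [Sz|Sz] := eqVneq S 0.
    have az (i : 'I_n) : a i = 0.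
      apply: absv0_eq0; apply: (powR_eq0_eq0 (p := p)); apply/eqP.
      by rewrite eq_le powR_ge0 andbT -Sz /S (bigD1 i)//= lerDl sumr_ge0// => j _; exact: powR_ge0.
    rewrite Sz powR0 ?gt_eqF// mulr0 vE big1 ?rn0// => i _.
    by rewrite az scale0r.
  have {}Sz : 0 < S by rewrite lt_neqAle eq_sym Sz.
  have n0 : 0 < n%:R :> R.
    rewrite ltr0n lt0n; apply/eqP => nz'; move: Sz; rewrite /S.
    by case: n {an S S0 vE} nz' => // _; rewrite big_ord0 ltxx.
  (* The n numbers e^p add up to [S], so raising the coefficients to at least [e] at most doubles
     the sum of p-th powers. *)
  pose e := (S / n%:R) `^ al; have e0 : 0 < e by rewrite powR_gt0 ?divr_gt0.
  have [h _] := est n (t e) (fun i => t0 e i e0).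
  have tp : \sum_(i < n) t e i `^ p <= 2 * S.
    apply: (@le_trans _ _ (\sum_(i < n) (absv (a i) `^ p + S / n%:R))).
      apply: ler_sum => i _; rewrite /t; case: (leP (absv (a i)) e) => _.
        by rewrite /e -powRrM mulfV ?gt_eqF// powRr1 ?divr_ge0 ?ler0n// lerDr powR_ge0.
      by rewrite lerDl divr_ge0// ler0n.
    rewrite big_split /= sumr_const card_ord -[X in _ + X]mulr_natl mulrCA mulfV ?gt_eqF//.
    by rewrite mulr1 mulr2n mulrDl mul1r.
  have aN : rn (vsum z a) <= D * rn (\sum_(i < n) ofreal (t e i) *: z i).
    rewrite -(@vsum_trunc _ _ _ n z (fun i => ofreal (t e i))); apply: uz; first exact: fsupp_trunc.
    move=> i; rewrite /trunc; case: ltnP => ni; last by rewrite an.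
    by rewrite absv_ofreal ger0_norm ?(ltW (t0 _ _ e0))// le_max lexx.
  apply: (le_trans aN).
  rewrite (_ : M * D * 2 * S `^ al = D * (M * (2 * S `^ al))); last by ring.
  apply: ler_wpM2l; first exact: D0.
  apply: (le_trans h); apply: ler_wpM2l; first exact: M0.
  have tp0 : 0 <= \sum_(i < n) t e i `^ p by rewrite sumr_ge0// => i _; exact: powR_ge0.
  have h3 := pow_le tp0 tp.
  have h4 : (2 * S) `^ al = 2 `^ al * S `^ al by apply: powRM S0; exact: ler0n.
  rewrite h4 in h3; refine (le_trans h3 _).
  by apply: ler_wpM2r; [exact: powR_ge0|exact: pow2].
apply: (@le_trans _ _ (M * D * rn (vsum z a))); last first.
  by rewrite ler_wpM2r ?rn_ge0// ler_peMr ?mulr_ge0// ler1n.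
apply/ler_addgt0Pr => e e0; have n1 : 0 < n.+1%:R * M :> R.
  by rewrite mulr_gt0// (lt_le_trans ltr01).
(* Raising the coefficients to at least [d] changes the vector by at most n d, which contributes at
   most [e] after multiplication by [M]. The successor avoids a division by zero. *)
pose d := e / (n.+1%:R * M); have d0 : 0 < d by rewrite divr_gt0.
have [_ h] := est n (t d) (fun i => t0 d i d0).
have aT : S `^ al <= (\sum_(i < n) t d i `^ p) `^ al.
  apply: pow_le => //; apply: ler_sum => i _; apply: ge0_ler_powR; rewrite ?nnegrE ?absv_ge0 ?(ltW p0)//.
    by rewrite ltW// t0.
  by rewrite le_max lexx.
apply: (le_trans aT); apply: (le_trans h).
have split_t : \sum_(i < n) ofreal (t d i) *: z i =
    \sum_(i < n) ofreal (absv (a i)) *: z i + \sum_(i < n) ofreal (t d i - absv (a i)) *: z i.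
  by rewrite -big_split /=; apply: eq_bigr => i _; rewrite -scalerDl -ofrealD addrC subrK.
have b1 : rn (\sum_(i < n) ofreal (absv (a i)) *: z i) <= D * rn (vsum z a).
  rewrite -(@vsum_trunc _ _ _ n z (fun i => ofreal (absv (a i)))); apply: uz => // i.
  rewrite /trunc; case: ltnP => _; last by rewrite absv0 absv_ge0.
  by rewrite absv_ofreal ger0_norm// absv_ge0.
have b2 : rn (\sum_(i < n) ofreal (t d i - absv (a i)) *: z i) <= n.+1%:R * d.
  apply: (le_trans (rn_sum _ _ _)); apply: (@le_trans _ _ (\sum_(i < n) d)).
    apply: ler_sum => i _; rewrite rnZ nz mulr1 absv_ofreal ger0_norm.
      rewrite lerBlDl /t; case: (leP (absv (a i)) d) => _; first by rewrite lerDr absv_ge0.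
      by rewrite lerDl ltW.
    by rewrite subr_ge0 /t le_max lexx.
  by rewrite sumr_const card_ord -[leLHS]mulr_natl ler_wpM2r ?(ltW d0)// ler_nat.
rewrite split_t; apply: (@le_trans _ _ (M * (D * rn (vsum z a) + n.+1%:R * d))).
  by rewrite ler_wpM2l// (le_trans (rnD _ _))// lerD.
have dE : M * (n.+1%:R * d) = e by rewrite mulrA (mulrC M) /d [LHS]mulrC divfK ?gt_eqF.
by rewrite mulrDr mulrA dE.
Qed.

End Power.

End Estimates.

End PowerNorm.

(** * Rademacher vectors *)

Section Rademacher.
Variables (R : realType) (k : scalar_kind).
Local Notation K := (scalars R k).
Local Notation absv := (@absv R k).
Local Notation ofreal := (@ofreal R k).

(** From exp y <= 1 / (1 - y) <= 1 + y + 2 y^2 for y up to 1/2; the linear terms cancel. *)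
Lemma cosh_bound (x : R) : `|x| <= 2^-1 -> expR x + expR (- x) <= 2 * expR (2 * x ^+ 2).
Proof.
have half y : y <= 2^-1 -> expR y <= 1 + y + 2 * y ^+ 2 :> R.
  move=> y2; have h : 1 - y <= expR (- y) by exact: expR_ge1Dx.
  have y1 : 0 < 1 - y by lra.
  have -> : expR y = (expR (- y))^-1 by rewrite expRN invrK.
  apply: (@le_trans _ _ (1 - y)^-1); first by rewrite lef_pV2 ?posrE ?expR_gt0.
  rewrite -[leLHS]mul1r ler_pdivrMr//.
  rewrite -subr_ge0 (_ : _ - 1 = y ^+ 2 * (1 - 2 * y)); last by ring.
  by rewrite mulr_ge0 ?sqr_ge0//; lra.
rewrite ler_norml => /andP[h1 h2]; have e1 := half _ h2.
have e2 : expR (- x) <= 1 - x + 2 * x ^+ 2 by have := half (- x); rewrite sqrrN; apply; lra.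
have e3 := expR_ge1Dx (2 * x ^+ 2); lra.
Qed.

(** From ln (t / q) < t / q. It reduces moments to exponential moments. *)
Lemma powR_le_expR (q t : R) : 0 < q -> 0 <= t -> t `^ q <= q `^ q * expR t.
Proof.
move=> q0; rewrite le_eqVlt => /orP[/eqP <-|t0].
  by rewrite powR0 ?gt_eqF// mulr_ge0 ?powR_ge0 ?expR_ge0.
rewrite /powR !gt_eqF// -expRD ler_expR.
have : ln (t / q) < t / q by apply: ln_sublinear; rewrite divr_gt0.
rewrite ln_div ?posrE// ltr_pdivlMr// => /ltW.
by rewrite mulrBl; lra.
Qed.

Definition sign (b : bool) : R := (-1) ^+ b.

Lemma signK b : sign b * sign b = 1.
Proof. by rewrite /sign -signr_addb addbb. Qed.

Lemma normr_sign b : `|sign b| = 1.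
Proof. by rewrite /sign normr_sign. Qed.

Section Block.
Variable m : nat.
Local Notation T := {ffun 'I_m -> bool}.

Lemma card_signs : #|{: T}| = (2 ^ m)%N.
Proof. by rewrite card_ffun card_bool card_ord. Qed.

(** Independence of the signs factors the exponential moment into hyperbolic cosines. *)
Lemma sum_exp_signs (b : 'I_m -> R) : \sum_i b i ^+ 2 <= 4^-1 ->
  \sum_(s : T) expR (\sum_i b i * sign (s i)) <= (2 ^ m)%:R * expR 2^-1.
Proof.
move=> b4.
have bi i : `|b i| <= 2^-1.
  rewrite -[leRHS]ger0_norm// -ler_sqr ?nnegrE// ?normr_ge0// !real_normK ?num_real//.
  apply: le_trans (_ : \sum_i b i ^+ 2 <= _).
    by rewrite (bigD1 i)//= lerDl sumr_ge0// => j _; exact: sqr_ge0.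
  by apply: (le_trans b4); rewrite expr2; lra.
have -> : \sum_(s : T) expR (\sum_i b i * sign (s i)) = \prod_i (expR (b i) + expR (- b i)).
  rewrite (eq_bigr (fun s : T => \prod_i expR (b i * sign (s i)))); last by move=> s _; rewrite expR_sum.
  rewrite -(bigA_distr_bigA (fun i c => expR (b i * sign c))).
  by apply: eq_bigr => i _; rewrite big_bool /= /sign expr0 expr1 mulr1 mulrN1 addrC.
apply: (@le_trans _ _ (\prod_(i < m) (2 * expR (2 * b i ^+ 2)))).
  by apply: ler_prod => i _; rewrite addr_ge0 ?expR_ge0//= cosh_bound.
rewrite big_split /= prodr_const card_ord natrX ler_wpM2l ?exprn_ge0//.
rewrite -expR_sum ler_expR -mulr_sumr; lra.
Qed.

Lemma real_khintchine (q : R) (b : 'I_m -> R) : 0 < q -> \sum_i b i ^+ 2 <= 4^-1 ->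
  \sum_(s : T) `|\sum_i b i * sign (s i)| `^ q <= (2 ^ m)%:R * (q `^ q * (2 * expR 2^-1)).
Proof.
move=> q0 b4.
apply: (@le_trans _ _ (\sum_(s : T) q `^ q * (expR (\sum_i b i * sign (s i)) + expR (\sum_i - b i * sign (s i))))).
  apply: ler_sum => s _; set x := \sum_i _.
  have -> : \sum_i - b i * sign (s i) = - x by rewrite -sumrN; apply: eq_bigr => i _; rewrite mulNr.
  apply: (le_trans (powR_le_expR q0 (normr_ge0 _))).
  rewrite ler_wpM2l ?powR_ge0//; have := expR_ge0 x; have := expR_ge0 (- x).
  by have [_|_] := ger0P x; lra.
rewrite -mulr_sumr big_split /=.
have h1 := sum_exp_signs b4.
have h2 : \sum_(s : T) expR (\sum_i - b i * sign (s i)) <= (2 ^ m)%:R * expR 2^-1.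
  by apply: sum_exp_signs; under eq_bigr do rewrite sqrrN.
rewrite mulrCA ler_wpM2l ?powR_ge0// mulrCA.
lra.
Qed.

Definition rademacher (b : 'I_m -> K) (s : T) : K := \sum_i b i * ofreal (sign (s i)).
(** The coefficient of [f] along the i-th Rademacher function, for the uniform probability on the
    cube. *)
Definition fourier (f : T -> K) (i : 'I_m) : K := ofreal (2 ^ m)%:R^-1 * \sum_(s : T) f s * ofreal (sign (s i)).
Definition l2norm (b : 'I_m -> K) : R := Num.sqrt (\sum_i absv (b i) ^+ 2).

Lemma l2norm_ge0 b : 0 <= l2norm b. Proof. exact: sqrtr_ge0. Qed.

Lemma l2norm_sqr b : l2norm b ^+ 2 = \sum_i absv (b i) ^+ 2.
Proof. by rewrite sqr_sqrtr// sumr_ge0// => i _; exact: sqr_ge0. Qed.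

Lemma l2norm_le b b' : (forall i, absv (b' i) <= absv (b i)) -> l2norm b' <= l2norm b.
Proof.
move=> bb; apply: ler_wsqrtr; apply: ler_sum => i _.
by rewrite lerXn2r ?nnegrE ?absv_ge0.
Qed.

Lemma l2norm_eq0 b : l2norm b = 0 -> forall i, b i = 0.
Proof.
move=> b0 i; apply: absv0_eq0; apply/eqP; rewrite -sqrf_eq0.
have := l2norm_sqr b; rewrite b0 expr0n /= => /esym/eqP.
rewrite psumr_eq0 => [/allP/(_ i)|j _]; last exact: sqr_ge0.
by rewrite mem_index_enum => /(_ isT).
Qed.

Lemma rademacherZ c b s : rademacher (fun i => c * b i) s = c * rademacher b s.
Proof. by rewrite /rademacher mulr_sumr; apply: eq_bigr => i _; rewrite mulrA. Qed.

Lemma additive_rademacher (g : K -> R) (b : 'I_m -> K) (s : T) :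
  (forall x y, g (x + y) = g x + g y) -> (forall x, g (- x) = - g x) ->
  g (rademacher b s) = \sum_i g (b i) * sign (s i).
Proof.
move=> gD gN; have g0 : g 0 = 0.
  by apply: (addrI (g 0)); rewrite -gD !addr0.
rewrite /rademacher (big_morph _ gD g0); apply: eq_bigr => i _.
rewrite /sign; case: (s i); rewrite ?expr0 ?expr1 ?mulr1 ?mulrN1 ?ofrealN ?ofreal1 ?mulr1//.
by rewrite mulrN1 gN.
Qed.

(** The first power of 2 undoes the scaling to l_2 norm 1/2, the next two factors combine real and
    imaginary parts, and the rest is the real case. *)
Definition khintchine_constant (q : R) : R := 2 `^ q * (2 `^ q * (2 * (q `^ q * (2 * expR 2^-1)))).

Lemma khintchine_constant_ge0 q : 0 <= khintchine_constant q.
Proof. by rewrite !mulr_ge0 ?powR_ge0 ?expR_ge0. Qed.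

Lemma khintchine (q : R) (b : 'I_m -> K) : 0 < q ->
  \sum_(s : T) absv (rademacher b s) `^ q <= (2 ^ m)%:R * (khintchine_constant q * l2norm b `^ q).
Proof.
move=> q0.
have small (c : 'I_m -> K) : \sum_i absv (c i) ^+ 2 <= 4^-1 ->
    \sum_(s : T) absv (rademacher c s) `^ q <= (2 ^ m)%:R * (2 `^ q * (2 * (q `^ q * (2 * expR 2^-1)))).
  move=> c4.
  have part (g : K -> R) : (forall x y, g (x + y) = g x + g y) -> (forall x, g (- x) = - g x) ->
      (forall x, `|g x| <= absv x) ->
      \sum_(s : T) `|g (rademacher c s)| `^ q <= (2 ^ m)%:R * (q `^ q * (2 * expR 2^-1)).
    move=> gD gN gle; under eq_bigr do rewrite (additive_rademacher _ _ gD gN).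
    apply: real_khintchine => //; apply: le_trans c4; apply: ler_sum => i _.
    by rewrite -[leLHS]ger0_norm ?sqr_ge0// normrX lerXn2r ?nnegrE ?absv_ge0.
  have h1 := part _ (@rpartD R k) (@rpartN R k) (@rpart_le R k).
  have h2 := part _ (@ipartD R k) (@ipartN R k) (@ipart_le R k).
  apply: (@le_trans _ _ (\sum_(s : T) 2 `^ q * (`|rpart (rademacher c s)| `^ q + `|ipart (rademacher c s)| `^ q))).
    apply: ler_sum => s _; set x := rademacher c s.
    have mx : absv x <= 2 * Num.max `|rpart x| `|ipart x|.
      rewrite (le_trans (absv_le_parts x))// mulr2n mulrDl mul1r lerD// le_max lexx ?orbT//.
    have mx0 : 0 <= Num.max `|rpart x| `|ipart x| by rewrite le_max normr_ge0.
    have := ge0_ler_powR (ltW q0) _ _ mx; rewrite !nnegrE absv_ge0 mulr_ge0// => /(_ isT isT).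
    rewrite powRM// => /le_trans; apply; rewrite ler_wpM2l ?powR_ge0//.
    by case: (leP `|rpart x| `|ipart x|) => _; rewrite ?lerDl ?lerDr powR_ge0.
  rewrite -mulr_sumr big_split /= mulrCA ler_wpM2l ?powR_ge0//.
  lra.
have [u0|u0] := eqVneq (l2norm b) 0.
  rewrite u0 powR0 ?gt_eqF// !mulr0 big1// => s _.
  rewrite /rademacher big1 ?absv0 ?powR0 ?gt_eqF// => i _.
  by rewrite (l2norm_eq0 u0) mul0r.
have {}u0 : 0 < l2norm b by rewrite lt_neqAle eq_sym u0 l2norm_ge0.
(* Scaling by r makes the l2 norm of b equal to 1/2. *)
pose r := (2 * l2norm b)^-1; have r0 : 0 < r by rewrite invr_gt0 mulr_gt0.
have small_r : \sum_i absv (ofreal r * b i) ^+ 2 <= 4^-1.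
  rewrite (eq_bigr (fun i => r ^+ 2 * absv (b i) ^+ 2)); last first.
    by move=> i _; rewrite absvM absv_ofreal gtr0_norm// exprMn.
  rewrite -mulr_sumr -l2norm_sqr -exprMn /r invfM -mulrA mulVf ?gt_eqF// mulr1.
  by rewrite expr2; lra.
have := small _ small_r.
rewrite (eq_bigr (fun s => r `^ q * absv (rademacher b s) `^ q)); last first.
  by move=> s _; rewrite rademacherZ absvM absv_ofreal gtr0_norm// powRM ?absv_ge0 ?ltW.
rewrite -mulr_sumr => h; set S := \sum_(s : T) _ in h *.
have inv : (2 * l2norm b) `^ q * r `^ q = 1.
  by rewrite -powRM ?mulr_ge0 ?l2norm_ge0 ?(ltW r0)// mulfV ?powR1// mulf_neq0 ?gt_eqF.
have -> : S = (2 * l2norm b) `^ q * (r `^ q * S) by rewrite mulrA inv mul1r.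
apply: (le_trans (ler_wpM2l (powR_ge0 _ _) h)).
rewrite powRM ?l2norm_ge0// /khintchine_constant le_eqVlt; apply/orP; left; apply/eqP; ring.
Qed.

(* Duality against the Rademacher sum with coefficients c such that
   c_i b_i = |b_i|^2, where b is the Fourier transform of f. *)
Lemma fourier_bound (p q : R) (f : T -> K) : 0 < p -> 0 < q -> p^-1 + q^-1 = 1 ->
  (2 ^ m)%:R * l2norm (fourier f) `^ p <=
  (1 + khintchine_constant q) `^ p * \sum_(s : T) absv (f s) `^ p.
Proof.
move=> p0 q0 pq; set b := fourier f; set u := l2norm b.
set S := \sum_(s : T) _; pose N : R := (2 ^ m)%:R.
have N0 : 0 < N by rewrite ltr0n expn_gt0.
have S0 : 0 <= S by rewrite sumr_ge0// => s _; exact: powR_ge0.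
have B0 := khintchine_constant_ge0 q.
have [u0|u0] := eqVneq u 0.
  by rewrite u0 powR0 ?gt_eqF// mulr0 mulr_ge0 ?powR_ge0.
have {}u0 : 0 < u by rewrite lt_neqAle eq_sym u0 l2norm_ge0.
pose c i : K := if b i == 0 then 0 else ofreal (absv (b i) ^+ 2) / b i.
have cb i : c i * b i = ofreal (absv (b i) ^+ 2).
  rewrite /c; case: eqP => [->|/eqP bi]; last by rewrite divfK.
  by rewrite mul0r absv0 expr0n ofreal0.
have cl : l2norm c = u.
  rewrite /u /l2norm; congr Num.sqrt; apply: eq_bigr => i _; congr (_ ^+ 2).
  rewrite /c; case: eqP => [->//|/eqP bi].
  by rewrite absvM absvV absv_ofreal ger0_norm ?sqr_ge0// expr2 mulfK// gt_eqF// absv_gt0.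
have sumE : ofreal (u ^+ 2) = ofreal N^-1 * \sum_(s : T) f s * rademacher c s.
  rewrite l2norm_sqr.
  have -> : ofreal (\sum_i absv (b i) ^+ 2) = \sum_i c i * b i.
    rewrite (big_morph ofreal (@ofrealD R k) (ofreal0 R k)).
    by apply: eq_bigr => i _; rewrite cb.
  under eq_bigr do rewrite /b /fourier mulrCA.
  rewrite -mulr_sumr; congr (_ * _).
  under eq_bigr do rewrite mulr_sumr.
  rewrite exchange_big /=; apply: eq_bigr => s _.
  by rewrite /rademacher mulr_sumr; apply: eq_bigr => i _; rewrite mulrCA.
have u2 : N * u ^+ 2 <= \sum_(s : T) absv (f s) * absv (rademacher c s).
  have := congr1 absv sumE; rewrite absvM !absv_ofreal !ger0_norm ?invr_ge0 ?sqr_ge0 ?(ltW N0)// => ->.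
  rewrite mulVKf ?gt_eqF//.
  elim/big_rec2: _ => [|s x y _ h]; first by rewrite absv0.
  by rewrite (le_trans (absvD _ _))// absvM lerD2l.
have [Sz|Sz] := eqVneq S 0.
  have fz s : absv (f s) = 0.
    apply: (powR_eq0_eq0 (p := p)); apply/eqP.
    have := Sz; rewrite /S => /eqP; rewrite psumr_eq0 => [/allP/(_ s)|s' _]; last exact: powR_ge0.
    by rewrite mem_index_enum => /(_ isT).
  move: u2; rewrite big1 => [|s _]; last by rewrite fz mul0r.
  by rewrite leNgt mulr_gt0 ?exprn_gt0.
have {}S0 : 0 < S by rewrite lt_neqAle eq_sym Sz.
(* The L_p mean of [f]. In Young's inequality for |f| / phi and the Rademacher sum divided by [u],
   the two averages are 1 and at most the Khintchine constant. *)
pose phi := (S / N) `^ p^-1.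
have phi0 : 0 < phi by rewrite powR_gt0// divr_gt0.
have phip : phi `^ p = S / N by rewrite -powRrM mulVf ?gt_eqF// powRr1// divr_ge0 ?ltW.
have young s : absv (f s) * absv (rademacher c s) <=
    phi * u * ((absv (f s) `^ p / phi `^ p) + absv (rademacher c s) `^ q / u `^ q).
  have h := @conjugate_powR R (absv (f s) / phi) (absv (rademacher c s) / u) p q.
  have {}h := h (divr_ge0 (absv_ge0 _) (ltW phi0)) (divr_ge0 (absv_ge0 _) (ltW u0)) p0 q0 pq.
  have p1 : p^-1 <= 1 by rewrite -pq lerDl invr_ge0 ltW.
  have q1 : q^-1 <= 1 by rewrite -pq lerDr invr_ge0 ltW.
  have dE (x y r : R) : 0 <= x -> 0 < y -> (x / y) `^ r = x `^ r / y `^ r.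
    move=> x0 y0; rewrite powRM ?invr_ge0 ?(ltW y0)//; congr (_ * _).
    by rewrite -(powR_inv1 (ltW y0)) -powRrM mulN1r powRN.
  have E : absv (f s) * absv (rademacher c s) =
      phi * u * (absv (f s) / phi * (absv (rademacher c s) / u)).
    by field; rewrite !gt_eqF.
  rewrite E ler_wpM2l ?mulr_ge0 ?(ltW phi0) ?(ltW u0)// (le_trans h)// !dE ?absv_ge0//.
  by rewrite lerD// ler_piMr// divr_ge0 ?powR_ge0.
have main : N * u ^+ 2 <= phi * u * (N + N * khintchine_constant q).
  apply: (le_trans u2); apply: (le_trans (ler_sum _ (fun s _ => young s))).
  rewrite -mulr_sumr ler_wpM2l ?mulr_ge0 ?(ltW phi0) ?(ltW u0)//.
  rewrite big_split /= -!mulr_suml phip lerD//.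
    by rewrite -/S invf_div mulrCA mulfV ?gt_eqF// mulr1.
  rewrite ler_pdivrMr ?powR_gt0// -mulrA -cl; exact: khintchine.
have uphi : u <= phi * (1 + khintchine_constant q).
  rewrite -(ler_pM2l (mulr_gt0 N0 u0)).
  rewrite (_ : N * u * u = N * u ^+ 2); last by rewrite expr2 mulrA.
  apply: (le_trans main); rewrite le_eqVlt; apply/orP; left; apply/eqP; ring.
have up : u `^ p <= (phi * (1 + khintchine_constant q)) `^ p.
  apply: ge0_ler_powR; rewrite ?nnegrE ?(ltW p0) ?(ltW u0)// mulr_ge0 ?(ltW phi0)//.
  by rewrite addr_ge0.
rewrite powRM ?(ltW phi0) ?addr_ge0// phip in up.
apply: (@le_trans _ _ (N * (S / N * (1 + khintchine_constant q) `^ p))).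
  by rewrite ler_wpM2l// ltW.
rewrite le_eqVlt; apply/orP; left; apply/eqP; field; rewrite gt_eqF//.
Qed.

(** Orthogonality: for distinct indices, flipping the i-th sign negates the sum. *)
Lemma sum_signs (i j : 'I_m) :
  \sum_(s : T) sign (s j) * sign (s i) = (2 ^ m)%:R * (j == i)%:R.
Proof.
have [->|ji] := eqVneq j i.
  under eq_bigr do rewrite signK.
  by rewrite sumr_const card_signs mulr1.
rewrite mulr0; set S := \sum_(s : T) _.
pose flip (s : T) : T := [ffun l => if l == i then ~~ s l else s l].
have flipK : involutive flip.
  by move=> s; apply/ffunP => l; rewrite !ffunE; case: (l == i); rewrite ?negbK.
suff : S = - S by move=> h; lra.
rewrite {1}/S (reindex_inj (can_inj flipK)) /= -sumrN; apply: eq_bigr => s _.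
by rewrite !ffunE eqxx (negbTE ji) /sign signrN mulrN.
Qed.

Lemma fourier_rademacher (b : 'I_m -> K) : fourier (rademacher b) =1 b.
Proof.
move=> i; rewrite /fourier /rademacher.
under eq_bigr do rewrite mulr_suml.
rewrite exchange_big /=.
rewrite (eq_bigr (fun j => b j * ofreal ((2 ^ m)%:R * (j == i)%:R))); last first.
  move=> j _; rewrite -sum_signs (big_morph ofreal (@ofrealD R k) (ofreal0 R k)) mulr_sumr.
  by apply: eq_bigr => s _; rewrite -mulrA ofrealM.
rewrite (bigD1 i)//= eqxx big1 => [|j /negbTE ->]; last by rewrite mulr0 ofreal0 mulr0.
by rewrite addr0 mulr1 mulrCA -ofrealM mulVf ?ofreal1 ?mulr1// pnatr_eq0 expn_eq0.
Qed.

Lemma rademacher_linear c b b' s :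
  rademacher (fun i => c * b i + b' i) s = c * rademacher b s + rademacher b' s.
Proof.
rewrite /rademacher mulr_sumr -big_split /=.
by apply: eq_bigr => i _; rewrite mulrDl mulrA.
Qed.

Lemma fourier_linear c f f' i :
  fourier (fun s => c * f s + f' s) i = c * fourier f i + fourier f' i.
Proof.
rewrite /fourier mulrCA -mulrDr; congr (_ * _).
by rewrite mulr_sumr -big_split /=; apply: eq_bigr => s _; rewrite mulrDl mulrA.
Qed.

(** Only the l_2 norm of [b] enters. This one estimate therefore yields both the boundedness of the
    Rademacher projection and the unconditionality of its range. *)
Lemma rademacher_dominated (p q : R) (f : T -> K) b :
  0 < p -> 0 < q -> p^-1 + q^-1 = 1 -> l2norm b <= l2norm (fourier f) ->
  \sum_(s : T) absv (rademacher b s) `^ p <=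
  khintchine_constant p * (1 + khintchine_constant q) `^ p * \sum_(s : T) absv (f s) `^ p.
Proof.
move=> p0 q0 pq bf; apply: (le_trans (khintchine b p0)).
rewrite mulrCA -mulrA; apply: ler_wpM2l; first exact: khintchine_constant_ge0.
apply: le_trans (fourier_bound f p0 q0 pq); apply: ler_wpM2l => //.
by apply: ge0_ler_powR; rewrite ?nnegrE ?l2norm_ge0 ?(ltW p0).
Qed.

End Block.
End Rademacher.

(** * Rademacher vectors on blocks of the basis, and the exponent 2 *)

Section RademacherBlocks.
Variables (R : realType) (k : scalar_kind).
Local Notation K := (scalars R k).
Local Notation absv := (@absv R k).
Local Notation ofreal := (@ofreal R k).

(** Block (n, c) is the c-th copy of the sign cube of dimension n + 1. *)
Definition sign_cell := {nc : nat * nat & {ffun 'I_nc.1.+1 -> bool}}.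
Definition sign_index := {n : nat & 'I_n.+1}.

Local Notation Q := sign_cell.
Local Notation J := sign_index.
Local Notation Cell nc s := (existT (fun p : nat * nat => {ffun 'I_p.1.+1 -> bool}) nc s : Q).
Local Notation Ix n i := (existT (fun m : nat => 'I_m.+1) n i : J).

(** Any injection will do: under [power_type] positions affect norms by a constant factor only, so
    no order has to be preserved as it was for averages. *)
Definition cell_pos (q : Q) : nat := pickle q.

Lemma cell_pos_inj : injective cell_pos.
Proof. exact: pcan_inj pickleK. Qed.

Definition synth_cells (b : J * nat -> K^o) : Q -> K^o :=
  fun q => rademacher (fun i => b (Ix (tag q).1 i, (tag q).2)) (tagged q).

Definition synth (b : J * nat -> K^o) : nat -> K^o := push cell_pos (synth_cells b).

Definition analysis_cells (f : Q -> K^o) : J * nat -> K^o :=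
  fun p => fourier (fun s => f (Cell (tag p.1, p.2) s)) (tagged p.1).

Definition analysis (a : nat -> K^o) : J * nat -> K^o := analysis_cells (a \o cell_pos).

Lemma synth_linear : linear synth.
Proof.
move=> c a b; rewrite /synth -(push_linear cell_pos_inj); congr push.
apply/funext => q.
exact: (rademacher_linear c (fun i => a (Ix (tag q).1 i, (tag q).2)) (fun i => b (Ix (tag q).1 i, (tag q).2)) (tagged q)).
Qed.

Lemma analysis_linear : linear analysis.
Proof.
move=> c a b; apply/funext => p; pose f (a : nat -> K) s := a (cell_pos (Cell (tag p.1, p.2) s)).
exact: (fourier_linear c (f a) (f b) (tagged p.1)).
Qed.

HB.instance Definition _ := GRing.isLinear.Build K _ _ _ synth synth_linear.
HB.instance Definition _ := GRing.isLinear.Build K _ _ _ analysis analysis_linear.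

Lemma analysis_synth b : analysis (synth b) = b.
Proof.
apply/funext => -[[n i] c]; rewrite /analysis /analysis_cells /=.
rewrite (_ : (fun s => _) = rademacher (fun i => b (Ix n i, c))); first exact: fourier_rademacher.
by apply/funext => s; rewrite /synth /= push_in//; exact: cell_pos_inj.
Qed.

Lemma powR_root_le (r c x y : R) : 0 < r -> 0 <= c -> 0 <= x -> 0 <= y ->
  x `^ r^-1 <= c * y `^ r^-1 -> x <= c `^ r * y.
Proof.
move=> r0 c0 x0 y0 h; have rK w : 0 <= w -> (w `^ r^-1) `^ r = w.
  by move=> w0; rewrite -powRrM mulVf ?gt_eqF// powRr1.
rewrite -[leLHS]rK// -[y in leRHS]rK// -powRM ?powR_ge0//.
by apply: ge0_ler_powR; rewrite ?nnegrE ?mulr_ge0 ?powR_ge0 ?(ltW r0).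
Qed.

Lemma powR_exponent_le (s t c : R) :
  (forall n, (0 < n)%N -> n%:R `^ s <= c * n%:R `^ t) -> s <= t.
Proof.
move=> h; rewrite leNgt; apply/negP => ts; pose d := s - t.
have d0 : 0 < d by rewrite subr_gt0.
have c1 : 1 <= c by have := h 1%N isT; rewrite !powR1 mulr1.
pose n := Num.bound ((c + 1) `^ d^-1).
have nc : (c + 1) `^ d^-1 < n%:R by apply: archi_boundP; exact: powR_ge0.
have n0 : 0 < n%:R :> R by apply: le_lt_trans nc; exact: powR_ge0.
have := h n; rewrite -(ltr0n R) n0 => /(_ isT).
rewrite (_ : s = d + t); last by rewrite subrK.
rewrite powRD ?(gt_eqF n0) ?implybT// ler_pM2r ?powR_gt0//; apply/negP; rewrite -ltNge.
apply: (@lt_le_trans _ _ (c + 1)); first by rewrite ltrDl.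
rewrite -[leLHS](@powRr1 _ (c + 1)) ?addr_ge0 ?(le_trans ler01 c1)//.
have dn0 : d != 0 by rewrite gt_eqF.
rewrite -[X in _ `^ X <= _](mulVf dn0) powRrM.
by apply: ge0_ler_powR; rewrite ?nnegrE ?powR_ge0 ?ltW.
Qed.

Definition in_blocks (L : seq (nat * nat)) (f : Q -> K) := forall q, tag q \notin L -> f q = 0.
Definition in_rows (L : seq (nat * nat)) (b : J * nat -> K) :=
  forall p, (tag p.1, p.2) \notin L -> b p = 0.

Definition block_cells (L : seq (nat * nat)) : seq Q :=
  [seq Cell nc s | nc <- L, s <- enum {: {ffun 'I_nc.1.+1 -> bool}}].

Lemma supp_block_cells L f : uniq L -> in_blocks L f -> supp_in (block_cells L) f.
Proof.
move=> uL Lf; split.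
  apply: allpairs_uniq_dep => // [nc _|[? ?] [? ?] _ _ e]; first exact: enum_uniq.
  exact: e.
move=> [nc s] nq; apply: Lf; apply: contra nq => ncL.
by apply/allpairsPdep; exists nc, s; rewrite mem_enum.
Qed.

Lemma sum_block_cells L (F : Q -> R) :
  \sum_(q <- block_cells L) F q = \sum_(nc <- L) \sum_s F (Cell nc s).
Proof. by rewrite big_allpairs_dep; apply: eq_bigr => nc _; rewrite big_enum. Qed.

Lemma fsupp_blocks f : fsupp f -> exists2 L, uniq L & in_blocks L f.
Proof.
move=> [s [us sf]]; exists (undup (map tag s)); first exact: undup_uniq.
move=> q; rewrite mem_undup => nq; apply: sf.
by apply: contra nq => qs; exact: map_f.
Qed.

Lemma fsupp_rows b : fsupp b -> exists2 L, uniq L & in_rows L b.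
Proof.
move=> [s [us sb]]; exists (undup [seq (tag p.1, p.2) | p <- s]); first exact: undup_uniq.
move=> p; rewrite mem_undup => np; apply: sb.
by apply: contra np => ps; apply/mapP; exists p.
Qed.

Lemma rows_fsupp L b : uniq L -> in_rows L b -> fsupp b.
Proof.
move=> uL Lb; exists (undup [seq (Ix nc.1 i, nc.2) | nc <- L, i <- enum 'I_nc.1.+1]).
split; first exact: undup_uniq.
move=> [[n i] c] np; apply: Lb; apply: contra np => /= ncL; rewrite mem_undup.
by apply/allpairsPdep; exists (n, c), i; rewrite mem_enum.
Qed.

Lemma synth_in_blocks L b : in_rows L b -> in_blocks L (synth_cells b).
Proof.
move=> Lb [nc s] /= ncL; rewrite /synth_cells /rademacher big1// => i _.
by rewrite Lb ?mul0r//= -surjective_pairing.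
Qed.

Lemma analysis_in_rows L f : in_blocks L f -> in_rows L (analysis_cells f).
Proof.
move=> Lf [[n i] c] /= ncL; rewrite /analysis_cells /fourier big1 ?mulr0// => s _.
by rewrite Lf ?mul0r.
Qed.

Lemma synth_cells_fsupp b : fsupp b -> fsupp (synth_cells b).
Proof.
move=> /fsupp_rows[L uL Lb]; exists (block_cells L).
by apply: supp_block_cells => //; exact: synth_in_blocks.
Qed.

Lemma synth_fsupp b : fsupp b -> fsupp (synth b).
Proof. by move=> fb; apply: push_fsupp; [exact: cell_pos_inj|exact: synth_cells_fsupp]. Qed.

Lemma analysis_fsupp a : fsupp a -> fsupp (analysis a).
Proof.
move=> fa; have /fsupp_blocks[L uL La] : fsupp (a \o cell_pos).
  by apply: comp_fsupp => //; exact: cell_pos_inj.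
by apply: (rows_fsupp uL); exact: analysis_in_rows.
Qed.

Section PowerType.
Variables (X : completeNormedModType K) (Y : set X) (z : nat -> X) (D p q M : R).
Hypotheses (bz : normalized_unconditional_basis Y z) (uz : uncond D z) (zY : closed_span z = Y)
  (Yu : unique_normalized_unconditional_basis Y) (p0 : 0 < p) (q0 : 0 < q)
  (pq : p^-1 + q^-1 = 1) (M1 : 1 <= M) (zp : power_type z p M).

Local Notation N a := (rn (vsum z a)).
Local Notation P := (push cell_pos).
Local Notation mass f nc := (\sum_s absv (f (Cell nc s)) `^ p).

Let M0 : 0 <= M. Proof. exact: le_trans M1. Qed.

Let pV0 : 0 <= p^-1. Proof. by rewrite invr_ge0 ltW. Qed.

Let mass_ge0 (f : Q -> K) (nc : nat * nat) : 0 <= mass f nc.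
Proof. by rewrite sumr_ge0// => s _; exact: powR_ge0. Qed.

Lemma cell_norm L f : uniq L -> in_blocks L f ->
  N (P f) <= M * (\sum_(nc <- L) mass f nc) `^ p^-1 /\
  (\sum_(nc <- L) mass f nc) `^ p^-1 <= M * N (P f).
Proof.
move=> uL Lf; have sf := push_supp cell_pos_inj (supp_block_cells uL Lf).
have := zp sf; rewrite /pnorm big_map sum_block_cells.
suff -> : \sum_(nc <- L) \sum_s absv (P f (cell_pos (Cell nc s))) `^ p = \sum_(nc <- L) mass f nc by [].
by apply: eq_bigr => nc _; apply: eq_bigr => s _; rewrite push_in//; exact: cell_pos_inj.
Qed.

Lemma cell_compare L L' f f' B : 0 <= B -> uniq L -> uniq L' -> in_blocks L f -> in_blocks L' f' ->
  \sum_(nc <- L') mass f' nc <= B * \sum_(nc <- L) mass f nc ->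
  N (P f') <= M * M * B `^ p^-1 * N (P f).
Proof.
move=> B0 uL uL' Lf Lf' ff'; have [h _] := cell_norm uL' Lf'.
apply: (le_trans h); rewrite -!mulrA; apply: ler_wpM2l => //.
have s0 (l : seq (nat * nat)) (g : Q -> K) : 0 <= \sum_(nc <- l) mass g nc.
  by rewrite sumr_ge0.
apply: (@le_trans _ _ ((B * \sum_(nc <- L) mass f nc) `^ p^-1)).
  by apply: ge0_ler_powR; rewrite ?nnegrE ?mulr_ge0.
rewrite powRM// mulrCA; apply: ler_wpM2l; first exact: powR_ge0.
by have [_] := cell_norm uL Lf.
Qed.

Let B := khintchine_constant p * (1 + khintchine_constant q) `^ p.

Let B0 : 0 <= B.
Proof. by rewrite mulr_ge0 ?powR_ge0 ?khintchine_constant_ge0. Qed.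

Lemma block_compare L f f' : uniq L -> in_blocks L f -> in_blocks L f' ->
  (forall nc, mass f' nc <= B * mass f nc) -> N (P f') <= M * M * B `^ p^-1 * N (P f).
Proof.
move=> uL Lf Lf' ff'; apply: (cell_compare B0 uL uL Lf Lf').
by rewrite mulr_sumr; apply: ler_sum.
Qed.

(** The factor [D] pays for discarding the coordinates outside the range of [cell_pos]. *)
Lemma projection_bound a : fsupp a -> N (synth (analysis a)) <= M * M * B `^ p^-1 * D * N a.
Proof.
move=> fa; have fc : fsupp (a \o cell_pos) by apply: comp_fsupp => //; exact: cell_pos_inj.
have [L uL La] := fsupp_blocks fc.
apply: (@le_trans _ _ (M * M * B `^ p^-1 * N (P (a \o cell_pos)))).
  apply: (block_compare uL La); first by apply: synth_in_blocks; exact: analysis_in_rows.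
  move=> nc; apply: (@rademacher_dominated _ _ nc.1.+1 p q (fun s => (a \o cell_pos) (Cell nc s))
    (fun i => analysis a (Ix nc.1 i, nc.2)) p0 q0 pq); rewrite le_eqVlt; apply/orP; left; apply/eqP.
  by case: nc.
rewrite -[leRHS]mulrA; apply: ler_wpM2l; first by rewrite !mulr_ge0 ?powR_ge0.
by apply: uz => // i; apply: push_comp_le; exact: cell_pos_inj.
Qed.

Lemma synth_uncond b b' : fsupp b -> (forall p, absv (b' p) <= absv (b p)) ->
  N (synth b') <= M * M * B `^ p^-1 * N (synth b).
Proof.
move=> fb bb; have [L uL Lb] := fsupp_rows fb.
have Lb' : in_rows L b'.
  move=> r rL; apply: absv0_eq0; apply/eqP; rewrite eq_le absv_ge0 andbT.
  by rewrite (le_trans (bb r))// Lb// absv0.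
apply: (block_compare uL); [exact: synth_in_blocks..|].
move=> nc; apply: (@rademacher_dominated _ _ nc.1.+1 p q (fun s => synth_cells b (Cell nc s))
  (fun i => b' (Ix nc.1 i, nc.2)) p0 q0 pq).
rewrite (_ : fourier _ = (fun i => b (Ix nc.1 i, nc.2))); first by apply: l2norm_le => i; exact: bb.
by apply/funext => i; exact: (fourier_rademacher (fun i => b (Ix nc.1 i, nc.2)) i).
Qed.

(** The p-th power mass of a block is the same in every copy, so shifting only renames the
    summands. *)
Lemma synth_up b : fsupp b -> N (synth (copy_up b)) <= M * M * N (synth b).
Proof.
move=> fb; have [L uL Lb] := fsupp_rows fb.
pose L' := [seq (nc.1, nc.2.+1) | nc <- L].
have uL' : uniq L' by rewrite map_inj_uniq// => -[? ?] [? ?] [-> ->].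
have Lb' : in_rows L' (copy_up b).
  move=> [j [|c]] //= nL; rewrite /copy_up /=; apply: Lb.
  by apply: contra nL => jc; apply/mapP; exists (tag j, c).
have := @cell_compare L L' (synth_cells b) (synth_cells (copy_up b)) 1 ler01 uL uL'
  (synth_in_blocks Lb) (synth_in_blocks Lb').
by rewrite powR1 mulr1 mul1r big_map; apply.
Qed.

Lemma synth_down b : fsupp b -> N (synth (copy_down b)) <= M * M * N (synth b).
Proof.
move=> fb; have [L uL Lb] := fsupp_rows fb.
pose L' := [seq (nc.1, nc.2.-1) | nc <- L & (0 < nc.2)%N].
have uL' : uniq L'.
  rewrite map_inj_in_uniq ?filter_uniq// => -[n [|c]] [n' [|c']];
  by rewrite ?mem_filter//= => _ _ [-> ->].
have Lb' : in_rows L' (copy_down b).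
  move=> [j c] nL; rewrite /copy_down /=; apply: Lb.
  by apply: contra nL => jc; apply/mapP; exists (tag j, c.+1); rewrite ?mem_filter.
have := @cell_compare L L' (synth_cells b) (synth_cells (copy_down b)) 1 ler01 uL uL'
  (synth_in_blocks Lb) (synth_in_blocks Lb').
rewrite powR1 mulr1 mul1r big_map big_filter; apply.
rewrite [leRHS](bigID (fun nc => (0 < nc.2)%N)) /=.
rewrite (eq_bigr (fun nc => mass (synth_cells b) nc)); last by move=> [n [|c]].
by rewrite lerDl; apply: sumr_ge0 => nc _; exact: mass_ge0.
Qed.

Let MB := M * M * B `^ p^-1 * D + M * M * B `^ p^-1 + M * M.

Let z0 i : z i != 0.
Proof.
apply/eqP => zi; have := normalized_rn bz.1 i.
by rewrite zi rn0 => /eqP; rewrite eq_sym oner_eq0.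
Qed.

Lemma power_type_exponent : p = 2.
Proof.
have D0 : 0 <= D by apply: le_trans (uncond_ge1 (z0 0%N) uz).
have MM0 : 0 <= M * M by exact: mulr_ge0.
have MMB0 : 0 <= M * M * B `^ p^-1 by rewrite mulr_ge0 ?powR_ge0.
have MMBD0 : 0 <= M * M * B `^ p^-1 * D by rewrite mulr_ge0.
have [MB0 MB1 MB2 MB3] : [/\ 0 <= MB, M * M * B `^ p^-1 * D <= MB,
    M * M * B `^ p^-1 <= MB & M * M <= MB].
  by rewrite /MB; split; lra.
have [||||||r ri [C C0 e]] := @shifted_basis_embeds _ _ _ _ z D bz uz z0 zY Yu J
  analysis synth MB analysis_synth MB0.
- by move=> i; apply: analysis_fsupp; exact: fsupp_dlt.
- by move=> j; apply: synth_fsupp; exact: fsupp_dlt.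
- by move=> a fa; apply: (le_trans (projection_bound fa)); rewrite ler_wpM2r ?rn_ge0.
- by move=> b b' fb bb; apply: (le_trans (synth_uncond fb bb)); rewrite ler_wpM2r ?rn_ge0.
- by move=> b fb; apply: (le_trans (synth_up fb)); rewrite ler_wpM2r ?rn_ge0.
- by move=> b fb; apply: (le_trans (synth_down fb)); rewrite ler_wpM2r ?rn_ge0.
pose A0 := 1 + khintchine_constant q.
have A00 : 0 <= A0 by rewrite addr_ge0 ?khintchine_constant_ge0.
pose T := (M * (C * M)) `^ p; have T0 : 0 <= T by exact: powR_ge0.
pose Mp := M `^ p; have Mp0 : 0 <= Mp by exact: powR_ge0.
(* The comparison is raised to the power [p], so that the block size [W] appears linearly on both
   sides and cancels. The constants do not involve [n]. *)
have key n : n.+1%:R <= Mp * T * khintchine_constant p * n.+1%:R `^ (p / 2) /\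
    n.+1%:R `^ (p / 2) <= A0 `^ p * T * Mp * n.+1%:R.
  pose g (i : 'I_n.+1) : J * nat := (Ix n i, 0%N).
  have gi : injective g.
    by move=> i j [] /eqP; rewrite -tag_eqE /tag_eq /= eqxx /= tagged_asE => /eqP.
  pose w i : X := vsum z (synth (dlt (g i))).
  pose W := 2 ^+ n.+1 : R.
  have W0 : 0 < W by rewrite exprn_gt0.
  have wE (a : 'I_n.+1 -> K) : vsum w a = vsum z (synth (push g a)).
    have fa : fsupp (push g a) by apply: push_fsupp => //; exact: fsupp_ord.
    have fF j : fsupp (synth (dlt j) : nat -> K) by apply: synth_fsupp; exact: fsupp_dlt.
    have [_ ->] := @linear_vsum _ _ _ _ _ z synth (push g a) fF fa.
    by rewrite vsum_push//; exact: fsupp_ord.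
  pose G (a : 'I_n.+1 -> K) : R := \sum_s absv (rademacher a s) `^ p.
  have wG (a : 'I_n.+1 -> K) : rn (vsum w a) <= M * G a `^ p^-1 /\ G a `^ p^-1 <= M * rn (vsum w a).
    have Lb : in_rows [:: (n, 0%N)] (push g a).
      move=> j; rewrite inE => nj; apply: push_out => -[i gj].
      by move: nj; rewrite -gj eqxx.
    have := @cell_norm [:: (n, 0%N)] (synth_cells (push g a)) isT (synth_in_blocks Lb).
    rewrite big_seq1 wE.
    suff -> : mass (synth_cells (push g a)) (n, 0%N) = G a by [].
    apply: eq_bigr => s _; congr (absv _ `^ _); apply: eq_bigr => i _.
    by congr (_ * _); exact: (push_in gi).
  have rootK t : 0 <= t -> (t `^ p) `^ p^-1 = t.
    by move=> t0; rewrite -powRrM mulfV ?gt_eqF// powRr1.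
  have G0 a : 0 <= G a by rewrite sumr_ge0// => s _; exact: powR_ge0.
  have Gdlt i : G (dlt i) = W.
    rewrite /G (eq_bigr (fun=> 1)); first by rewrite sumr_const card_signs natrX.
    move=> s _; rewrite /rademacher (bigD1 i)//= big1 => [|j /negbTE ji].
      by rewrite addr0 /dlt eqxx mul1r absv_ofreal normr_sign powR1.
    by rewrite /dlt ji mul0r.
  (* With coefficients rn (w i) the unitized vectors add up to the sum of the [w i]; [h] is the p-th
     power of the l_p norm of these coefficients. *)
  pose h : R := \sum_(i < n.+1) rn (w i) `^ p.
  have h0 : 0 <= h by rewrite sumr_ge0// => i _; exact: powR_ge0.
  have wi i : rn (w i) <= M * W `^ p^-1 /\ W `^ p^-1 <= M * rn (w i).
    by have := wG (dlt i); rewrite vsum_dlt Gdlt.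
  have Wh : n.+1%:R * W <= Mp * h.
    rewrite /h mulr_sumr mulr_natl -[n.+1 in leLHS]card_ord -sumr_const; apply: ler_sum => i _.
    apply: powR_root_le; rewrite ?(ltW W0) ?powR_ge0// rootK ?rn_ge0//.
    by have [] := wi i.
  have hW : h <= Mp * (n.+1%:R * W).
    rewrite /h mulr_natl -[n.+1 in leRHS]card_ord -sumr_const mulr_sumr; apply: ler_sum => i _.
    apply: powR_root_le; rewrite ?(ltW W0) ?powR_ge0// rootK ?rn_ge0//.
    by have [] := wi i.
  pose a : 'I_n.+1 -> K := fun i => ofreal (rn (w i)).
  have w0 i : w i != 0.
    apply/eqP => w0; have [_] := wi i; rewrite w0 rn0 mulr0 leNgt.
    by rewrite powR_gt0.
  have aw : vsum (unitize w) a = vsum w (fun=> 1).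
    rewrite vsum_cst_scale; last exact: fsupp_ord.
    by apply: vsum_ext => i; rewrite -ofrealM mulfV ?ofreal1// gt_eqF// rn_gt0.
  pose r' i := r (Ix n i).
  have r'i : injective r'.
    by move=> i j /ri ij; apply: gi; rewrite /g ij.
  have [e1 e2] : eqv C (z \o r') (unitize w).
    have := eqv_reindex (f := fun i : 'I_n.+1 => Ix n i) _ e.
    by apply=> i j ij; apply: gi; rewrite /g ij.
  have fa : fsupp a by exact: fsupp_ord.
  have {}e1 := e1 _ fa; have {}e2 := e2 _ fa; rewrite aw in e1 e2.
  have [p1 p2] : rn (vsum (z \o r') a) <= M * h `^ p^-1 /\ h `^ p^-1 <= M * rn (vsum (z \o r') a).
    rewrite -vsum_push//.
    have sa : supp_in (enum 'I_n.+1) a.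
      by split; rewrite ?enum_uniq// => i; rewrite mem_enum.
    have := zp (push_supp r'i sa); rewrite /pnorm big_map big_enum.
    rewrite (eq_bigr (fun i => rn (w i) `^ p)); first by [].
    by move=> i _; rewrite push_in// absv_ofreal ger0_norm ?rn_ge0.
  have [G1 G2] := wG (fun=> 1).
  set g1 := G (fun=> 1) in G1 G2.
  have g10 : 0 <= g1 by exact: G0.
  have hG : h <= T * g1.
    apply: powR_root_le; rewrite ?mulr_ge0//.
    rewrite (le_trans p2)// -!mulrA ler_wpM2l// (le_trans e1)// ler_wpM2l//.
  have Gh : g1 <= T * h.
    apply: powR_root_le; rewrite ?mulr_ge0//.
    rewrite (le_trans G2)// -!mulrA ler_wpM2l// (le_trans e2)// ler_wpM2l//.
  have l1 : l2norm (fun _ : 'I_n.+1 => 1 : K) `^ p = n.+1%:R `^ (p / 2) :> R.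
    rewrite /l2norm; under eq_bigr do rewrite absv1 expr1n.
    by rewrite sumr_const card_ord -powR12_sqrt// -powRrM mulrC.
  have k1 := khintchine (fun _ : 'I_n.+1 => 1 : K) p0.
  have k2 := fourier_bound (rademacher (fun _ : 'I_n.+1 => 1 : K)) p0 q0 pq.
  have fr : fourier (rademacher (fun _ : 'I_n.+1 => 1 : K)) = fun=> 1.
    by apply/funext => i; exact: fourier_rademacher.
  rewrite -/g1 l1 natrX -/W in k1; rewrite -/g1 fr l1 natrX -/W -/A0 in k2.
  split.
    move: (khintchine_constant p) k1 => c k1.
    rewrite -(ler_pM2r W0) (le_trans Wh)// -!mulrA ler_wpM2l// (le_trans hG)// ler_wpM2l//.
    by rewrite (le_trans k1)// mulrC mulrA.
  rewrite -(ler_pM2r W0) mulrC (le_trans k2)// -!mulrA ler_wpM2l ?powR_ge0// (le_trans Gh)//.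
  by rewrite ler_wpM2l.
have nR (n : nat) : n%:R = n%:R `^ 1 :> R by rewrite powRr1.
have l1 : 1 <= p / 2.
  by apply: powR_exponent_le => -[//|n] _; rewrite -nR; exact: (key n).1.
have l2 : p / 2 <= 1.
  by apply: powR_exponent_le => -[//|n] _; rewrite -nR; exact: (key n).2.
lra.
Qed.

End PowerType.
End RademacherBlocks.

(** * Identification of the basis, and the theorem *)

Section Assembly.
Variables (R : realType) (k : scalar_kind).
Local Notation K := (scalars R k).
Local Notation absv := (@absv R k).
Local Notation ofreal := (@ofreal R k).

Section Spreading.
Variables (X : completeNormedModType K) (Y : set X) (z : nat -> X) (C D : R).
Hypotheses (bz : normalized_unconditional_basis Y z) (uz : uncond D z) (zY : closed_span z = Y)
  (Yu : unique_normalized_unconditional_basis Y) (C0 : 0 <= C) (sz : spreading C z).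

Let nz i : rn (z i) = 1. Proof. exact: (normalized_rn bz.1). Qed.
Let z0 i : z i != 0.
Proof. by apply/eqP => zi; have := nz i; rewrite zi rn0 => /eqP; rewrite eq_sym oner_eq0. Qed.
Let D0 : 0 <= D. Proof. by apply: le_trans (uncond_ge1 (z0 0%N) uz). Qed.

Lemma pnorm_trunc (p : R) n (a : nat -> K) :
  pnorm p (iota 0 n) (trunc n a) = (\sum_(i < n) absv (a i) `^ p) `^ p^-1.
Proof.
rewrite /pnorm (_ : iota 0 n = index_iota 0 n); last by rewrite /index_iota subn0.
rewrite big_mkord; congr (_ `^ _).
by apply: eq_bigr => i _; rewrite /trunc ltn_ord.
Qed.

Lemma power_type_trunc (p M : R) n (a : nat -> K) : power_type z p M ->
  rn (vsum z (trunc n a)) <= M * (\sum_(i < n) absv (a i) `^ p) `^ p^-1 /\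
  (\sum_(i < n) absv (a i) `^ p) `^ p^-1 <= M * rn (vsum z (trunc n a)).
Proof.
by move=> zp; rewrite -pnorm_trunc; apply: zp; apply: supp_in_iota => i; exact: trunc_out.
Qed.

Lemma bounded_fundamental_c0 Q : (forall n, fundamental z n <= Q) ->
  perm_equivalent z (@c0_unit_basis R k).
Proof.
move=> lamQ; have Q0 : 0 <= Q by apply: le_trans (lamQ 0%N); exact: fundamental_ge0.
have DQ0 : 0 <= D * Q by exact: mulr_ge0.
apply: (@perm_equivalent_c0 _ _ _ _ (D * Q + D) D) => //; first exact: addr_ge0.
  move=> a B fa aB; have B0 : 0 <= B by apply: le_trans (aB 0%N); exact: absv_ge0.
  have [n an] := fsupp_bound fa.
  have h := @uz (trunc n (fun=> ofreal B)) a (fsupp_trunc _ _).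
  have {h} : rn (vsum z a) <= D * rn (vsum z (trunc n (fun=> ofreal B))).
    apply: h => i; rewrite /trunc; case: ltnP => [_|/an ->]; last by rewrite absv0.
    by rewrite absv_ofreal ger0_norm.
  move/le_trans; apply.
  rewrite vsum_trunc -scaler_sumr rnZ absv_ofreal ger0_norm//.
  rewrite mulrCA mulrC ler_wpM2r//.
  by apply: (@le_trans _ _ (D * Q)); [apply: ler_wpM2l => //; exact: lamQ|rewrite lerDl].
move=> a i fa; have := coord_le i uz fa; rewrite nz mulr1 => /le_trans; apply.
by rewrite ler_wpM2r ?rn_ge0// lerDr.
Qed.

Lemma spreading_basis_classification :
  [\/ perm_equivalent z (@c0_unit_basis R k), perm_equivalent z (@l1_unit_basis R k)
    | perm_equivalent z (@l2_unit_basis R k)].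
Proof.
have [al [Q Q1 [al0 al1 lamP]]] := fundamental_power bz uz zY Yu C0 sz.
have [alz|aln] := eqVneq al 0.
  apply: Or31; apply: (@bounded_fundamental_c0 Q) => -[|n].
    by rewrite /fundamental big_ord0 rn0 (le_trans ler01 Q1).
  by have [+ _] := lamP n.+1 isT; rewrite alz powRr0 mulr1.
have {aln}al0 : 0 < al by rewrite lt_neqAle eq_sym aln.
have [M M1 zp] := power_estimate bz uz zY Yu C0 sz al0 al1 Q1 lamP.
have M0 : 0 <= M by exact: le_trans M1.
have [al1E|aln1] := eqVneq al 1.
  rewrite al1E invr1 in zp; apply: Or32.
  have E n (a : nat -> K) : (\sum_(i < n) absv (a i) `^ 1) `^ 1^-1 = \sum_(i < n) absv (a i) :> R.
    rewrite invr1 powRr1; first by apply: eq_bigr => i _; rewrite powRr1 ?absv_ge0.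
    by apply: sumr_ge0 => i _; exact: powR_ge0.
  apply: (@perm_equivalent_l1 _ _ _ _ M D) => // n a;
    by have := power_type_trunc n a zp; rewrite E => -[].
have {aln1}al1 : al < 1 by rewrite lt_neqAle aln1.
have p2 : al^-1 = 2.
  (* As al < 1, the exponent conjugate to 1 / al is the finite number 1 / (1 - al). *)
  have q0 : 0 < 1 - al by rewrite subr_gt0.
  apply: (@power_type_exponent _ _ _ _ z D _ (1 - al)^-1 M bz uz zY Yu) => //; rewrite ?invr_gt0//.
  by rewrite !invrK addrC subrK.
rewrite p2 in zp; apply: Or33.
have E n (a : nat -> K) : (\sum_(i < n) absv (a i) `^ 2) `^ 2^-1 = Num.sqrt (\sum_(i < n) absv (a i) ^+ 2) :> R.
  rewrite powR12_sqrt; last by apply: sumr_ge0 => i _; exact: powR_ge0.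
  by congr Num.sqrt; apply: eq_bigr => i _; rewrite powR_mulrn ?absv_ge0.
apply: (@perm_equivalent_l2 _ _ _ _ M D) => // n a;
  by have := power_type_trunc n a zp; rewrite E => -[].
Qed.

End Spreading.

End Assembly.

Theorem theorem3p1 (R : realType) (k : scalar_kind) (n : nat)
    (X : completeNormedModType (scalars R k)) (n_gt0 : (0 < n)%N)
    (genusX : genus n X) (Y : set X) (x : nat -> X)
    (complY : complemented Y) (basis_x : normalized_unconditional_basis Y x) :
  exists2 phi : nat -> nat, {homo phi : i j / (i < j)%N} &
    [\/ perm_equivalent (x \o phi) (@c0_unit_basis R k),
        perm_equivalent (x \o phi) (@l1_unit_basis R k)
      | perm_equivalent (x \o phi) (@l2_unit_basis R k)].
Proof.
have [D ux] := unconditional_constant complY basis_x.2.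
have x0 := unconditional_basis_nonzero complY basis_x.2.
have nx := normalized_rn basis_x.1.
have D1 := uncond_ge1 (x0 0%N) ux.
have D0 : 0 <= D by exact: le_trans D1.
have [phi phii minphi] := minimal_subsequence genusX complY basis_x.
have phi_inj := incr_inj phii.
have [m mi asym] := asymptotic_subsequence D1 (uncond_reindex phi_inj ux) (fun i => nx (phi i)).
have DD0 : 0 <= 2 * D ^+ 3 by rewrite mulr_ge0 ?exprn_ge0.
have [m' m'i [C C0 sz]] : exists2 m', incr m' & exists2 C : R, 0 <= C & spreading C (x \o phi \o m \o m').
  apply: (spreading_subsequence DD0 asym) => psi psii.
  (* Self-similarity passes from [phi] to [phi \o m]: all of [x \o phi] embeds in the subsequence
     given by [m \o psi], and the embedding is restricted to the range of [m]. *)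
  have [s si [C C0 e]] := minphi _ (incr_comp mi psii).
  exists (s \o m); first exact: inj_comp si (incr_inj mi).
  by exists C => //; exact: (eqv_reindex (incr_inj mi) e).
pose th := phi \o m \o m'.
have thi : incr th by apply: incr_comp m'i; exact: incr_comp.
exists th => //.
have [_ bz] := subsequence_basis complY basis_x thi.
exact: (spreading_basis_classification bz (uncond_reindex (incr_inj thi) ux) erefl
  (subsequence_unique genusX complY basis_x thi) C0 sz).
Qed.
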